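(* For all $p \in [1,\infty)\setminus 2\mathbb{Z}$, all integers $k > \max\{2,p\}$, and all $1 - 2^{-k} < s \le c \le 1$, there exists a polynomial-time (Karp) reduction from $(s,c)$-Gap-$k$-SAT instances on $n$ variables to $\gamma$-$\mathrm{CVP}_p$ instances of rank $n$, with $\gamma=\gamma(p,k,s,c)$ satisfying \[ \gamma \ge 1 + \frac{2^{k-1}}{2^k-1}\cdot (c-s)\cdot \frac{|\sin(\pi p/2)|}{4p^3k}\cdot\Big(\frac{2p}{e^2\pi^2k}\Big)^{(p+1)/2}. \] In particular, for all $p\in[1,\infty)\setminus 2\mathbb{Z}$ and every $\varepsilon>0$ there exists $\gamma = \gamma(p,\varepsilon,s,c) > 1$ such that there is no $2^{(1-\varepsilon)n}$-time algorithm for $\gamma$-$\mathrm{CVP}_p$ (on lattices of rank $n$) assuming Gap-SETH.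
   Context: For $1\le p<\infty$, $\|\vec x\|_p=(\sum_i|x_i|^p)^{1/p}$. A lattice of rank $n$ is $B\mathbb{Z}^n$ for $B\in\mathbb{R}^{d\times n}$ with linearly independent columns, and $\mathrm{dist}_p(\mathcal{L},\vec t)=\min_{\vec x\in\mathcal{L}}\|\vec x-\vec t\|_p$. $\gamma$-$\mathrm{CVP}_p$: given $B$, $\vec t$, $r>0$, distinguish $\mathrm{dist}_p(B\mathbb{Z}^n,\vec t)\le r$ (YES) from $\mathrm{dist}_p(B\mathbb{Z}^n,\vec t)>\gamma r$ (NO). A $k$-SAT instance is a conjunction of $m$ clauses, each a disjunction of $k$ literals over $n$ boolean variables; its value $\mathrm{val}$ is the maximum fraction of clauses satisfied by an assignment. $(s,c)$-Gap-$k$-SAT: distinguish $\mathrm{val}\ge c$ (YES) from $\mathrm{val}<s$ (NO). A Karp reduction maps YES to YES and NO to NO. Gap-SETH: for every $\varepsilon>0$ there exist $k\in\mathbb{Z}^+$ and $\delta>0$ such that no algorithm can distinguish, in time $2^{(1-\varepsilon)n}$, a satisfiable $k$-SAT formula on $n$ variables from one with value less than $1-\delta$. *)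

(* Defs.v *)
From HB Require Import structures.
From mathcomp Require Import all_boot all_order all_algebra.
From mathcomp Require Import all_classical all_reals all_analysis.

Set Implicit Arguments.
Unset Strict Implicit.
Unset Printing Implicit Defensive.

Import Order.TTheory GRing.Theory Num.Theory.
Import numFieldNormedType.Exports.

Local Open Scope ring_scope.

(** * Lattices and the closest vector problem *)

Definition lpnorm (R : realType) (p : R) (d : nat) (x : 'cV[R]_d) : R :=
  (\sum_(i < d) `|x i 0| `^ p) `^ p^-1.

Definition lattice (R : realType) (d n : nat) (B : 'M[R]_(d, n)) :
    set 'cV[R]_d :=
  range (fun z : 'cV[int]_n => B *m map_mx intr z).

(* For B with linearly independent columns the infimum is a minimum. *)
Definition dist (R : realType) (p : R) (d : nat) (L : set 'cV[R]_d)
    (t : 'cV[R]_d) : R :=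
  inf [set lpnorm p (x - t) | x in L]%classic.

(* (B, t, r) is an instance of CVP of rank n: the columns of B are linearly
   independent, and r > 0. *)
Definition cvp_instance (R : realType) (d n : nat) (B : 'M[R]_(d, n))
    (t : 'cV[R]_d) (r : R) : Prop :=
  row_free B^T /\ 0 < r.

Definition cvp_yes (R : realType) (p : R) (d n : nat) (B : 'M[R]_(d, n))
    (t : 'cV[R]_d) (r : R) : Prop :=
  dist p (lattice B) t <= r.

Definition cvp_no (R : realType) (p gamma : R) (d n : nat)
    (B : 'M[R]_(d, n)) (t : 'cV[R]_d) (r : R) : Prop :=
  gamma * r < dist p (lattice B) t.

(** * k-SAT *)

(* The literal (i, b) is satisfied when variable i has value b.  Repeated
   literals in a clause and repeated clauses in a formula are allowed. *)
Definition literal (n : nat) : Type := ('I_n * bool)%type.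
Definition formula (k n : nat) : Type := seq (k.-tuple (literal n)).

Definition sat_clause (k n : nat) (a : {ffun 'I_n -> bool})
    (C : k.-tuple (literal n)) : bool :=
  has (fun l : literal n => a l.1 == l.2) C.

Definition satisfiable (k n : nat) (phi : formula k n) : Prop :=
  exists a : {ffun 'I_n -> bool}, all (sat_clause a) phi.

(* Only used for formulas with at least one clause. *)
Definition val_sat (R : realType) (k n : nat) (phi : formula k n) : R :=
  (\max_(a : {ffun 'I_n -> bool}) count (sat_clause a) phi)%:R
    / (size phi)%:R.

(** * Random access machines

  Programs act on finitely many natural-number arrays and finitely many real
  arrays.  Operations on naturals, and every use of an address, are charged
  their bit length (the logarithmic cost criterion).  Operations on reals are
  exact and are charged one unit, as on a real RAM; a program may contain
  finitely many real constants.  Programs satisfying [discrete] do not touch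
  the reals, and are ordinary random access machines with logarithmic cost. *)

(* Direct a is cell 0 of array a; Indirect a b is the cell of array a whose
   index is the content of cell 0 of the natural-number array b. *)
Inductive addr : Type :=
| Direct (a : nat)
| Indirect (a b : nat).

Inductive nat_op : Type := NAdd | NSub | NMul | NDiv.
Inductive real_op : Type := RAdd | RSub | RMul | RDiv | RPow.

Inductive prog (R : realType) : Type :=
| Skip
| NConst (x : addr) (m : nat)
| NOp (o : nat_op) (x y z : addr)
| RConst (x : addr) (u : R)
| ROfNat (x y : addr)
| ROp (o : real_op) (x y z : addr)
| Seq (P Q : prog R)
| IfNLe (y z : addr) (P Q : prog R)
| IfRLe (y z : addr) (P Q : prog R)
| WhileNLt (y z : addr) (P : prog R).

Arguments Skip {R}.
Arguments NConst {R}.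
Arguments NOp {R}.
Arguments ROfNat {R}.
Arguments ROp {R}.

Fixpoint discrete (R : realType) (P : prog R) : bool :=
  match P with
  | Skip | NConst _ _ | NOp _ _ _ _ => true
  | RConst _ _ | ROfNat _ _ | ROp _ _ _ _ | IfRLe _ _ _ _ => false
  | Seq P1 P2 | IfNLe _ _ P1 P2 => discrete P1 && discrete P2
  | WhileNLt _ _ P1 => discrete P1
  end.

Record state (R : realType) : Type := State {
  nats : nat -> nat -> nat;
  reals : nat -> nat -> R
}.

Definition bits (m : nat) : nat := (trunc_log 2 m).+1.

Definition index_of (R : realType) (s : state R) (x : addr) : nat * nat :=
  match x with
  | Direct a => (a, 0%N)
  | Indirect a b => (a, nats s b 0%N)
  end.

Definition nget (R : realType) (s : state R) (x : addr) : nat :=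
  nats s (index_of s x).1 (index_of s x).2.

Definition rget (R : realType) (s : state R) (x : addr) : R :=
  reals s (index_of s x).1 (index_of s x).2.

Definition update (T : Type) (f : nat -> nat -> T) (ai : nat * nat) (v : T) :
    nat -> nat -> T :=
  fun a i => if (a, i) == ai then v else f a i.

Definition nset (R : realType) (s : state R) (x : addr) (v : nat) : state R :=
  State (update (nats s) (index_of s x) v) (reals s).

Definition rset (R : realType) (s : state R) (x : addr) (v : R) : state R :=
  State (nats s) (update (reals s) (index_of s x) v).

Definition nat_op_fun (o : nat_op) : nat -> nat -> nat :=
  match o with
  | NAdd => addn
  | NSub => subn
  | NMul => muln
  | NDiv => divn
  end.

Definition real_op_fun (R : realType) (o : real_op) (u v : R) : R :=
  match o with
  | RAdd => u + v
  | RSub => u - v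
  | RMul => u * v
  | RDiv => u / v
  | RPow => u `^ v
  end.

Definition addr_cost (R : realType) (s : state R) (x : addr) : nat :=
  bits (index_of s x).2.

Definition nread_cost (R : realType) (s : state R) (x : addr) : nat :=
  (addr_cost s x + bits (nget s x))%N.

Definition rread_cost (R : realType) (s : state R) (x : addr) : nat :=
  (addr_cost s x + 1)%N.

(* exec P s N s': started in s, the program P halts in s' at total cost N. *)
Inductive exec (R : realType) :
    prog R -> state R -> nat -> state R -> Prop :=
| exec_skip s : exec Skip s 1%N s
| exec_nconst x m s :
    exec (NConst x m) s (addr_cost s x + bits m)%N (nset s x m)
| exec_nop o x y z s :
    exec (NOp o x y z) s (addr_cost s x + nread_cost s y + nread_cost s z)%N
      (nset s x (nat_op_fun o (nget s y) (nget s z)))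
| exec_rconst x u s :
    exec (RConst x u) s (addr_cost s x + 1)%N (rset s x u)
| exec_rofnat x y s :
    exec (ROfNat x y) s (addr_cost s x + nread_cost s y)%N
      (rset s x (nget s y)%:R)
| exec_rop o x y z s :
    exec (ROp o x y z) s (addr_cost s x + rread_cost s y + rread_cost s z)%N
      (rset s x (real_op_fun o (rget s y) (rget s z)))
| exec_seq P Q s s1 s2 N1 N2 :
    exec P s N1 s1 -> exec Q s1 N2 s2 -> exec (Seq P Q) s (N1 + N2)%N s2
| exec_ifn y z P Q s s1 N :
    exec (if (nget s y <= nget s z)%N then P else Q) s N s1 ->
    exec (IfNLe y z P Q) s (nread_cost s y + nread_cost s z + N)%N s1
| exec_ifr y z P Q s s1 N :
    exec (if rget s y <= rget s z then P else Q) s N s1 ->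
    exec (IfRLe y z P Q) s (rread_cost s y + rread_cost s z + N)%N s1
| exec_while_stop y z P s :
    (nget s z <= nget s y)%N ->
    exec (WhileNLt y z P) s (nread_cost s y + nread_cost s z)%N s
| exec_while_step y z P s s1 s2 N1 N2 :
    (nget s y < nget s z)%N ->
    exec P s N1 s1 -> exec (WhileNLt y z P) s1 N2 s2 ->
    exec (WhileNLt y z P) s
      (nread_cost s y + nread_cost s z + N1 + N2)%N s2.

(* The input word is placed in natural-number array 0. *)
Definition init_state (R : realType) (w : seq nat) : state R :=
  State (fun a i => if a == 0%N then nth 0%N w i else 0%N) (fun _ _ => 0).

Definition accepting (R : realType) (s : state R) : Prop := nats s 0%N 0%N <> 0%N.

(** * Encodings of instances *)

Definition enc_literal (n : nat) (l : literal n) : nat :=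
  ((l.1 : nat).*2 + l.2)%N.

Definition enc_formula (k n : nat) (phi : formula k n) : seq nat :=
  [:: n, size phi &
    flatten [seq map (@enc_literal n) C | C : k.-tuple (literal n) <- phi]].

Definition enc_rat (x : rat) : seq nat :=
  [:: nat_of_bool (x < 0)%R; `|numq x|%N; `|denq x|%N].

Definition enc_cvp (d n : nat) (B : 'M[rat]_(d, n)) (t : 'cV[rat]_d)
    (r : rat) : seq nat :=
  [:: n, d &
    enc_rat r ++
    flatten [seq enc_rat (t i 0) | i <- enum 'I_d] ++
    flatten [seq enc_rat (B i j) | i <- enum 'I_d, j <- enum 'I_n]].

Definition word_size (w : seq nat) : nat := (\sum_(x <- w) bits x)%N.

Definition outputs_cvp (R : realType) (s : state R) (d n : nat)
    (B : 'M[R]_(d, n)) (t : 'cV[R]_d) (r : R) : Prop :=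
  [/\ nats s 0%N 0%N = n /\ nats s 0%N 1%N = d,
      reals s 0%N 0%N = r,
      forall i : 'I_d, reals s 1%N i = t i 0
    & forall (i : 'I_d) (j : 'I_n), reals s 2%N (i * n + j)%N = B i j].

(** * Reductions and algorithms *)

(* A bound by some polynomial is expressed as a * (N + 1) ^ a for some a. *)
Definition poly_bound (a N : nat) : nat := (a * N.+1 ^ a)%N.

(* The dimension d is bounded as well, so that the instance B, t, r (and not
   just the part of it written explicitly) has polynomial size. *)
Definition karp_reduction_gapsat_cvp (R : realType) (k : nat)
    (s c p gamma : R) : Prop :=
  exists (P : prog R) (a : nat), forall (n : nat) (phi : formula k n),
    (0 < size phi)%N ->
    exists (N : nat) (st : state R) (d : nat) (B : 'M[R]_(d, n))
           (t : 'cV[R]_d) (r : R),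
      [/\ exec P (init_state R (enc_formula phi)) N st,
          (N + d <= poly_bound a (n + size phi))%N,
          outputs_cvp st B t r /\ cvp_instance B t r,
          c <= val_sat R phi -> cvp_yes p B t r
        & val_sat R phi < s -> cvp_no p gamma B t r].

(* P halts on w within time 2 ^ ((1 - eps) n) times a polynomial in sz, and
   accepts (rejects) if yes (no) holds. *)
Definition decides_within (R : realType) (P : prog R) (eps : R)
    (n a sz : nat) (w : seq nat) (yes no : Prop) : Prop :=
  exists (N : nat) (st : state R),
    [/\ exec P (init_state R w) N st,
        N%:R <= 2 `^ ((1 - eps) * n%:R) * (poly_bound a sz)%:R,
        yes -> accepting st
      & no -> ~ accepting st].

(* P distinguishes satisfiable k-SAT formulas from those of value less than
   1 - delta. *)
Definition gap_sat_algorithm (R : realType) (k : nat) (delta eps : R)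
    (P : prog R) : Prop :=
  discrete P /\
  exists a : nat, forall (n : nat) (phi : formula k n),
    (0 < size phi)%N ->
    decides_within P eps n a (n + size phi) (enc_formula phi)
      (satisfiable phi) (val_sat R phi < 1 - delta).

Definition Gap_SETH (R : realType) : Prop :=
  forall eps : R, 0 < eps ->
  exists (k : nat) (delta : R), [/\ (0 < k)%N, 0 < delta &
    ~ exists P : prog R, gap_sat_algorithm k delta eps P].

(* A discrete machine receives rational instances; hardness on these implies
   hardness on all instances. *)
Definition cvp_algorithm (R : realType) (p gamma eps : R) (P : prog R) :
    Prop :=
  discrete P /\
  exists a : nat, forall (n d : nat) (B : 'M[rat]_(d, n)) (t : 'cV[rat]_d)
    (r : rat),
    let B' := map_mx (ratr : rat -> R) B in
    let t' := map_mx (ratr : rat -> R) t in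
    let r' : R := ratr r in
    cvp_instance B' t' r' ->
    decides_within P eps n a (word_size (enc_cvp B t r)) (enc_cvp B t r)
      (cvp_yes p B' t' r') (cvp_no p gamma B' t' r').

(* Main.v *)
(* The gadget for a clause is a finite family of affine forms in y in {1, -1}^k
   whose l_p cost is 1 if some y_i = 1 and 1 + rho if all y_i = -1.  Its rows are
   W_w (theta_j <w, y> + tau_j) for w in {-1, 0, 1}^k with j nonzero entries, and
   the weights W_w are nonnegative as soon as, for each j <= k, the iterated
   difference of |x|^p is at least rho times its iterated mean at some point.
   For j <= p this is the mean value theorem.  For j > p, which needs p not even,
   |x|^p is an integral of remainders of the Taylor expansion of cos, so that its
   iterated differences are integrals of powers of sin.  Rows alpha y_i make
   |y_i| >= 3 expensive.  A lattice point gives the values y_i = +-(2 x_v - 1),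
   and the cost is then a sum of gadget costs over the clauses.

   For the hardness under Gap-SETH the gadget is rounded to integers, and the
   radius (m C)^(1/p), which need not be computable for a given p, is found with
   the assumed CVP algorithm itself: the formula obtained by making all literals
   positive is satisfiable, and the least q for which the algorithm accepts its
   instance with radius E q approximates the distance up to the factor gamma.
   The algorithm is run repeatedly on fresh memory, run j using the indices
   congruent to j modulo J of the odd arrays. *)

Require Import Defs.
From mathcomp Require Import all_boot all_order all_algebra.
From mathcomp Require Import all_classical all_reals all_analysis.
From mathcomp Require Import measurable_realfun.
From mathcomp Require Import ring lra zify.

Set Implicit Arguments.
Unset Strict Implicit.
Unset Printing Implicit Defensive.

Import Order.TTheory GRing.Theory Num.Theory.
Import numFieldNormedType.Exports.

(** * Random access machines *)

(** The indicator of the one falsifying sign vector is $2^{-k}\prod_i(1-y_i)$. Its part of degree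
    $j$ is an elementary symmetric polynomial, and differences of order $j$ of $|x|^p$, summed over
    all supports of size $j$, reproduce it on sign vectors. Differences alone would give half of the
    rows a negative weight; the iterated mean, constant on sign vectors, is added to make up for
    this, so $\rho$ is limited by the worst ratio of difference to mean. For even $p$ a difference
    of order above $p$ vanishes, and $|\sin(\pi p/2)|$ measures how far $p$ is from that. In
    $\gamma$, a factor $1/p$ comes from the p-th root and $1/k$ from the cost of the penalty rows.
    For the second claim every approximation must fit into the gap $1+\delta\rho/C$ of the p-th
    powers. It is split into eight equal factors $x$, and $\gamma=x^{1/p}$. The other factors pay
    for rounding the gadget, for the spread of the calibrating distance, for the two inexact answers
    of the CVP algorithm, for the step of the radius search and for rounding the ratio of the two
    radii. *)

Section PolyBounds.

Definition is_poly (f : nat -> nat) := exists a, forall V, f V <= poly_bound a V.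

Lemma is_poly_le f g : (forall V, f V <= g V) -> is_poly g -> is_poly f.
Proof. by move=> fg [a ga]; exists a => V; exact: leq_trans (fg V) (ga V). Qed.

Lemma leq_poly_bound a b V W : a <= b -> V <= W -> poly_bound a V <= poly_bound b W.
Proof.
move=> ab VW; apply: leq_mul => //; apply: (@leq_trans (W.+1 ^ a)).
  by case: (a) => // a'; rewrite leq_exp2r.
by rewrite leq_pexp2l.
Qed.

Lemma is_polyC c : is_poly (fun=> c).
Proof. by exists c => V; rewrite leq_pmulr // expn_gt0. Qed.

Lemma is_poly_id : is_poly id.
Proof. by exists 1 => V; rewrite /poly_bound mul1n expn1. Qed.

Lemma is_polyD f g : is_poly f -> is_poly g -> is_poly (fun V => f V + g V).
Proof.
move=> [a fa] [b gb]; exists (a + b) => V; rewrite /poly_bound mulnDl.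
apply: leq_add; [apply: leq_trans (fa V) _|apply: leq_trans (gb V) _];
  by rewrite leq_mul // leq_pexp2l // ?leq_addr ?leq_addl.
Qed.

Lemma is_polyM f g : is_poly f -> is_poly g -> is_poly (fun V => f V * g V).
Proof.
move=> [a fa] [b gb]; exists (a * b + (a + b)) => V.
apply: leq_trans (leq_mul (fa V) (gb V)) _; rewrite /poly_bound mulnACA -expnD.
by rewrite leq_mul ?leq_addr // leq_pexp2l // leq_addl.
Qed.

Lemma is_poly_comp f g : is_poly f -> is_poly g -> is_poly (fun V => f (g V)).
Proof.
move=> [a fa] [b gb]; exists (a * b.+1 ^ a + b * a) => V.
apply: leq_trans (fa _) _.
have H : (g V).+1 <= b.+1 * V.+1 ^ b.
  by rewrite mulSn -add1n leq_add ?expn_gt0 //; exact: gb.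
apply: (@leq_trans (a * (b.+1 * V.+1 ^ b) ^ a)).
  by rewrite leq_mul2l; case: (a) => // a'; rewrite leq_exp2r // H orbT.
rewrite expnMn -expnM mulnA /poly_bound.
by rewrite leq_mul ?leq_addr // leq_pexp2l // leq_addl.
Qed.

End PolyBounds.

(** * Expressions over arrays of naturals, with bounds on value and cost *)

Section Expressions.

(** Programs are composed of assignments and loops over such expressions: correctness then concerns
    [neval] alone, and costs follow from the syntax. *)
Inductive nexp : Type :=
| NC (m : nat)
| NV (a : nat)
| NR (a : nat) (e : nexp)
| NB (o : nat_op) (e1 e2 : nexp).

Fixpoint neval (f : nat -> nat -> nat) (e : nexp) : nat :=
  match e with
  | NC m => m
  | NV a => f a 0
  | NR a e => f a (neval f e)
  | NB o e1 e2 => nat_op_fun o (neval f e1) (neval f e2)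
  end.

(* The even arrays below 32 hold the variables of our programs, the even arrays
   from 32 on are scratch cells; the odd arrays are left to simulated programs. *)
Definition own (a : nat) : bool := ~~ odd a && (a < 32).
Definition tmp (d : nat) : nat := (16 + d).*2.
Definition scratch (d a : nat) : bool := ~~ odd a && (tmp d <= a).

Fixpoint nwf (e : nexp) : bool :=
  match e with
  | NC _ => true
  | NV a => own a
  | NR a e => own a && nwf e
  | NB _ e1 e2 => nwf e1 && nwf e2
  end.

Fixpoint nreads (b : nat) (e : nexp) : bool :=
  match e with
  | NC _ => false
  | NV a => a == b
  | NR a e => (a == b) || nreads b e
  | NB _ e1 e2 => nreads b e1 || nreads b e2
  end.

Lemma neval_ext f g e : nwf e ->
  (forall a i, own a -> nreads a e -> f a i = g a i) -> neval f e = neval g e.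
Proof.
elim: e => [m|a|a e IH|o e1 IH1 e2 IH2] //=.
- by move=> oa fg; rewrite fg.
- move=> /andP[oa we] fg; rewrite (IH we) ?fg ?eqxx // => b i ob rb.
  by apply: fg => //; rewrite rb orbT.
- move=> /andP[w1 w2] fg; rewrite (IH1 w1) ?(IH2 w2) // => b i ob rb; apply: fg => //;
  by rewrite rb ?orbT.
Qed.

(** Meant for memories whose variables are at most [V]. The product of successors dominates sum,
    difference, product and quotient at once. *)
Fixpoint ebd (e : nexp) (V : nat) : nat :=
  match e with
  | NC m => m
  | NV _ => V
  | NR _ e => V + ebd e V
  | NB _ e1 e2 => (ebd e1 V).+1 * (ebd e2 V).+1
  end.

(** Lengths enter through the crude bound [bits m <= m.+1], which is good enough for polynomiality
    in [V]. *)
Fixpoint ecost (e : nexp) (V : nat) : nat :=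
  match e with
  | NC m => m + 2
  | NV _ => V + 8
  | NR _ e => ecost e V + (V + ebd e V) + 20
  | NB _ e1 e2 => ecost e1 V + ecost e2 V + ebd e1 V + ebd e2 V + 10
  end.

Lemma is_poly_ebd e : is_poly (ebd e).
Proof.
elim: e => [m|a|a e IH|o e1 IH1 e2 IH2] /=.
- exact: is_polyC.
- exact: is_poly_id.
- by apply: is_polyD => //; exact: is_poly_id.
- apply: is_polyM; [apply: (is_poly_le (g := fun V => ebd e1 V + 1))|
    apply: (is_poly_le (g := fun V => ebd e2 V + 1))];
  by [move=> V; rewrite addn1 | apply: is_polyD => //; exact: is_polyC].
Qed.

Lemma is_poly_ecost e : is_poly (ecost e).
Proof.
have pe := is_poly_ebd.
elim: e => [m|a|a e IH|o e1 IH1 e2 IH2] /=.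
- exact: is_polyC.
- by apply: is_polyD; [exact: is_poly_id|exact: is_polyC].
- apply: is_polyD; last exact: is_polyC; apply: is_polyD => //.
  by apply: is_polyD => //; exact: is_poly_id.
- by do !apply: is_polyD => //; exact: is_polyC.
Qed.

Lemma bits_le m : bits m <= m.+1.
Proof.
rewrite ltnS; case: m => // m; apply: ltnW.
exact: leq_trans (ltn_expl _ _) (trunc_logP _ _).
Qed.

End Expressions.

(** * Compilation of expressions, assignments and counted loops *)

Section Compilation.
Variable R : realType.
Implicit Types (s : state R) (P : prog R) (e : nexp).

(** The scratch cells act as a stack: code at depth [d] writes only from cell [d] upwards, so
    operands computed earlier survive. The machine has no move instruction; a copy is an addition to
    0. *)
Fixpoint ncomp (e : nexp) (d : nat) : prog R :=
  match e with
  | NC m => NConst (Direct (tmp d)) m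
  | NV a => Seq (NConst (Direct (tmp d)) 0)
                (NOp NAdd (Direct (tmp d)) (Direct (tmp d)) (Direct a))
  | NR a e => Seq (ncomp e d) (Seq (NConst (Direct (tmp d.+1)) 0)
                (NOp NAdd (Direct (tmp d)) (Direct (tmp d.+1)) (Indirect a (tmp d))))
  | NB o e1 e2 => Seq (ncomp e1 d) (Seq (ncomp e2 d.+1)
                (NOp o (Direct (tmp d)) (Direct (tmp d)) (Direct (tmp d.+1))))
  end.

Definition tsame (d : nat) s s' : Prop :=
  reals s' = reals s /\ forall a i, ~~ scratch d a -> nats s' a i = nats s a i.

Definition bounded (V : nat) s : Prop := forall a i, own a -> nats s a i <= V.

Lemma scratch_tmp d d' : scratch d (tmp d') = (d <= d').
Proof. by rewrite /scratch /tmp odd_double /= leq_double leq_add2l. Qed.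

Lemma own_scratch d a : own a -> ~~ scratch d a.
Proof.
rewrite /own /scratch /tmp => /andP[-> a32] /=; rewrite -ltnNge.
by apply: leq_trans a32 _; rewrite (leq_double 16) leq_addr.
Qed.

Lemma scratchS d a : ~~ scratch d a -> ~~ scratch d.+1 a.
Proof.
by rewrite /scratch; case: (odd a) => //=; rewrite -!ltnNge /tmp addnS doubleS => /leq_trans; apply; lia.
Qed.

Lemma tsame_trans d s1 s2 s3 : tsame d s1 s2 -> tsame d s2 s3 -> tsame d s1 s3.
Proof.
by move=> [r1 n1] [r2 n2]; split => [|a i na]; [rewrite r2|rewrite n2 // n1].
Qed.

Lemma tsameS d s s' : tsame d.+1 s s' -> tsame d s s'.
Proof. by move=> [r n]; split => // a i na; apply: n; exact: scratchS. Qed.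

Lemma tsame_nset d s v : tsame d s (nset s (Direct (tmp d)) v).
Proof.
split => // a i; rewrite /nset /= /update /=.
by case: eqP => // -[-> _]; rewrite scratch_tmp leqnn.
Qed.

Lemma bounded_tsame d V s s' : bounded V s -> tsame d s s' -> bounded V s'.
Proof. by move=> bs [_ n] a i oa; rewrite n ?bs // own_scratch. Qed.

Lemma neval_tsame d s s' e : nwf e -> tsame d s s' ->
  neval (nats s') e = neval (nats s) e.
Proof. by move=> we [_ n]; apply: neval_ext => // a i oa _; rewrite n // own_scratch. Qed.

Lemma neval_bd V (f : nat -> nat -> nat) e : (forall a i, own a -> f a i <= V) ->
  nwf e -> neval f e <= ebd e V.
Proof.
move=> fV; elim: e => [m|a|a e IH|o e1 IH1 e2 IH2] //=.
- exact: fV.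
- by move=> /andP[oa we]; apply: leq_trans (fV _ _ oa) (leq_addr _ _).
- move=> /andP[/IH1 b1 /IH2 b2].
  move: (neval f e1) (neval f e2) (ebd e1 V) (ebd e2 V) b1 b2 => x y X Y xX yY.
  by case: o => /=; nia.
Qed.

Lemma bits0 : bits 0 = 1. Proof. by rewrite /bits trunc_log0. Qed.

Lemma nget_nset_direct s a v : nget (nset s (Direct a) v) (Direct a) = v.
Proof. by rewrite /nget /nset /= /update eqxx. Qed.

Lemma nats_nset_direct s a v : nats (nset s (Direct a) v) a 0 = v.
Proof. exact: nget_nset_direct. Qed.

Lemma acost_direct s a : addr_cost s (Direct a) = 1.
Proof. exact: bits0. Qed.

Lemma acost_indirect s a b : addr_cost s (Indirect a b) = bits (nats s b 0).
Proof. by []. Qed.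

Lemma nget_direct s a : nget s (Direct a) = nats s a 0.
Proof. by []. Qed.

Lemma nget_indirect s a b : nget s (Indirect a b) = nats s a (nats s b 0).
Proof. by []. Qed.

Lemma comp_exec e d s V : nwf e -> bounded V s -> exists N s',
  [/\ exec (ncomp e d) s N s', nats s' (tmp d) 0 = neval (nats s) e,
      tsame d s s' & N <= ecost e V].
Proof.
elim: e d s => [m|a|a e IH|o e1 IH1 e2 IH2] d s.
- move=> _ _; do 2!eexists; split; first exact: exec_nconst.
  + exact: nats_nset_direct.
  + exact: tsame_nset.
  + by rewrite acost_direct /=; have := bits_le m; lia.
- move=> oa bs.
  pose s1 := nset s (Direct (tmp d)) 0.
  have t1 : tsame d s s1 by exact: tsame_nset.
  have ga : nget s1 (Direct a) = nats s a 0 := t1.2 a 0 (own_scratch d oa).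
  have g0 : nget s1 (Direct (tmp d)) = 0 := nget_nset_direct _ _ _.
  do 2!eexists; split.
  + by apply: exec_seq; [exact: exec_nconst|exact: exec_nop].
  + by rewrite nats_nset_direct -/s1 ga g0.
  + exact: tsame_trans t1 (tsame_nset _ _ _).
  + rewrite /nread_cost -/s1 ga g0 !acost_direct bits0 [ecost _ _]/=.
    by have := bits_le (nats s a 0); have := bs a 0 oa; lia.
- move=> /andP[oa we] bs.
  have [N1 [s1 [x1 v1 t1 c1]]] := IH d s we bs.
  pose s2 := nset s1 (Direct (tmp d.+1)) 0.
  have t2 : tsame d.+1 s1 s2 by exact: tsame_nset.
  have v2 : nats s2 (tmp d) 0 = neval (nats s) e by rewrite t2.2 // scratch_tmp ltnn.
  have ga : nget s2 (Indirect a (tmp d)) = nats s a (neval (nats s) e).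
    by rewrite nget_indirect v2 t2.2 ?t1.2 // own_scratch.
  have g0 : nget s2 (Direct (tmp d.+1)) = 0 := nget_nset_direct _ _ _.
  do 2!eexists; split.
  + by apply: exec_seq x1 _; apply: exec_seq; [exact: exec_nconst|exact: exec_nop].
  + by rewrite nats_nset_direct -/s2 ga g0.
  + apply: tsame_trans t1 _; apply: tsame_trans (tsameS t2) _; exact: tsame_nset.
  + rewrite /nread_cost -/s2 ga g0 !acost_direct acost_indirect v2 bits0 [ecost (NR _ _) _]/=.
    have := bits_le (neval (nats s) e); have := bits_le (nats s a (neval (nats s) e)).
    have := neval_bd bs we; have := bs a (neval (nats s) e) oa; lia.
- move=> /andP[w1 w2] bs.
  have [N1 [s1 [x1 v1 t1 c1]]] := IH1 d s w1 bs.
  have [N2 [s2 [x2 v2 t2 c2]]] := IH2 d.+1 s1 w2 (bounded_tsame bs t1).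
  rewrite (neval_tsame w2 t1) in v2.
  have v1' : nats s2 (tmp d) 0 = neval (nats s) e1 by rewrite t2.2 // scratch_tmp ltnn.
  do 2!eexists; split.
  + by apply: exec_seq x1 _; apply: exec_seq x2 _; exact: exec_nop.
  + by rewrite nats_nset_direct !nget_direct v1' v2.
  + apply: tsame_trans t1 _; apply: tsame_trans (tsameS t2) _; exact: tsame_nset.
  + rewrite /nread_cost !acost_direct !nget_direct v1' v2 [ecost (NB _ _ _) _]/=.
    have := bits_le (neval (nats s) e1); have := bits_le (neval (nats s) e2).
    have := neval_bd bs w1; have := neval_bd bs w2; lia.
Qed.

Definition store (a : nat) (e1 e2 : nexp) : prog R :=
  Seq (ncomp e1 0) (Seq (ncomp e2 1) (Seq (NConst (Direct (tmp 2)) 0)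
    (NOp NAdd (Indirect a (tmp 0)) (Direct (tmp 1)) (Direct (tmp 2))))).

Definition scost e1 e2 V : nat :=
  ecost e1 V + ecost e2 V + ebd e1 V + ebd e2 V + 10.

Lemma store_exec a e1 e2 s V : nwf e1 -> nwf e2 -> bounded V s ->
  exists N s', [/\ exec (store a e1 e2) s N s', reals s' = reals s,
    forall b i, ~~ scratch 0 b -> nats s' b i =
      update (nats s) (a, neval (nats s) e1) (neval (nats s) e2) b i
    & N <= scost e1 e2 V].
Proof.
move=> w1 w2 bs.
have [N1 [s1 [x1 v1 t1 c1]]] := comp_exec 0 w1 bs.
have [N2 [s2 [x2 v2 t2 c2]]] := comp_exec 1 w2 (bounded_tsame bs t1).
rewrite (neval_tsame w2 t1) in v2.
pose s3 := nset s2 (Direct (tmp 2)) 0.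
have t3 : tsame 2 s2 s3 by exact: tsame_nset.
have u1 : nats s3 (tmp 0) 0 = neval (nats s) e1.
  by rewrite t3.2 ?scratch_tmp // t2.2 ?scratch_tmp.
have u2 : nats s3 (tmp 1) 0 = neval (nats s) e2 by rewrite t3.2 ?scratch_tmp.
have g0 : nget s3 (Direct (tmp 2)) = 0 := nget_nset_direct _ _ _.
have t : tsame 0 s s3.
  by apply: tsame_trans t1 _; apply: tsame_trans (tsameS t2) _; exact: tsameS (tsameS t3).
do 2!eexists; split.
- apply: exec_seq x1 _; apply: exec_seq x2 _; apply: exec_seq; first exact: exec_nconst.
  exact: exec_nop.
- exact: t.1.
- move=> b i nb; rewrite -/s3 nget_direct u2 g0.
  rewrite [LHS]/(update (nats s3) (a, nats s3 (tmp 0) 0) (neval (nats s) e2 + 0) b i).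
  by rewrite u1 addn0 /update; case: eqP => // _; exact: t.2.
- rewrite /nread_cost -/s3 g0 nget_direct u2 !acost_direct acost_indirect u1 bits0 /scost.
  have := bits_le (neval (nats s) e1); have := bits_le (neval (nats s) e2).
  have := neval_bd bs w1; have := neval_bd bs w2; lia.
Qed.

Inductive rexp : Type :=
| RC (u : R)
| RN (e : nexp)
| RB (o : real_op) (r1 r2 : rexp).

Fixpoint reval (f : nat -> nat -> nat) (r : rexp) : R :=
  match r with
  | RC u => u
  | RN e => (neval f e)%:R
  | RB o r1 r2 => real_op_fun o (reval f r1) (reval f r2)
  end.

Fixpoint rwf (r : rexp) : bool :=
  match r with
  | RC _ => true
  | RN e => nwf e
  | RB _ r1 r2 => rwf r1 && rwf r2
  end.

Fixpoint rreads (b : nat) (r : rexp) : bool :=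
  match r with
  | RC _ => false
  | RN e => nreads b e
  | RB _ r1 r2 => rreads b r1 || rreads b r2
  end.

Fixpoint rcost (r : rexp) (V : nat) : nat :=
  match r with
  | RC _ => 2
  | RN e => ecost e V + ebd e V + 5
  | RB _ r1 r2 => rcost r1 V + rcost r2 V + 5
  end.

Lemma is_poly_rcost r : is_poly (rcost r).
Proof.
elim: r => [u|e|o r1 IH1 r2 IH2] /=; first exact: is_polyC.
- by do !apply: is_polyD; [exact: is_poly_ecost|exact: is_poly_ebd|exact: is_polyC].
- by do !apply: is_polyD => //; exact: is_polyC.
Qed.

Lemma reval_ext f g r : rwf r ->
  (forall a i, own a -> rreads a r -> f a i = g a i) -> reval f r = reval g r.
Proof.
elim: r => [u|e|o r1 IH1 r2 IH2] //=.
- by move=> we fg; rewrite (neval_ext we fg).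
- move=> /andP[w1 w2] fg; rewrite (IH1 w1) ?(IH2 w2) // => b i ob rb; apply: fg => //;
  by rewrite rb ?orbT.
Qed.

(** The stack of reals starts at array 3, because real arrays 0 to 2 receive the output. *)
Fixpoint compr (r : rexp) (d : nat) : prog R :=
  match r with
  | RC u => RConst (Direct (3 + d)) u
  | RN e => Seq (ncomp e 0) (ROfNat (Direct (3 + d)) (Direct (tmp 0)))
  | RB o r1 r2 => Seq (compr r1 d) (Seq (compr r2 d.+1)
      (ROp o (Direct (3 + d)) (Direct (3 + d)) (Direct (3 + d.+1))))
  end.

Definition rtsame (d : nat) s s' : Prop :=
  (forall b i, b < 3 + d -> reals s' b i = reals s b i) /\
  forall a i, ~~ scratch 0 a -> nats s' a i = nats s a i.

Lemma bounded_rtsame d V s s' : bounded V s -> rtsame d s s' -> bounded V s'.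
Proof. by move=> bs [_ n] a i oa; rewrite n ?bs // own_scratch. Qed.

Lemma compr_exec r d s V : rwf r -> bounded V s -> exists N s',
  [/\ exec (compr r d) s N s', reals s' (3 + d) 0 = reval (nats s) r,
      rtsame d s s' & N <= rcost r V].
Proof.
have lt3 (b d' i : nat) : b < 3 + d' -> ((b, i) == (3 + d', 0)) = false.
  by move=> bd; apply/eqP => -[E _]; rewrite E ltnn in bd.
elim: r d s => [u|e|o r1 IH1 r2 IH2] d s /=.
- move=> _ _; do 2!eexists; split; first exact: exec_rconst.
  + by rewrite /rset /= /update eqxx.
  + by split => // b i bd; rewrite /rset /= /update lt3.
  + by rewrite /addr_cost /= bits0.
- move=> we bs; have [N1 [s1 [x1 v1 t1 c1]]] := comp_exec 0 we bs.
  do 2!eexists; split.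
  + by apply: exec_seq x1 _; exact: exec_rofnat.
  + by rewrite /rset /= /update eqxx /nget /= v1.
  + by split => [b i bd|a i na] /=; [rewrite /update lt3 // t1.1|exact: t1.2].
  + rewrite /nread_cost /addr_cost /nget /= v1 bits0.
    have := bits_le (neval (nats s) e); have := neval_bd bs we; lia.
- move=> /andP[w1 w2] bs.
  have [N1 [s1 [x1 v1 t1 c1]]] := IH1 d s w1 bs.
  have [N2 [s2 [x2 v2 t2 c2]]] := IH2 d.+1 s1 w2 (bounded_rtsame bs t1).
  have E2 : reval (nats s1) r2 = reval (nats s) r2.
    by apply: reval_ext => // a i oa _; rewrite t1.2 // own_scratch.
  do 2!eexists; split.
  + by apply: exec_seq x1 _; apply: exec_seq x2 _; exact: exec_rop.
  + rewrite /rset /= /update eqxx /rget /=.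
    by rewrite t2.1 ?v1 ?v2 ?E2 // addnS.
  + split => [b i bd|a i na] /=; last by rewrite t2.2 // t1.2.
    by rewrite /update lt3 // t2.1 ?t1.1 // addnS ltnW.
  + rewrite /rread_cost /addr_cost /= bits0; lia.
Qed.

Definition rstore (a : nat) (e : nexp) (r : rexp) : prog R :=
  Seq (compr r 0) (Seq (ncomp e 0) (Seq (RConst (Direct 4) 0%R)
    (ROp RAdd (Indirect a (tmp 0)) (Direct 3) (Direct 4)))).

Definition rscost e r V : nat := rcost r V + ecost e V + ebd e V + 10.

Lemma rstore_exec a e r s V : nwf e -> rwf r -> bounded V s -> a < 3 ->
  exists N s', [/\ exec (rstore a e r) s N s',
    forall b i, ~~ scratch 0 b -> nats s' b i = nats s b i,
    forall b i, b < 3 -> reals s' b i =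
      update (reals s) (a, neval (nats s) e) (reval (nats s) r) b i
    & N <= rscost e r V].
Proof.
move=> we wr bs a3.
have [N1 [s1 [x1 v1 t1 c1]]] := compr_exec 0 wr bs.
have [N2 [s2 [x2 v2 t2 c2]]] := comp_exec 0 we (bounded_rtsame bs t1).
have E2 : neval (nats s1) e = neval (nats s) e.
  by apply: neval_ext => // b i ob _; rewrite t1.2 // own_scratch.
rewrite E2 in v2.
do 2!eexists; split.
- apply: exec_seq x1 _; apply: exec_seq x2 _; apply: exec_seq; first exact: exec_rconst.
  exact: exec_rop.
- by move=> b i nb /=; rewrite t2.2 // t1.2.
- move=> b i b3 /=; rewrite v2 /rget /= /update /= t2.1 v1 GRing.addr0.
  case: eqP => // _.
  have -> : ((b, i) == (4, 0)) = false by apply/eqP => -[E _]; rewrite E in b3.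
  by rewrite t1.1 // addn0.
- rewrite /rread_cost /addr_cost /= v2 bits0 /rscost.
  have := bits_le (neval (nats s) e); have := neval_bd bs we; lia.
Qed.

Definition forp (ctr bnd : nat) (eb : nexp) (body : prog R) : prog R :=
  Seq (store bnd (NC 0) eb) (Seq (store ctr (NC 0) (NC 0))
    (WhileNLt (Direct ctr) (Direct bnd)
      (Seq body (store ctr (NC 0) (NB NAdd (NV ctr) (NC 1)))))).

(** [NV 0] stands for an arbitrary counter, since [ecost] ignores array numbers. The factor [n.+1]
    includes the last, failing test. *)
Definition fcost (eb : nexp) (n C V : nat) : nat :=
  scost (NC 0) eb V + scost (NC 0) (NC 0) V
  + n.+1 * (C + scost (NC 0) (NB NAdd (NV 0) (NC 1)) V + V + V + 6).

(** The invariant has to be insensitive to scratch cells and to the counter, because the loop writes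
    these between two runs of the body. The bound [V] holds before and after each run, so one cost
    bound serves all rounds. *)
Lemma forp_exec ctr bnd eb body n C V (Inv : nat -> state R -> Prop) s :
  own ctr -> own bnd -> ctr != bnd -> nwf eb -> neval (nats s) eb = n ->
  bounded V s ->
  (forall j s1 s2, Inv j s1 -> reals s2 = reals s1 ->
     (forall a i, ~~ scratch 0 a -> (a, i) != (ctr, 0) -> nats s2 a i = nats s1 a i) ->
     Inv j s2) ->
  (forall s1, reals s1 = reals s -> (forall a i, ~~ scratch 0 a -> (a, i) != (ctr, 0) ->
     nats s1 a i = update (nats s) (bnd, 0) n a i) -> Inv 0 s1) ->
  (forall j s1, j <= n -> Inv j s1 -> nats s1 ctr 0 = j -> 
     bounded V s1 /\ nats s1 bnd 0 = n) ->
  (forall j s1, j < n -> Inv j s1 -> nats s1 ctr 0 = j ->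
     exists N s2, [/\ exec body s1 N s2, N <= C, nats s2 ctr 0 = j,
       bounded V s2 & Inv j.+1 s2]) ->
  exists N s', [/\ exec (forp ctr bnd eb body) s N s', N <= fcost eb n C V,
    Inv n s' & nats s' ctr 0 = n].
Proof.
move=> octr obnd cb web En bs Istab I0 Ib Istep.
have [N1 [s1 [x1 r1 u1 c1]]] := @store_exec bnd (NC 0) eb s V isT web bs.
rewrite En in u1.
(* Nothing yet says that [n] is at most [V]. The maximum is harmless: storing a constant has a cost
   that does not depend on the bound. *)
have n1 : bounded (maxn V n) s1.
  move=> a i oa; rewrite u1 ?own_scratch // /update /=; case: ifP => _.
    exact: leq_maxr.
  by rewrite leq_max bs.
have [N2 [s2 [x2 r2 u2 c2]]] := @store_exec ctr (NC 0) (NC 0) s1 _ isT isT n1.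
have i0 : Inv 0 s2.
  apply: I0; first by rewrite r2.
  by move=> a i na ac; rewrite u2 // /update /= (negbTE ac) u1.
have k0 : nats s2 ctr 0 = 0 by rewrite u2 ?own_scratch // /update eqxx.
have loop : forall m j s3, j + m = n -> Inv j s3 -> nats s3 ctr 0 = j ->
    exists N s4, [/\ exec (WhileNLt (Direct ctr) (Direct bnd)
      (Seq body (store ctr (NC 0) (NB NAdd (NV ctr) (NC 1))))) s3 N s4,
      N <= m.+1 * (C + scost (NC 0) (NB NAdd (NV 0) (NC 1)) V + V + V + 6),
      Inv n s4 & nats s4 ctr 0 = n].
  elim=> [|m IH] j s3 jm Ij kj.
    rewrite addn0 in jm.
    have [b3 e3] := Ib j s3 ltac:(lia) Ij kj.
    do 2!eexists; split.
    - by apply: exec_while_stop; rewrite /nget /= kj e3 jm.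
    - rewrite /nread_cost /addr_cost /nget /= bits0 e3 kj jm.
      by have := bits_le n; have := b3 bnd 0 obnd; rewrite e3; lia.
    - by rewrite -jm.
    - by rewrite kj.
  have jn : j < n by lia.
  have [b3 e3] := Ib j s3 (ltnW jn) Ij kj.
  have [M1 [s4 [y1 d1 k4 b4 I4]]] := Istep j s3 jn Ij kj.
  have wc : nwf (NB NAdd (NV ctr) (NC 1)) by rewrite /= octr.
  have [M2 [s5 [y2 r5 u5 d2]]] := @store_exec ctr (NC 0) _ s4 V isT wc b4.
  have I5 : Inv j.+1 s5.
    by apply: Istab I4 r5 _ => a i na ac; rewrite u5 // /update /= (negbTE ac).
  have k5 : nats s5 ctr 0 = j.+1 by rewrite u5 ?own_scratch // /update /= eqxx k4 addn1.
  have [M3 [s6 [y3 d3 I6 k6]]] := IH j.+1 s5 ltac:(lia) I5 k5.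
  do 2!eexists; split; last exact: k6; last exact: I6.
  - apply: exec_while_step y3; last by apply: exec_seq y1 y2.
    by rewrite /nget /= kj e3.
  - rewrite /nread_cost /addr_cost /nget /= bits0 e3 kj [m.+2 * _]mulSn.
    have := bits_le n; have := bits_le j; have := b3 bnd 0 obnd; rewrite e3.
    by have : scost (NC 0) (NB NAdd (NV ctr) (NC 1)) V = scost (NC 0) (NB NAdd (NV 0) (NC 1)) V by []; lia.
have [N3 [s3 [x3 c3 I3 k3]]] := loop n 0 s2 (add0n _) i0 k0.
do 2!eexists; split; last exact: k3; last exact: I3.
- by apply: exec_seq x1 _; apply: exec_seq x2 x3.
- rewrite /fcost; have : scost (NC 0) (NC 0) (maxn V n) = scost (NC 0) (NC 0) V by []; lia.
Qed.

(* The content of an array after the assignments idx j := v j, for j < n. *)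
Fixpoint written (T : Type) (f : nat -> T) (idx : nat -> nat) (v : nat -> T)
    (n i : nat) : T :=
  if n is n'.+1 then if i == idx n' then v n' else written f idx v n' i else f i.

Lemma written_notin T f idx v n i : (forall j, j < n -> idx j != i) ->
  @written T f idx v n i = f i.
Proof.
elim: n => //= n IH H; rewrite eq_sym (negbTE (H n _)) // IH // => j jn.
exact/H/ltnW.
Qed.

Lemma written_in T f idx v n j : (forall j j', j < n -> j' < n -> idx j = idx j' -> j = j') ->
  j < n -> @written T f idx v n (idx j) = v j.
Proof.
elim: n => //= n IH inj jn; case: eqP => [E|E].
  by rewrite (inj _ _ jn (ltnSn n) E).
have {}jn : j < n by move: jn; rewrite ltnS leq_eqVlt => /predU1P[ejn|//]; rewrite ejn in E.
by apply: IH jn => a b an bn; apply: inj; exact: ltnW.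
Qed.

Definition env s ctr j := update (nats s) (ctr, 0) j.

Definition fill a ctr bnd eb e1 e2 := forp ctr bnd eb (store a e1 e2).
Definition rfill a ctr bnd eb e r := forp ctr bnd eb (rstore a e r).

(** Neither expression reads the array being filled or the loop bound, so its value in round [j] is
    the one in the initial state with the counter set to [j]; this gives the closed form [written].
    Values need to be bounded only if [a] is a variable, as [bounded] says nothing about the arrays
    of simulated programs. *)
Lemma fill_exec a ctr bnd eb e1 e2 s V n :
  own ctr -> own bnd -> ctr != bnd -> a != ctr -> a != bnd -> ~~ scratch 0 a ->
  nwf eb -> nwf e1 -> nwf e2 ->
  ~~ nreads a e1 -> ~~ nreads a e2 -> ~~ nreads bnd e1 -> ~~ nreads bnd e2 ->
  neval (nats s) eb = n -> bounded V s -> n <= V ->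
  (own a -> forall j, j < n -> neval (env s ctr j) e2 <= V) ->
  exists N s', [/\ exec (fill a ctr bnd eb e1 e2) s N s',
    N <= fcost eb n (scost e1 e2 V) V, reals s' = reals s,
    forall b i, ~~ scratch 0 b -> b != a -> b != ctr -> b != bnd ->
      nats s' b i = nats s b i &
    (forall i, nats s' a i = written (nats s a) (fun j => neval (env s ctr j) e1)
       (fun j => neval (env s ctr j) e2) n i) /\ bounded V s'].
Proof.
move=> octr obnd cb ac ab na web w1 w2 ra1 ra2 rb1 rb2 En bs nV vV.
pose idx j := neval (env s ctr j) e1; pose v j := neval (env s ctr j) e2.
pose Inv j (s1 : state R) := [/\ reals s1 = reals s,
  forall b i, ~~ scratch 0 b -> b != a -> (b, i) != (ctr, 0) ->
    nats s1 b i = update (nats s) (bnd, 0) n b i &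
  forall i, nats s1 a i = written (nats s a) idx v j i].
have wV j i : own a -> j <= n -> written (nats s a) idx v j i <= V.
  move=> oa; elim: j => [|j IH] jn /=; first exact: bs.
  by case: ifP => _; [exact: vV|apply: IH; exact: ltnW].
have Ib j s1 : j <= n -> Inv j s1 -> nats s1 ctr 0 <= n ->
    bounded V s1 /\ nats s1 bnd 0 = n.
  move=> jn [_ u w] kj; split.
    move=> b i ob; have [[-> ->]|bc] := eqVneq (b, i) (ctr, 0).
      exact: leq_trans kj nV.
    have [Eb|ba] := eqVneq b a; first by rewrite Eb w wV // -Eb.
    by rewrite u ?own_scratch // /update; case: ifP => // _; exact: bs.
  rewrite u ?own_scratch // 1?eq_sym // /update ?eqxx //.
  by rewrite xpair_eqE (negbTE cb).
have [N [s' [x c [rs us ws] k']]] : exists N s', [/\ exec (fill a ctr bnd eb e1 e2) s N s',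
    N <= fcost eb n (scost e1 e2 V) V, Inv n s' & nats s' ctr 0 = n].
  apply: (forp_exec octr obnd cb web En bs); last 2 first.
  - by move=> j s1 jn Ij kj; apply: (Ib j) => //; rewrite kj.
  - move=> j s1 jn Ij kj; have [b1 _] := Ib j s1 (ltnW jn) Ij (leq_trans (eq_leq kj) (ltnW jn)).
    have [r1 u1 w1'] := Ij.
    have [N [s2 [x2 r2 u2 c2]]] := store_exec a w1 w2 b1.
    have ev e : nwf e -> ~~ nreads a e -> ~~ nreads bnd e ->
        neval (nats s1) e = neval (env s ctr j) e.
      move=> we ra rb; apply: neval_ext => // b i ob rbe; rewrite /env /update.
      have [[-> ->]|bc] := eqVneq (b, i) (ctr, 0); first by rewrite kj.
      rewrite u1 ?own_scratch //; last by apply: contra ra => /eqP <-.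
      rewrite /update; case: eqP => // -[E _]; by rewrite E (negbTE rb) in rbe.
    rewrite !ev // in u2.
    have I2 : Inv j.+1 s2.
      split; first by rewrite r2.
        by move=> b i nb ba bc; rewrite u2 // /update xpair_eqE (negbTE ba) u1.
      by move=> i; rewrite u2 // /update xpair_eqE eqxx w1' /=.
    have k2 : nats s2 ctr 0 = j.
      by rewrite u2 ?own_scratch // /update xpair_eqE eq_sym (negbTE ac).
    exists N, s2; split => //; apply: (Ib j.+1 s2 jn I2 _).1; rewrite k2; exact: ltnW.
  - move=> j s1 s2 [r1 u1 w1'] r2 u2; split; first by rewrite r2.
      by move=> b i nb ba bc; rewrite u2 // u1.
    by move=> i; rewrite u2 ?w1' // xpair_eqE (negbTE ac).
  - move=> s1 r1 u1; split => // [b i nb _ bc|i]; first exact: u1.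
    rewrite u1 // ?xpair_eqE ?(negbTE ac) // /update.
    by rewrite xpair_eqE (negbTE ab).
exists N, s'; split => //; last by split => //; apply: (Ib n s' _ _ _).1; rewrite ?k'.
move=> b i nb ba bc bb; rewrite us // ?xpair_eqE ?(negbTE bc) // /update.
by rewrite xpair_eqE (negbTE bb).
Qed.

Lemma rfill_exec a ctr bnd eb e r s V n :
  own ctr -> own bnd -> ctr != bnd -> a < 3 ->
  nwf eb -> nwf e -> rwf r -> ~~ nreads bnd e -> ~~ rreads bnd r ->
  neval (nats s) eb = n -> bounded V s -> n <= V ->
  exists N s', [/\ exec (rfill a ctr bnd eb e r) s N s',
    N <= fcost eb n (rscost e r V) V,
    forall b i, ~~ scratch 0 b -> b != ctr -> b != bnd -> nats s' b i = nats s b i,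
    forall b i, b < 3 -> b != a -> reals s' b i = reals s b i &
    (forall i, reals s' a i = written (reals s a) (fun j => neval (env s ctr j) e)
       (fun j => reval (env s ctr j) r) n i) /\ bounded V s'].
Proof.
move=> octr obnd cb a3 web we wr rb rr En bs nV.
pose idx j := neval (env s ctr j) e; pose v j := reval (env s ctr j) r.
pose Inv j (s1 : state R) := [/\ 
  forall b i, ~~ scratch 0 b -> (b, i) != (ctr, 0) ->
    nats s1 b i = update (nats s) (bnd, 0) n b i,
  forall b i, b < 3 -> b != a -> reals s1 b i = reals s b i &
  forall i, reals s1 a i = written (reals s a) idx v j i].
have Ib j s1 : j <= n -> Inv j s1 -> nats s1 ctr 0 <= n ->
    bounded V s1 /\ nats s1 bnd 0 = n.
  move=> jn [u _ w] kj; split.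
    move=> b i ob; have [[-> ->]|bc] := eqVneq (b, i) (ctr, 0).
      exact: leq_trans kj nV.
    by rewrite u ?own_scratch // /update; case: ifP => // _; exact: bs.
  rewrite u ?own_scratch // /update ?eqxx //.
  by rewrite xpair_eqE eq_sym (negbTE cb).
have [N [s' [x c [us rs ws] k']]] : exists N s', [/\ exec (rfill a ctr bnd eb e r) s N s',
    N <= fcost eb n (rscost e r V) V, Inv n s' & nats s' ctr 0 = n].
  apply: (forp_exec octr obnd cb web En bs); last 2 first.
  - by move=> j s1 jn Ij kj; apply: (Ib j) => //; rewrite kj.
  - move=> j s1 jn Ij kj; have [b1 _] := Ib j s1 (ltnW jn) Ij (leq_trans (eq_leq kj) (ltnW jn)).
    have [u1 r1 w1] := Ij.
    have [N [s2 [x2 u2 r2 c2]]] := rstore_exec we wr b1 a3.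
    have same b i : own b -> b != bnd -> nats s1 b i = env s ctr j b i.
      move=> ob bb; rewrite /env /update.
      have [[-> ->]|bc] := eqVneq (b, i) (ctr, 0); first by rewrite kj.
      by rewrite u1 ?own_scratch // /update xpair_eqE (negbTE bb).
    have e1 : neval (nats s1) e = idx j.
      by apply: neval_ext => // b i ob rbe; apply: same => //; apply: contraNneq rb => <-.
    have e2 : reval (nats s1) r = v j.
      by apply: reval_ext => // b i ob rbe; apply: same => //; apply: contraNneq rr => <-.
    rewrite e1 e2 in r2.
    have I2 : Inv j.+1 s2.
      split.
      - by move=> b i nb bc; rewrite u2 // u1.
      - by move=> b i b3 ba; rewrite r2 // /update xpair_eqE (negbTE ba) r1.
      - by move=> i; rewrite r2 // /update xpair_eqE eqxx w1 /=.
    have k2 : nats s2 ctr 0 = j by rewrite u2 ?own_scratch.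
    exists N, s2; split => //; apply: (Ib j.+1 s2 jn I2 _).1; rewrite k2; exact: ltnW.
  - move=> j s1 s2 [u1 r1 w1] r2 u2; split.
    + by move=> b i nb bc; rewrite u2 // u1.
    + by move=> b i b3 ba; rewrite r2 r1.
    + by move=> i; rewrite r2 w1.
  - by move=> s1 r1 u1; split => // [b i _ _|i]; rewrite r1.
exists N, s'; split => //; last by split => //; apply: (Ib n s' _ _ _).1; rewrite ?k'.
move=> b i nb bc bb; rewrite us // ?xpair_eqE ?(negbTE bc) // /update.
by rewrite xpair_eqE (negbTE bb).
Qed.

Lemma is_poly_scost e1 e2 : is_poly (scost e1 e2).
Proof.
do !apply: is_polyD; try exact: is_poly_ecost; try exact: is_poly_ebd.
exact: is_polyC.
Qed.

Lemma is_poly_rscost e r : is_poly (rscost e r).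
Proof.
do !apply: is_polyD; [exact: is_poly_rcost|exact: is_poly_ecost|exact: is_poly_ebd|].
exact: is_polyC.
Qed.

Lemma is_poly_fcost eb (C : nat -> nat) : is_poly C ->
  is_poly (fun V => fcost eb V (C V) V).
Proof.
move=> pC; apply: is_polyD; first by apply: is_polyD; exact: is_poly_scost.
apply: is_polyM.
  apply: (is_poly_le (g := fun V => V + 1)) => [V|]; first by rewrite addn1.
  by apply: is_polyD; [exact: is_poly_id|exact: is_polyC].
apply: is_polyD; last exact: is_polyC.
apply: is_polyD; last exact: is_poly_id.
apply: is_polyD; last exact: is_poly_id.
by apply: is_polyD => //; exact: is_poly_scost.
Qed.

Lemma fcost_le eb n n' C V : n <= n' -> fcost eb n C V <= fcost eb n' C V.
Proof. by move=> nn; rewrite leq_add2l leq_mul. Qed.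

End Compilation.

(** * Simulation of a program in interleaved memory *)

Section Bits.

Lemma bits_gt0 m : 0 < bits m. Proof. by []. Qed.

Lemma ltn_bits m : m < 2 ^ bits m.
Proof. by rewrite /bits trunc_log_ltn. Qed.

Lemma bits_leq m b : 0 < b -> m < 2 ^ b -> bits m <= b.
Proof.
case: m => [|m] b0 mb; first by rewrite bits0.
rewrite /bits; have H : 2 ^ trunc_log 2 m.+1 <= m.+1 by apply: trunc_logP.
by have := leq_ltn_trans H mb; rewrite ltn_exp2l.
Qed.

Lemma leq_bits m m' : m <= m' -> bits m <= bits m'.
Proof. by move=> mm; apply: bits_leq => //; exact: leq_ltn_trans mm (ltn_bits _). Qed.

Lemma bits_addr v J j : j < J -> bits (v * J + j) <= bits v + bits J.
Proof.
move=> jJ; apply: bits_leq; rewrite // expnD.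
have := ltn_bits v; have := ltn_bits J.
move: (2 ^ bits v) (2 ^ bits J) => X Y; nia.
Qed.

Lemma bits_op o x y : bits (nat_op_fun o x y) <= bits x + bits y.
Proof.
apply: bits_leq; rewrite // expnD; have := ltn_bits x; have := ltn_bits y.
move: (2 ^ bits x) (2 ^ bits y) => X Y yY xX.
case: o => /=; [nia|nia|nia|].
by apply: leq_ltn_trans (leq_div _ _) _; nia.
Qed.

End Bits.

Section Simulation.
Variable R : realType.
Implicit Types (s t : state R) (P : prog R) (x y z : addr).

Lemma nats_nset s x v a i :
  nats (nset s x v) a i = if (a, i) == index_of s x then v else nats s a i.
Proof. by []. Qed.

(** With logarithmic cost an operation pays the length of its operands, which bounds the length of
    its result. This later bounds the cost of reading the answer of a simulated run. *)
Lemma bits_exec P s N s1 : exec P s N s1 -> forall a i,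
  bits (nats s1 a i) <= bits (nats s a i) + N.
Proof.
elim=> {P s N s1}.
- by move=> s a i; rewrite leq_addr.
- move=> x m s a i; rewrite nats_nset; case: ifP => _; lia.
- move=> o x y z s a i; rewrite nats_nset; case: ifP => _; last by lia.
  by have := bits_op o (nget s y) (nget s z); rewrite /nread_cost; lia.
- by move=> x u s a i; rewrite leq_addr.
- by move=> x y s a i; rewrite leq_addr.
- by move=> o x y z s a i; rewrite leq_addr.
- move=> P Q s s1 s2 N1 N2 _ H1 _ H2 a i; have := H1 a i; have := H2 a i; lia.
- move=> y z P Q s s1 N _ H a i; have := H a i; lia.
- move=> y z P Q s s1 N _ H a i; have := H a i; lia.
- by move=> y z P s _ a i; rewrite leq_addr.
- move=> y z P s s1 s2 N1 N2 _ _ H1 _ H2 a i; have := H1 a i; have := H2 a i; lia.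
Qed.

(* Cell i of array a of the simulated program is cell i * J + j of array 2 a + 1;
   arrays 8 and 10 hold j and J, and the index is computed in scratch cell d. *)
Definition adr (d : nat) x : addr :=
  Indirect (match x with Direct a => a | Indirect a _ => a end).*2.+1 (tmp d).

Definition adr_code (d : nat) x : prog R :=
  match x with
  | Direct _ => Seq (NConst (Direct (tmp d)) 0)
      (NOp NAdd (Direct (tmp d)) (Direct (tmp d)) (Direct 8))
  | Indirect _ b => Seq (NOp NMul (Direct (tmp d)) (Indirect b.*2.+1 8) (Direct 10))
      (NOp NAdd (Direct (tmp d)) (Direct (tmp d)) (Direct 8))
  end.

(** Real instructions become [Skip], since only discrete programs are simulated. In a loop the
    addresses are recomputed at the end of each round: the body may change the index of an indirect
    operand and overwrites the scratch cells. *)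
Fixpoint simp P : prog R :=
  match P with
  | NConst x m => Seq (adr_code 0 x) (NConst (adr 0 x) m)
  | NOp o x y z => Seq (adr_code 0 x) (Seq (adr_code 1 y) (Seq (adr_code 2 z)
      (NOp o (adr 0 x) (adr 1 y) (adr 2 z))))
  | Seq P Q => Seq (simp P) (simp Q)
  | IfNLe y z P Q => Seq (adr_code 0 y) (Seq (adr_code 1 z)
      (IfNLe (adr 0 y) (adr 1 z) (simp P) (simp Q)))
  | WhileNLt y z P => Seq (Seq (adr_code 0 y) (adr_code 1 z))
      (WhileNLt (adr 0 y) (adr 1 z)
        (Seq (simp P) (Seq (adr_code 0 y) (adr_code 1 z))))
  | _ => Skip
  end.

Lemma discrete_comp e d : discrete (ncomp R e d).
Proof. by elim: e d => //= [a e IH d|o e1 IH1 e2 IH2 d]; rewrite ?IH ?IH1 ?IH2. Qed.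

Lemma discrete_adr d x : discrete (adr_code d x). Proof. by case: x. Qed.

Lemma discrete_simp P : discrete (simp P).
Proof. by elim: P => //= *; rewrite ?discrete_adr //=; apply/andP. Qed.

Variables J j : nat.
Hypothesis jJ : j < J.

Definition sim s t : Prop :=
  [/\ forall a i, nats t a.*2.+1 (i * J + j) = nats s a i, nats t 8 0 = j & nats t 10 0 = J].

(** Even arrays belong to the simulating program and the other residues modulo [J] to other runs;
    both must survive a run. *)
Definition frame t t1 : Prop := forall a i, ~~ scratch 0 a -> (odd a -> i %% J != j) ->
  nats t1 a i = nats t a i.

Lemma frame_trans t1 t2 t3 : frame t1 t2 -> frame t2 t3 -> frame t1 t3.
Proof. by move=> f1 f2 a i na ia; rewrite f2 // f1. Qed.

Lemma tsame_frame d t t1 : tsame d t t1 -> frame t t1.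
Proof.
move=> [_ n] a i na _; apply: n; apply: contra na; rewrite /scratch.
by move=> /andP[-> H] /=; apply: leq_trans H; rewrite leq_double leq_add2l.
Qed.

Lemma tsame_sim d s t t1 : sim s t -> tsame d t t1 -> sim s t1.
Proof.
move=> [h1 h2 h3] [_ n]; split.
- by move=> a i; rewrite n ?h1 // /scratch /= odd_double.
- by rewrite n // own_scratch.
- by rewrite n // own_scratch.
Qed.

Lemma adr_code_exec d x s t : sim s t -> exists N t1,
  [/\ exec (adr_code d x) t N t1, tsame d t t1,
     nats t1 (tmp d) 0 = (index_of s x).2 * J + j & N <= 12 * bits J * addr_cost s x].
Proof.
move=> [h1 h2 h3]; have bj : bits j <= bits J by apply/leq_bits/ltnW.
have bJ := bits_gt0 J.
case: x => [a|a b].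
- pose t1 := nset t (Direct (tmp d)) 0.
  have s1 : tsame d t t1 by exact: tsame_nset.
  have g8 : nget t1 (Direct 8) = j by rewrite nget_direct s1.2 ?own_scratch.
  have g0 : nget t1 (Direct (tmp d)) = 0 := nget_nset_direct _ _ _.
  do 2!eexists; split.
  + by apply: exec_seq; [exact: exec_nconst|exact: exec_nop].
  + exact: tsame_trans s1 (tsame_nset _ _ _).
  + by rewrite nats_nset_direct -/t1 g8 g0.
  + by rewrite /nread_cost -/t1 g8 g0 !acost_direct bits0; lia.
- pose v := nats s b 0.
  have gv : nget t (Indirect b.*2.+1 8) = v by rewrite nget_indirect h2 -[j]add0n -(mul0n J) h1.
  have gJ : nget t (Direct 10) = J by [].
  pose t1 := nset t (Direct (tmp d)) (v * J).
  have s1 : tsame d t t1 by exact: tsame_nset.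
  have g8 : nget t1 (Direct 8) = j by rewrite nget_direct s1.2 ?own_scratch.
  have g0 : nget t1 (Direct (tmp d)) = v * J := nget_nset_direct _ _ _.
  do 2!eexists; split.
  + apply: exec_seq; [exact: exec_nop|exact: exec_nop].
  + rewrite gv gJ; exact: tsame_trans s1 (tsame_nset _ _ _).
  + by rewrite gv gJ nats_nset_direct -/t1 g8 g0.
  + rewrite /nread_cost gv gJ -[nset t _ _]/t1 g8 g0 !acost_direct !acost_indirect h2 -/v.
    have : bits (v * J) <= bits v + bits J.
      by apply: leq_trans (bits_addr v jJ); apply: leq_bits; rewrite leq_addr.
    have := bits_gt0 v; move: (bits (v * J)) (bits v) (bits J) (bits j) bj bJ => A B C D DC C0 B0 ABC.
    have : B + C <= B * C + 1 by nia.
    by nia.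
Qed.

Lemma nget_adr d x s t : sim s t -> nats t (tmp d) 0 = (index_of s x).2 * J + j ->
  nget t (adr d x) = nget s x.
Proof. by move=> [h1 _ _] E; case: x E => [a|a b] E; rewrite /nget /= E h1. Qed.

Lemma acost_adr d x s t : nats t (tmp d) 0 = (index_of s x).2 * J + j ->
  addr_cost t (adr d x) <= 2 * bits J * addr_cost s x.
Proof.
move=> E; rewrite /adr acost_indirect E /addr_cost.
have := bits_addr (index_of s x).2 jJ; have := bits_gt0 (index_of s x).2; have := bits_gt0 J.
move: (bits (_ + _)) (bits (index_of s x).2) (bits J) => A B C; nia.
Qed.

Lemma nread_adr d x s t : sim s t -> nats t (tmp d) 0 = (index_of s x).2 * J + j ->
  nread_cost t (adr d x) <= 2 * bits J * nread_cost s x.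
Proof.
move=> st E; rewrite /nread_cost (nget_adr st E).
have := acost_adr E; have := bits_gt0 J; move: (bits J) (addr_cost _ _) (addr_cost _ _) (bits _).
by move=> A B C D; nia.
Qed.

Lemma nset_adr d x s t v : sim s t -> nats t (tmp d) 0 = (index_of s x).2 * J + j ->
  sim (nset s x v) (nset t (adr d x) v) /\ frame t (nset t (adr d x) v).
Proof.
move=> [h1 h2 h3] E.
have ix : index_of t (adr d x) = ((index_of s x).1.*2.+1, (index_of s x).2 * J + j).
  by case: x E => [a|a b] E; rewrite /= E.
have J0 : 0 < J by exact: leq_ltn_trans jJ.
split; first split.
- move=> a i; rewrite !nats_nset ix h1 [index_of s x]surjective_pairing !xpair_eqE /=.
  rewrite eqSS (inj_eq double_inj); case: (a == _) => //=.
  by rewrite eqn_add2r eqn_pmul2r.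
- rewrite nats_nset ix xpair_eqE; case: eqP => // E8.
  by have := congr1 odd E8; rewrite /= odd_double.
- rewrite nats_nset ix xpair_eqE; case: eqP => // E8.
  by have := congr1 odd E8; rewrite /= odd_double.
- move=> a i na ia; rewrite nats_nset ix xpair_eqE; case: eqP => //= Ea.
  case: eqP => // Ei; have := ia; rewrite Ea Ei /= odd_double => /(_ isT).
  by rewrite modnMDl modn_small // eqxx.
Qed.

Lemma tsame_tmp d d' t t1 v : d' < d -> tsame d t t1 -> nats t (tmp d') 0 = v ->
  nats t1 (tmp d') 0 = v.
Proof. by move=> dd [_ n] <-; rewrite n // scratch_tmp -ltnNge. Qed.

Lemma adr2_exec y z s t : sim s t -> exists N t1,
  [/\ exec (Seq (adr_code 0 y) (adr_code 1 z)) t N t1, frame t t1 /\ sim s t1,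
     nats t1 (tmp 0) 0 = (index_of s y).2 * J + j /\ nats t1 (tmp 1) 0 = (index_of s z).2 * J + j
   & N <= 12 * bits J * (addr_cost s y + addr_cost s z)].
Proof.
move=> st; have [N1 [t1 [x1 s1 e1 c1]]] := adr_code_exec 0 y st.
have st1 := tsame_sim st s1; have [N2 [t2 [x2 s2 e2 c2]]] := adr_code_exec 1 z st1.
do 2!eexists; split; first exact: exec_seq x1 x2.
- split; last exact: tsame_sim s2.
  exact: frame_trans (tsame_frame s1) (tsame_frame s2).
- by split => //; exact: tsame_tmp s2 e1.
- by rewrite mulnDr leq_add.
Qed.

(** An index [i] becomes [i * J + j], of length at most [bits i + bits J], hence at most
    [2 * bits J * bits i]. Every charge grows by a multiple of [bits J]; the 14 is 12 for computing
    an address plus 2 for using it. *)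
Lemma sim_exec P s N s1 : exec P s N s1 -> discrete P -> forall t, sim s t ->
  exists N' t1, [/\ exec (simp P) t N' t1, sim s1 t1, frame t t1 &
    N' <= 14 * bits J * N].
Proof.
have bJ := bits_gt0 J.
elim=> {P s N s1}.
- move=> s _ t st; exists 1, t; split => //; exact: exec_skip.
- move=> x m s _ t st; have [N1 [t1 [x1 s1 e1 c1]]] := adr_code_exec 0 x st.
  have st1 := tsame_sim st s1; have [n1 n2] := nset_adr m st1 e1.
  do 2!eexists; split; [by apply: exec_seq x1 _; exact: exec_nconst|exact: n1| |].
    exact: frame_trans (tsame_frame s1) n2.
  have := acost_adr e1; move: (addr_cost s x) (addr_cost _ _) (bits m) (bits J) bJ c1 => A B C D.
  by nia.
- move=> o x y z s _ t st; have [N1 [t1 [x1 s1 e1 c1]]] := adr_code_exec 0 x st.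
  have st1 := tsame_sim st s1; have [N2 [t2 [x2 s2 e2 c2]]] := adr_code_exec 1 y st1.
  have st2 := tsame_sim st1 s2; have [N3 [t3 [x3 s3 e3 c3]]] := adr_code_exec 2 z st2.
  have st3 := tsame_sim st2 s3.
  have f1 : nats t3 (tmp 0) 0 = (index_of s x).2 * J + j.
    by apply: tsame_tmp s3 _ => //; exact: tsame_tmp s2 e1.
  have f2 : nats t3 (tmp 1) 0 = (index_of s y).2 * J + j by exact: tsame_tmp s3 e2.
  have [n1 n2] := nset_adr (nat_op_fun o (nget s y) (nget s z)) st3 f1.
  do 2!eexists; split.
  + by apply: exec_seq x1 _; apply: exec_seq x2 _; apply: exec_seq x3 _; exact: exec_nop.
  + by rewrite (nget_adr st3 f2) (nget_adr st3 e3).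
  + rewrite (nget_adr st3 f2) (nget_adr st3 e3); apply: frame_trans n2.
    apply: frame_trans (tsame_frame s3); exact: frame_trans (tsame_frame s1) (tsame_frame s2).
  + have := acost_adr f1; have := nread_adr st3 f2; have := nread_adr st3 e3.
    have : addr_cost s y <= nread_cost s y by rewrite leq_addr.
    have : addr_cost s z <= nread_cost s z by rewrite leq_addr.
    move: (addr_cost s x) (addr_cost s y) (addr_cost s z) c1 c2 c3 => a b c.
    move: (addr_cost _ _) (nread_cost _ _) (nread_cost _ _) (nread_cost _ _) (nread_cost _ _).
    by move: (bits J) bJ => B B0 a1 b1 b2 b3 b4; nia.
- by [].
- by [].
- by [].
- move=> P Q s s1 s2 N1 N2 _ IH1 _ IH2 /= /andP[d1 d2] t st.
  have [M1 [t1 [x1 st1 f1 c1]]] := IH1 d1 t st; have [M2 [t2 [x2 st2 f2 c2]]] := IH2 d2 t1 st1.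
  do 2!eexists; split; [exact: exec_seq x1 x2|exact: st2|exact: frame_trans f1 f2|].
  by rewrite mulnDr leq_add.
- move=> y z P Q s s1 N _ IH /= /andP[d1 d2] t st.
  have [M [t1 [x1 [f1 st1] [e1 e2] c1]]] := adr2_exec y z st.
  have [|M2 [t2 [x2 st2 f2 c2]]] := IH _ t1 st1; first by case: ifP.
  (* [adr2_exec] runs the two address computations as one [Seq], while [simp] nests to the right;
     the run is taken apart to be reassembled. *)
  inversion x1 as [| | | | | |P1 Q1 u u1 u2 L1 L2 y1 y2| | | |]; subst.
  do 2!eexists; split.
  + apply: exec_seq y1 _; apply: exec_seq y2 _; apply: exec_ifn.
    rewrite (nget_adr st1 e1) (nget_adr st1 e2).
    by move: x2; case: ifP => _ x2; exact: x2.
  + exact: st2.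
  + exact: frame_trans f1 f2.
  + have := nread_adr st1 e1; have := nread_adr st1 e2.
    have : addr_cost s y <= nread_cost s y by rewrite leq_addr.
    have : addr_cost s z <= nread_cost s z by rewrite leq_addr.
    move: (addr_cost s y) (addr_cost s z) c1 c2 => b c.
    move: (nread_cost _ _) (nread_cost _ _) (nread_cost _ _) (nread_cost _ _).
    by move: (bits J) bJ => B B0 b1 b2 b3 b4; nia.
- by [].
- move=> y z P s zy _ t st.
  have [M [t1 [x1 [f1 st1] [e1 e2] c1]]] := adr2_exec y z st.
  do 2!eexists; split.
  + apply: exec_seq x1 _; apply: exec_while_stop.
    by rewrite (nget_adr st1 e1) (nget_adr st1 e2).
  + exact: st1.
  + exact: f1.
  + have := nread_adr st1 e1; have := nread_adr st1 e2.
    have : addr_cost s y <= nread_cost s y by rewrite leq_addr.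
    have : addr_cost s z <= nread_cost s z by rewrite leq_addr.
    move: (addr_cost s y) (addr_cost s z) c1 => b c.
    move: (nread_cost _ _) (nread_cost _ _) (nread_cost _ _) (nread_cost _ _).
    by move: (bits J) bJ => B B0 b1 b2 b3 b4; nia.
- move=> y z P s s1 s2 N1 N2 yz _ IH1 _ IH2 /= dP t st.
  have [M [t1 [x1 [f1 st1] [e1 e2] c1]]] := adr2_exec y z st.
  have [M1 [t2 [x2 st2 f2 c2]]] := IH1 dP t1 st1.
  have [M2 [t3 [x3 st3 f3 c3]]] := IH2 dP t2 st2.
  inversion x3 as [| | | | | |P1 Q1 u u1 u2 L1 L2 y1 y2| | | |]; subst.
  do 2!eexists; split.
  + apply: exec_seq x1 _; apply: exec_while_step; last exact: y2.
      by rewrite (nget_adr st1 e1) (nget_adr st1 e2).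
    by apply: exec_seq x2 y1.
  + exact: st3.
  + by apply: frame_trans f1 _; exact: frame_trans f2 f3.
  + have := nread_adr st1 e1; have := nread_adr st1 e2.
    have : addr_cost s y <= nread_cost s y by rewrite leq_addr.
    have : addr_cost s z <= nread_cost s z by rewrite leq_addr.
    move: (addr_cost s y) (addr_cost s z) c1 c2 c3 => b c.
    move: (nread_cost _ _) (nread_cost _ _) (nread_cost _ _) (nread_cost _ _).
    by move: (bits J) bJ => B B0 b1 b2 b3 b4; nia.
Qed.

End Simulation.

Local Open Scope classical_set_scope.
Local Open Scope ring_scope.

(** * Signed means of powers *)

Section SignedMeans.
Variable R : realType.
Implicit Types (e h x y c : R) (g f : R -> R) (j n : nat).

(* For independent uniform signs u_1, ..., u_j this is the expectation of
   g (x + h (u_1 + ... + u_j)) if e = 1, and the expectation of the same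
   quantity multiplied by u_1 ... u_j if e = -1. *)
Fixpoint signed_mean (e h : R) (j : nat) (g : R -> R) (x : R) : R :=
  if j is j'.+1 then
    (signed_mean e h j' g (x + h) + e * signed_mean e h j' g (x - h)) / 2
  else g x.

Lemma signed_meanS e h j g x : signed_mean e h j.+1 g x =
  (signed_mean e h j g (x + h) + e * signed_mean e h j g (x - h)) / 2.
Proof. by []. Qed.

Lemma eq_signed_mean e h j g f x :
  g =1 f -> signed_mean e h j g x = signed_mean e h j f x.
Proof. by move=> gf; elim: j x => [|j IH] x //=; rewrite !IH. Qed.

Lemma signed_meanD e h j g f x :
  signed_mean e h j (fun z => g z + f z) x =
  signed_mean e h j g x + signed_mean e h j f x.
Proof. by elim: j x => [|j IH] x //=; rewrite !IH; field. Qed.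

Lemma signed_meanZ e h j c g x :
  signed_mean e h j (fun z => c * g z) x = c * signed_mean e h j g x.
Proof. by elim: j x => [|j IH] x //=; rewrite !IH; field. Qed.

Lemma signed_mean_sum e h j (I : Type) (r : seq I) (F : I -> R -> R) x :
  signed_mean e h j (fun z => \sum_(i <- r) F i z) x =
  \sum_(i <- r) signed_mean e h j (F i) x.
Proof.
elim: r x => [|i r IH] x.
  rewrite big_nil -[RHS](mul0r (signed_mean e h j (fun=> 0) x)) -signed_meanZ.
  by apply: eq_signed_mean => z; rewrite big_nil mul0r.
rewrite big_cons -IH -signed_meanD; apply: eq_signed_mean => z.
by rewrite big_cons.
Qed.

Lemma signed_meanSr e h j g x : signed_mean e h j.+1 g x =
  signed_mean e h j (fun z => (g (z + h) + e * g (z - h)) / 2) x.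
Proof.
elim: j x => [//|j IH] x.
by rewrite signed_meanS !IH.
Qed.

Lemma signed_mean_even e h j g x : (e == 1) || (e == -1) ->
  (forall z, g (- z) = g z) ->
  signed_mean e h j g (- x) = e ^+ j * signed_mean e h j g x.
Proof.
move=> he gE; elim: j x => [|j IH] x /=; first by rewrite expr0 mul1r gE.
have -> : - x + h = - (x - h) by ring.
have -> : - x - h = - (x + h) by ring.
rewrite !IH exprS; case/orP: he => /eqP ->; rewrite ?expr1n; first by field.
by field.
Qed.

Lemma eq_signed_mean_near e h j g f x :
  (forall z, `|z - x| <= j%:R * `|h| -> g z = f z) ->
  signed_mean e h j g x = signed_mean e h j f x.
Proof.
elim: j x => [|j IH] x gf /=; first by apply: gf; rewrite subrr normr0 mul0r.
congr ((_ + _ * _) / _); apply: IH => z hz; apply: gf.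
  have -> : z - x = z - (x + h) + h by ring.
  by rewrite -natr1 mulrDl mul1r; apply: le_trans (ler_normD _ _) _; rewrite lerD2r.
have -> : z - x = z - (x - h) - h by ring.
by rewrite -natr1 mulrDl mul1r; apply: le_trans (ler_normB _ _) _; rewrite lerD2r.
Qed.

Lemma le_signed_mean h j g f x :
  (forall z, `|z - x| <= j%:R * `|h| -> g z <= f z) ->
  signed_mean 1 h j g x <= signed_mean 1 h j f x.
Proof.
elim: j x => [|j IH] x gf /=; first by apply: gf; rewrite subrr normr0 mul0r.
rewrite !mul1r ler_pM2r ?invr_gt0 //; apply: lerD; apply: IH => z hz; apply: gf.
  have -> : z - x = z - (x + h) + h by ring.
  by rewrite -natr1 mulrDl mul1r; apply: le_trans (ler_normD _ _) _; rewrite lerD2r.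
have -> : z - x = z - (x - h) - h by ring.
by rewrite -natr1 mulrDl mul1r; apply: le_trans (ler_normB _ _) _; rewrite lerD2r.
Qed.

Lemma signed_mean_ge0 h j g x : (forall z, 0 <= g z) ->
  0 <= signed_mean 1 h j g x.
Proof.
by move=> g0; elim: j x => [|j IH] x //=; rewrite mul1r divr_ge0 // addr_ge0.
Qed.

Lemma signed_mean_expR h c j x :
  signed_mean 1 h j (fun z => expR (c * z)) x =
  ((expR (c * h) + expR (- (c * h))) / 2) ^+ j * expR (c * x).
Proof.
elim: j x => [|j IH] x /=; first by rewrite expr0 mul1r.
by rewrite !IH exprS !mulrDr !expRD mulrN; field.
Qed.

(** A central difference cancels the leading terms and so lowers the degree of a polynomial. The
    innermost difference is taken first, by [signed_meanSr], and the rest is induction. *)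
Lemma signed_mean_pow n j x : (j < n)%N ->
  signed_mean (-1) 1 n (fun z => z ^+ j) x = 0.
Proof.
elim: n j x => [//|n IH] j x; rewrite ltnS => jn.
rewrite signed_meanSr.
transitivity (signed_mean (-1) 1 n (fun z => \sum_(i < j)
    ((1 - (-1) ^+ (j - i)) / 2 *+ 'C(j, i)) * z ^+ i) x).
  apply: eq_signed_mean => z.
  rewrite [z + 1]addrC [z - 1]addrC !exprDn !big_ord_recr /= subnn binn.
  rewrite !expr0 !mulr1n !mul1r.
  set A := \sum_(i < j) _; set B := \sum_(i < j) _.
  have -> : (A + z ^+ j + -1 * (B + z ^+ j)) / 2 = (A - B) / 2 by field.
  rewrite -sumrB mulr_suml; apply: eq_bigr => i _.
  by rewrite expr1n mul1r -mulrnBl !mulrnAl; congr (_ *+ _); field.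
rewrite signed_mean_sum big1 // => i _.
by rewrite signed_meanZ IH ?mulr0 // (leq_trans (ltn_ord i)).
Qed.

(** A double difference multiplies [cos (z * t)] by $(2\cos 2t-2)/4=-\sin^2t$. *)
Lemma signed_mean_cos (t x : R) l :
  signed_mean (-1) 1 l.*2 (fun z => cos (z * t)) x =
  (-1) ^+ l * sin t ^+ l.*2 * cos (x * t).
Proof.
elim: l x => [|l IH] x; first by rewrite !expr0 !mul1r.
rewrite doubleS !signed_meanS !IH !exprS.
have -> : x + 1 + 1 = x + 2 by ring.
have -> : x + 1 - 1 = x by ring.
have -> : x - 1 + 1 = x by ring.
have -> : x - 1 - 1 = x - 2 by ring.
have -> : (x + 2) * t = x * t + 2 * t by ring.
have -> : (x - 2) * t = x * t - 2 * t by ring.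
rewrite !cosD cosN sinN.
have -> : cos (2 * t) = 1 - 2 * sin t ^+ 2.
  by rewrite mulr_natl mulr2n cosD; have := cos2Dsin2 t => H; nra.
by field.
Qed.

End SignedMeans.

(** * Inequalities for hyperbolic functions *)

Section Elementary.
Variable R : realType.
Implicit Types (x y t : R) (f df : R -> R).

Lemma nondecreasing_from0 f df x : 0 <= x ->
  (forall t, is_derive t 1 f (df t)) -> (forall t, 0 <= t -> 0 <= df t) ->
  f 0 <= f x.
Proof.
rewrite le_eqVlt => /predU1P[<-//|x0] dfE df0.
have cf : {within `[0, x], continuous f}.
  apply: derivable_within_continuous => z _; exact: ex_derive.
have [z] := MVT x0 (fun z _ => dfE z) cf.
rewrite in_itv /= => /andP[z0 _] /eqP; rewrite subr_eq => /eqP ->.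
by rewrite lerDr mulr_ge0 // ?subr0 ?df0 ?ltW.
Qed.

(** The difference of the two sides vanishes at 0 and has derivative $t(e^t-e^{-t})\ge0$. *)
Lemma sinh_le_xcosh x : 0 <= x ->
  expR x - expR (- x) <= x * (expR x + expR (- x)).
Proof.
move=> x0; rewrite -subr_ge0.
have := @nondecreasing_from0
  (fun t => t * (expR t + expR (- t)) - (expR t - expR (- t)))
  (fun t => t * (expR t - expR (- t))) x x0.
rewrite mul0r oppr0 expR0 !subrr; apply.
  by move=> t; apply: is_derive_eq; rewrite /GRing.scale /=; ring.
by move=> t t0; rewrite mulr_ge0 // subr_ge0 ler_expR; lra.
Qed.

(* The quotient of the two sides is nonincreasing on [0, +oo[. *)
Lemma cosh_le_gauss x : (expR x + expR (- x)) / 2 <= expR (x ^+ 2 / 2).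
Proof.
wlog x0 : x / 0 <= x.
  move=> H; have [/H//|xn] := lerP 0 x.
  by have := H (- x); rewrite opprK sqrrN addrC; apply; lra.
have := @nondecreasing_from0
  (fun t => - ((expR t + expR (- t)) * expR (- (t ^+ 2 / 2))))
  (fun t => (t * (expR t + expR (- t)) - (expR t - expR (- t)))
              * expR (- (t ^+ 2 / 2))) x x0.
rewrite expr0n /= mul0r !oppr0 expR0 mulr1 lerN2 (expRN (x ^+ 2 / 2)).
have e0 := expR_gt0 (x ^+ 2 / 2).
move=> H; rewrite ler_pdivrMr // [leRHS]mulrC -ler_pdivrMr //.
have -> : (2 : R) = 1 + 1 by [].
apply: H => t.
  by apply: is_derive_eq; rewrite /GRing.scale /=; field.
by move=> t0; rewrite mulr_ge0 ?expR_ge0 // subr_ge0 sinh_le_xcosh.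
Qed.

End Elementary.

(** * Differences of order at most p, and absolute moments of sums of signs *)

Section SmoothDifferences.
Variable R : realType.
Implicit Types (h p q x z : R) (j : nat).

Lemma is_derive_signed_mean_powR h q j x : 0 < h -> j%:R * h < x ->
  is_derive x 1 (signed_mean (-1) h j (fun z => z `^ q))
    (q * signed_mean (-1) h j (fun z => z `^ (q - 1)) x).
Proof.
move=> h0; elim: j x => [|j IH] x hx /=.
  apply: is_derive1_powR; move: hx; rewrite mul0r; lra.
move: hx; rewrite -natr1 mulrDl mul1r => hx.
have d1 := IH (x + h) ltac:(lra).
have d2 := IH (x - h) ltac:(lra).
have e1 : is_derive x 1 ((signed_mean (-1) h j (fun z => z `^ q)) \o (fun y => y + h))
   (q * signed_mean (-1) h j (fun z => z `^ (q - 1)) (x + h)).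
  by apply: is_derive_eq; rewrite ?addr0 ?oppr0 ?addr0 ?mulr1.
have e2 : is_derive x 1 ((signed_mean (-1) h j (fun z => z `^ q)) \o (fun y => y - h))
   (q * signed_mean (-1) h j (fun z => z `^ (q - 1)) (x - h)).
  by apply: is_derive_eq; rewrite ?addr0 ?oppr0 ?addr0 ?mulr1.
have -> : (fun y => (signed_mean (-1) h j (fun z => z `^ q) (y + h) +
      -1 * signed_mean (-1) h j (fun z => z `^ q) (y - h)) / 2) =
   2^-1 *: (((signed_mean (-1) h j (fun z => z `^ q)) \o (fun y => y + h)) -
     ((signed_mean (-1) h j (fun z => z `^ q)) \o (fun y => y - h))).
  by apply/funext => y; rewrite !fctE /= /GRing.scale /=; ring.
by apply: is_derive_eq; rewrite /GRing.scale /=; ring.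
Qed.

(** The mean value theorem once per order: each step yields a factor [q * h] and lowers the exponent
    by 1. The final exponent is nonnegative because [j <= q], so the power is smallest at the left
    end [x - j * h]. *)
Lemma signed_mean_powR_ge h q j x : 0 < h -> j%:R <= q -> j%:R * h < x ->
  h ^+ j * \prod_(i < j) (q - i%:R) * (x - j%:R * h) `^ (q - j%:R)
  <= signed_mean (-1) h j (fun z => z `^ q) x.
Proof.
move=> h0; elim: j q x => [|j IH] q x.
  by rewrite expr0 big_ord0 !mul1r mul0r !subr0.
rewrite -natr1 mulrDl mul1r => jq hx.
set S := signed_mean (-1) h j (fun z => z `^ q).
have xh : x - h < x + h by lra.
have dS z : z \in `]x - h, x + h[ ->
    is_derive z 1 S (q * signed_mean (-1) h j (fun z => z `^ (q - 1)) z).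
  by rewrite in_itv /= => /andP[z1 z2]; apply: is_derive_signed_mean_powR => //; lra.
have cS : {within `[x - h, x + h], continuous S}.
  apply: derivable_within_continuous => z; rewrite in_itv /= => /andP[z1 z2].
  by apply: ex_derive; apply: is_derive_signed_mean_powR => //; lra.
have [z] := MVT xh dS cS.
rewrite in_itv /= => /andP[z1 z2] E.
have -> : (S (x + h) + -1 * S (x - h)) / 2 = (S (x + h) - S (x - h)) / 2 by ring.
rewrite E.
have -> : q * signed_mean (-1) h j (fun z => z `^ (q - 1)) z * (x + h - (x - h)) / 2
  = q * h * signed_mean (-1) h j (fun z => z `^ (q - 1)) z by field.
have q0 : 0 <= q by apply: le_trans jq; rewrite addr_ge0.
have H := IH (q - 1) z ltac:(lra) ltac:(lra).
apply: le_trans (ler_wpM2l _ H); last by rewrite mulr_ge0 // ltW.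
rewrite exprS big_ord_recl /= subr0.
under eq_bigr do rewrite /bump /= natrD opprD addrA.
have P0 : 0 <= \prod_(i < j) (q - 1 - i%:R).
  apply: prodr_ge0 => i _; have : (i%:R : R) <= j%:R by rewrite ler_nat ltnW.
  by lra.
have -> : q - (j%:R + 1) = q - 1 - j%:R by ring.
have L : (x - (j%:R * h + h)) `^ (q - 1 - j%:R) <= (z - j%:R * h) `^ (q - 1 - j%:R).
  by apply: ge0_ler_powR; rewrite ?nnegrE; lra.
rewrite [leRHS](_ : _ = h * h ^+ j * (q * \prod_(i < j) (q - 1 - i%:R)) *
  (z - j%:R * h) `^ (q - 1 - j%:R)); last by ring.
by apply: ler_wpM2l => //; rewrite !mulr_ge0 // ?exprn_ge0 ?ltW.
Qed.

(** $1-1/m=(1+1/(m-1))^{-1}\ge e^{-1/(m-1)}$, and [m - 2] is below [m - 1]. *)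
Lemma expR_shrink (m : R) : 2 <= m -> expR (-1) <= (1 - m^-1) `^ (m - 2).
Proof.
move=> m2.
have e1 : expR (- (m - 1)^-1) <= 1 - m^-1.
  rewrite expRN.
  have -> : 1 - m^-1 = (1 + (m - 1)^-1)^-1 by field; lra.
  rewrite lef_pV2 ?posrE ?expR_gt0 ?expR_ge1Dx // ltr_wpDr //.
  by rewrite invr_ge0; lra.
apply: (@le_trans _ _ (expR (- (m - 1)^-1) `^ (m - 2))).
  rewrite -expRM ler_expR mulNr lerN2 mulrC ler_pdivrMr; lra.
apply: ge0_ler_powR; rewrite ?nnegrE ?expR_ge0 //; first by lra.
by apply: le_trans e1; exact: expR_ge0.
Qed.

(** The right side is the bound of [signed_mean_powR_ge] at [x = 1] and [h = (p + 1)^-1]. With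
    $m=p-j+1$, going from $j$ to $j+1$ multiplies it by $\frac{m-1}m(1-1/m)^{m-2}\ge
    e^{-1}\frac{m-1}m$, and the fractions telescope. *)
Lemma falling_telescope p j : 0 < p -> j%:R <= p ->
  expR (- j%:R) * (p - j%:R + 1) / (p + 1) <=
  (p + 1)^-1 ^+ j * \prod_(i < j) (p - i%:R)
    * (1 - j%:R * (p + 1)^-1) `^ (p - j%:R).
Proof.
move=> p0; elim: j => [|j IH].
  move=> _; rewrite ?mulr0n oppr0 expR0 expr0 big_ord0 mul0r !subr0 powR1.
  by rewrite [leLHS](_ : _ = 1) ?mulr1 //; field; lra.
rewrite -natr1 => jp.
have j0 : 0 <= j%:R :> R by [].
have {}IH := IH ltac:(lra).
set m := p - j%:R + 1.
have m2 : 2 <= m by rewrite /m; lra.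
set b := p + 1 in IH *.
have b0 : 0 < b by rewrite /b; lra.
have -> : 1 - (j%:R + 1) * b^-1 = (1 - j%:R * b^-1) * (1 - m^-1).
  by rewrite /m /b; field; rewrite /b; lra.
have X0 : 0 < 1 - j%:R * b^-1.
  by rewrite subr_gt0 ltr_pdivrMr // /b; lra.
rewrite powRM; [|exact: ltW|by rewrite subr_ge0 invf_le1; lra].
rewrite exprS big_ord_recr /=.
have -> : p - (j%:R + 1) = m - 2 by rewrite /m; ring.
have eX : (1 - j%:R * b^-1) `^ (p - j%:R) =
    (1 - j%:R * b^-1) `^ (m - 2) * (1 - j%:R * b^-1).
  rewrite -[X in _ = _ * X]powRr1 ?ltW // -powRD; last by apply/implyP => _; rewrite gt_eqF.
  by congr (_ `^ _); rewrite /m; ring.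
rewrite eX in IH.
set A := _ `^ (m - 2) in IH *.
set P := \prod_(i < j) _ in IH *.
set C := (1 - m^-1) `^ (m - 2).
have C1 : expR (-1) <= C by exact: expR_shrink.
have -> : b^-1 * b^-1 ^+ j * (P * (p - j%:R)) * (A * C) =
   (b^-1 ^+ j * P * (A * (1 - j%:R * b^-1))) * ((p - j%:R) / m * C).
  by rewrite /m /b; field; rewrite /b; lra.
apply: (@le_trans _ _ (expR (- j%:R) * m / b * ((p - j%:R) / m * C))); last first.
  apply: ler_wpM2r => //; apply: mulr_ge0; last exact: powR_ge0.
  by rewrite divr_ge0; lra.
have -> : expR (- (j%:R + 1)) * (m - 2 + 1) / b =
   (expR (- j%:R) * m / b) * ((p - j%:R) / m * expR (-1)).
  by rewrite opprD expRD /m /b; field; rewrite /b; lra.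
apply: ler_wpM2l; first by rewrite !mulr_ge0 ?expR_ge0 ?invr_ge0; lra.
by apply: ler_wpM2l => //; rewrite divr_ge0; lra.
Qed.

Lemma le_expRB1 x : x <= expR (x - 1).
Proof. by have := expR_ge1Dx (x - 1); lra. Qed.

(** The step [(p + 1)^-1] keeps all sample points positive, where the power is smooth, and the
    difference is at least $e^{-j}/(p+1)$. For the mean, $z\le e^{z-1}$ replaces the power by an
    exponential, whose mean is a power of cosh; this gives at most $e^{j/2}$. Finally $j\le p$. *)
Lemma small_order_ratio p j : 1 <= p -> j%:R <= p ->
  let h := (p + 1)^-1 in
  0 < signed_mean 1 h j (fun z => `|z| `^ p) 1 /\
  (expR (- (3 / 2 * p)) / (p + 1)) * signed_mean 1 h j (fun z => `|z| `^ p) 1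
  <= signed_mean (-1) h j (fun z => `|z| `^ p) 1.
Proof.
move=> p1 jp h.
have h0 : 0 < h by rewrite invr_gt0; lra.
have jh : j%:R * h < 1 by rewrite ltr_pdivrMr; lra.
have D1 : expR (- j%:R) / (p + 1) <= signed_mean (-1) h j (fun z => `|z| `^ p) 1.
  have -> : signed_mean (-1) h j (fun z => `|z| `^ p) 1 =
            signed_mean (-1) h j (fun z => z `^ p) 1.
    apply: eq_signed_mean_near => z; rewrite (gtr0_norm h0) => hz.
    by rewrite ger0_norm //; move: hz; rewrite ler_norml; lra.
  apply: le_trans (signed_mean_powR_ge h0 jp jh).
  apply: le_trans (falling_telescope _ jp); last by lra.
  rewrite ler_pM2r ?invr_gt0; last by lra.
  by rewrite ler_peMr ?expR_ge0 //; lra.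
have D0 : 0 < expR (- j%:R) / (p + 1) by rewrite divr_gt0 ?expR_gt0 //; lra.
have DA : signed_mean (-1) h j (fun z => `|z| `^ p) 1 <=
          signed_mean 1 h j (fun z => `|z| `^ p) 1.
  have H : forall i x, `|signed_mean (-1) h i (fun z => `|z| `^ p) x| <=
     signed_mean 1 h i (fun z => `|z| `^ p) x.
    elim=> [|i IH] x /=; first by rewrite ger0_norm // powR_ge0.
    rewrite normrM (@ger0_norm _ 2^-1) ?invr_ge0 // ler_pM2r ?invr_gt0 //.
    by rewrite mul1r mulN1r; apply: le_trans (ler_normB _ _) _; apply: lerD.
  exact: le_trans (ler_norm _) (H _ _).
have A1 : signed_mean 1 h j (fun z => `|z| `^ p) 1 <= expR (j%:R / 2).
  apply: (@le_trans _ _ (signed_mean 1 h j (fun z => expR (- p) * expR (p * z)) 1)).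
    apply: le_signed_mean => z; rewrite (gtr0_norm h0) => hz.
    have z0 : 0 <= z by move: hz; rewrite ler_norml; lra.
    rewrite ger0_norm // -expRD.
    have -> : - p + p * z = (z - 1) * p by ring.
    rewrite expRM; apply: ge0_ler_powR; rewrite ?nnegrE ?expR_ge0 ?le_expRB1 //.
    by lra.
  rewrite signed_meanZ signed_mean_expR mulr1 mulrCA -expRD addNr expR0 mulr1.
  rewrite expRM_natl; apply: lerXn2r; rewrite ?nnegrE ?expR_ge0 //.
  apply: le_trans (cosh_le_gauss _) _; rewrite ler_expR ler_pdivrMr // mulVf //.
  rewrite expr_le1 //; first by rewrite ler_pdivrMr; lra.
  by rewrite divr_ge0; lra.
split; first by apply: lt_le_trans DA; exact: lt_le_trans D1.
apply: le_trans D1; apply: le_trans (ler_wpM2l _ A1) _.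
  by rewrite divr_ge0 ?expR_ge0; lra.
rewrite mulrAC -expRD ler_pM2r ?invr_gt0 ?ler_expR; lra.
Qed.

(** Chernoff's method: $|z|^p\le c(e^{\theta z}+e^{-\theta z})$ with $c=(p/(e\theta))^p$, the
    maximum of $y^pe^{-\theta y}$, and the mean of each exponential is $\cosh(\theta)^n\le
    e^{n\theta^2/2}$. *)
Lemma moment_bound p n : 1 <= p -> (0 < n)%N ->
  signed_mean 1 1 n (fun z => `|z| `^ p) 0
  <= 2 * (p * n%:R / expR 1) `^ (p / 2).
Proof.
move=> p1 n0; have n1 : 0 < n%:R :> R by rewrite ltr0n.
have e1 := expR_gt0 (1 : R).
(* This value minimises $\theta^{-p}e^{n\theta^2/2}$. *)
pose th := Num.sqrt (p / n%:R).
have th2 : th ^+ 2 = p / n%:R by rewrite sqr_sqrtr // divr_ge0 //; lra.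
have th0 : 0 < th by rewrite sqrtr_gt0 divr_gt0 //; lra.
pose c := (p / (expR 1 * th)) `^ p.
have c0 : 0 <= c by exact: powR_ge0.
have B z : `|z| `^ p <= c * expR (th * z) + c * expR (- th * z).
  have H y : 0 <= y -> y `^ p <= c * expR (th * y).
    move=> y0.
    have -> : th * y = th * y / p * p by field; lra.
    rewrite expRM -powRM ?expR_ge0 //; last by rewrite divr_ge0 ?mulr_ge0 ?ltW //; lra.
    apply: ge0_ler_powR; rewrite ?nnegrE //; first by lra.
      by rewrite !mulr_ge0 ?invr_ge0 ?mulr_ge0 ?expR_ge0 ?ltW //; lra.
    have := le_expRB1 (th * y / p); rewrite expRB => le.
    have -> : p / (expR 1 * th) * expR (th * y / p) = (p / th) * (expR (th * y / p) / expR 1).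
      by field; rewrite !gt_eqF.
    apply: le_trans (ler_wpM2l _ le); last by rewrite divr_ge0 //; lra.
    have -> : p / th * (th * y / p) = y by field; rewrite !gt_eqF //; lra.
    by [].
  have [z0|z0] := lerP 0 z.
    rewrite (ger0_norm z0); apply: le_trans (H _ z0) _.
    by rewrite lerDl mulr_ge0 ?expR_ge0.
  rewrite (ltr0_norm z0); apply: le_trans (H (- z) _) _; first by lra.
  by rewrite mulrN -mulNr lerDr mulr_ge0 ?expR_ge0.
apply: le_trans (le_signed_mean (fun z _ => B z)) _.
rewrite signed_meanD !signed_meanZ !signed_mean_expR !mulr0 !mulr1 expR0 !mulr1.
rewrite opprK [expR (- th) + _]addrC.
rewrite [leLHS](_ : _ = 2 * (c * ((expR th + expR (- th)) / 2) ^+ n)); last by ring.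
apply: ler_wpM2l => //.
apply: (@le_trans _ _ (c * expR (p / 2))).
  apply: ler_wpM2l => //.
  have -> : expR (p / 2) = expR (th ^+ 2 / 2) ^+ n.
    by rewrite -expRM_natl; congr expR; rewrite th2; field; rewrite gt_eqF.
  by apply: lerXn2r; rewrite ?nnegrE ?expR_ge0 //; exact: cosh_le_gauss.
have -> : c = ((p / (expR 1 * th)) ^+ 2) `^ (p / 2).
  have nn : 0 <= p / (expR 1 * th) by rewrite divr_ge0 ?mulr_ge0 ?expR_ge0 ?ltW //; lra.
  by rewrite -powR_mulrn // -powRrM /c; congr (_ `^ _); field.
have -> : expR (p / 2) = expR 1 `^ (p / 2) by rewrite -expRM mul1r.
rewrite -powRM ?exprn_even_ge0 ?expR_ge0 //.
have -> // : (p / (expR 1 * th)) ^+ 2 * expR 1 = p * n%:R / expR 1.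
have -> : (p / (expR 1 * th)) ^+ 2 = p ^+ 2 / (expR 1 ^+ 2 * th ^+ 2).
  by field; rewrite !gt_eqF.
rewrite th2; field; rewrite !gt_eqF //; lra.
Qed.

End SmoothDifferences.

(** * Taylor remainders of the cosine *)

Section CosineRemainder.
Variable R : realType.
Implicit Types (t x s p : R) (q l j : nat).

(* The remainders of the Taylor expansions of cos (up to degree 2q) and sin (up
   to degree 2q + 1), with the sign that makes them nonnegative. *)
Fixpoint cos_rem q t : R :=
  if q is q'.+1 then t ^+ q.*2 / (q.*2)`!%:R - cos_rem q' t else 1 - cos t.

Fixpoint sin_rem q t : R :=
  if q is q'.+1 then t ^+ q.*2.+1 / (q.*2.+1)`!%:R - sin_rem q' t else t - sin t.

Lemma is_derive_pow_fact n t :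
  is_derive t 1 (fun x : R => x ^+ n.+1 / n.+1`!%:R) (t ^+ n / n`!%:R).
Proof.
have -> : (fun x : R => x ^+ n.+1 / n.+1`!%:R) =
    (n.+1`!%:R^-1 : R) *: ((@id R) ^+ n.+1).
  by apply/funext => x; rewrite !fctE /GRing.scale /= mulrC.
apply: is_derive_eq.
rewrite /GRing.scale /= !mulr1.
have h1 : n`!%:R != 0 :> R by rewrite pnatr_eq0 -lt0n fact_gt0.
have h2 : n.+1%:R != 0 :> R by rewrite pnatr_eq0.
rewrite factS natrM -mulr_natl; field.
by rewrite h1 addrC natr1 h2.
Qed.

Lemma is_derive_cos_rem q t : is_derive t 1 (cos_rem q.+1) (sin_rem q t).
Proof.
elim: q => [|q IH].
  apply: (@is_deriveB _ _ _ (fun x : R => x ^+ 2 / 2`!%:R) (cos_rem 0) t 1).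
    by have := is_derive_pow_fact 1 t; rewrite divr1 expr1.
  have : is_derive t 1 (fun x : R => 1 - cos x) (sin t).
    by apply: is_derive_eq; rewrite /GRing.scale /=; ring.
  by [].
apply: (@is_deriveB _ _ _ (fun x : R => x ^+ q.+2.*2 / (q.+2.*2)`!%:R) (cos_rem q.+1) t 1).
exact: is_derive_pow_fact.
Qed.

Lemma is_derive_sin_rem q t : is_derive t 1 (sin_rem q) (cos_rem q t).
Proof.
elim: q => [|q IH].
  have : is_derive t 1 (fun x : R => x - sin x) (1 - cos t).
    by apply: is_derive_eq; rewrite /GRing.scale /=; ring.
  by [].
apply: (@is_deriveB _ _ _ (fun x : R => x ^+ q.+1.*2.+1 / (q.+1.*2.+1)`!%:R) (sin_rem q) t 1).
exact: is_derive_pow_fact.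
Qed.

Lemma cos_rem_at0 q : cos_rem q 0 = 0.
Proof.
elim: q => [|q IH] /=; first by rewrite cos0 subrr.
by rewrite IH doubleS exprS !mul0r subr0.
Qed.

Lemma sin_rem_at0 q : sin_rem q 0 = 0.
Proof.
elim: q => [|q IH] /=; first by rewrite sin0 subrr.
by rewrite IH exprS !mul0r subr0.
Qed.

(** Each remainder vanishes at 0 and has the preceding one as derivative, so positivity is inherited
    from $1-\cos$ by monotonicity. *)
Lemma cos_rem_ge0_half q t : 0 <= t -> 0 <= cos_rem q t.
Proof.
elim: q t => [|q IH] t t0; first by rewrite subr_ge0 cos_le1.
have sin0 u : 0 <= u -> 0 <= sin_rem q u.
  move=> u0; rewrite -(sin_rem_at0 q).
  exact: (nondecreasing_from0 u0 (is_derive_sin_rem q)).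
rewrite -(cos_rem_at0 q.+1).
exact: (nondecreasing_from0 t0 (is_derive_cos_rem q)).
Qed.

Lemma cos_remN q t : cos_rem q (- t) = cos_rem q t.
Proof.
elim: q => [|q IH] /=; first by rewrite cosN.
by rewrite IH exprNn -signr_odd odd_double mul1r.
Qed.

Lemma cos_rem_ge0 q t : 0 <= cos_rem q t.
Proof.
have [t0|t0] := lerP 0 t; first exact: cos_rem_ge0_half.
by rewrite -cos_remN cos_rem_ge0_half // oppr_ge0 ltW.
Qed.

(** Against $t^{-p-1}$ with $2q<p<2q+2$, this bound gives integrability at 0, and that of
    [cos_rem_le2], of degree $2q$, gives it at infinity. *)
Lemma cos_rem_le q t : cos_rem q t <= t ^+ q.+1.*2 / (q.+1.*2)`!%:R.
Proof. by have := cos_rem_ge0 q.+1 t; rewrite /= subr_ge0. Qed.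

Lemma cos_rem_le2 q t : cos_rem q t <= 2 * (t ^+ q.*2 / (q.*2)`!%:R).
Proof.
case: q => [|q]; first by rewrite /= expr0 divr1 mulr1; have := cos_geN1 t; lra.
have := cos_rem_ge0 q t; have := cos_rem_ge0 q.+1 t; rewrite /=; lra.
Qed.

Lemma continuous_cos_rem q : continuous (cos_rem q).
Proof.
move=> t; case: q => [|q].
  apply: cvgB; [exact: cvg_cst|exact: continuous_cos].
by apply: differentiable_continuous; apply/derivable1_diffP; apply: ex_derive;
  exact: is_derive_cos_rem.
Qed.

(** The difference of order $2l$ annihilates the Taylor polynomial, of degree at most $2q<2l$, and
    only the cosine is left. *)
Lemma signed_mean_cos_rem q l t : (q < l)%N ->
  signed_mean (-1) 1 l.*2 (fun z => cos_rem q (z * t)) 0 =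
  (-1) ^+ (q.+1 + l) * sin t ^+ l.*2.
Proof.
have zero j : (j < l.*2)%N -> forall c,
    signed_mean (-1) 1 l.*2 (fun z : R => c * z ^+ j) 0 = 0.
  by move=> jl c; rewrite signed_meanZ signed_mean_pow // mulr0.
elim: q => [|q IH] ql.
  transitivity (signed_mean (-1) 1 l.*2 (fun z : R => 1 * z ^+ 0 + (-1) * cos (z * t)) 0).
    by apply: eq_signed_mean => z /=; rewrite expr0 mulr1 mulN1r.
  rewrite signed_meanD zero; last by rewrite double_gt0.
  by rewrite add0r signed_meanZ signed_mean_cos mul0r cos0 mulr1 add1n exprS mulrA.
transitivity (signed_mean (-1) 1 l.*2 (fun z : R =>
   (t ^+ q.+1.*2 / (q.+1.*2)`!%:R) * z ^+ q.+1.*2 + (-1) * cos_rem q (z * t)) 0).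
  by apply: eq_signed_mean => z; rewrite [in LHS]/= mulN1r exprMn; ring.
rewrite signed_meanD zero ?ltn_double // add0r signed_meanZ IH; last exact: ltnW.
by rewrite [(q.+2 + l)%N]addSn exprS mulrA.
Qed.

End CosineRemainder.

(** * The power function as an integral of cosine remainders *)

Section PowerAsCosineIntegral.
Variable R : realType.
Variables (p : R) (q : nat).
Hypotheses (q_lt_p : q.*2%:R < p) (p_lt_q : p < q.+1.*2%:R).
Implicit Types (x s t c : R).
Local Notation mu := lebesgue_measure.

(* The substitution t = exp s turns the integral of cos_rem q (x t) t^(-p-1)
   over t > 0 into an integral over the line, on which rescaling x acts by
   translation. *)
Definition osc x s : R := cos_rem q (x * expR s) * expR (- (p * s)).

Lemma osc_ge0 x s : 0 <= osc x s.
Proof. by rewrite mulr_ge0 ?cos_rem_ge0 ?expR_ge0. Qed.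

Lemma continuous_osc x : continuous (osc x).
Proof.
move=> s; apply: cvgM.
  apply: (@continuous_comp _ _ _ (fun s => x * expR s) (cos_rem q)).
    by apply: cvgM; [exact: cvg_cst|exact: continuous_expR].
  exact: continuous_cos_rem.
apply: (@continuous_comp _ _ _ (fun s => - (p * s)) expR); last exact: continuous_expR.
by apply: cvgN; apply: cvgM; [exact: cvg_cst|exact: cvg_id].
Qed.

Lemma measurable_osc x (D : set R) : measurable D ->
  measurable_fun D (fun s => (osc x s)%:E).
Proof.
move=> mD; apply/measurable_EFinP; apply: measurable_funTS.
by apply: continuous_measurable_fun; exact: continuous_osc.
Qed.

Lemma osc_translate x s : 0 < x -> osc 1 (s + ln x) = x `^ (- p) * osc x s.
Proof.
move=> x0; have -> : x `^ (- p) = expR (- (p * ln x)) by rewrite /powR gt_eqF // mulNr.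
rewrite /osc mul1r expRD lnK ?posrE // mulrDr opprD expRD [expR s * x]mulrC.
by ring.
Qed.

(** The integral is invariant under translation by [ln x]. Hence that of [osc x] is homogeneous of
    degree [p] in [x], which makes it a multiple of $|x|^p$. *)
Lemma integral_osc_scale x : 0 < x ->
  (\int[mu]_s (osc 1 s)%:E = (x `^ (- p))%:E * \int[mu]_s (osc x s)%:E)%E.
Proof.
move=> x0.
have dE : derive1 (fun s : R => s + ln x) = cst 1.
  by apply/funext => s; rewrite derive1E derive_val addr0.
rewrite (@increasing_ge0_integration_by_substitutionT _ (fun s => s + ln x) (osc 1)).
- rewrite -ge0_integralZl //; last by rewrite lee_fin powR_ge0.
  + apply: eq_integral => s _; rewrite dE /= !fctE /= mulr1 osc_translate //.
  + exact: measurable_osc.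
  + by move=> s _; rewrite lee_fin osc_ge0.
- by move=> a b ab; rewrite ltrD2r.
- by rewrite dE => s; exact: cvg_cst.
- by rewrite dE; exact: is_cvg_cst.
- by rewrite dE; exact: is_cvg_cst.
- by move=> s; exact: ex_derive.
- exact: cvg_addrr_Ny.
- exact: cvg_addrr.
- exact: continuous_osc.
- exact: osc_ge0.
Qed.

Lemma integral_expRN_tail c a : 0 < c ->
  (\int[mu]_(s in `[a, +oo[) (expR (- (c * s)))%:E = (expR (- (c * a)) / c)%:E)%E.
Proof.
move=> c0.
have cE : continuous (fun z : R => expR (- (c * z))).
  move=> z; apply: (@continuous_comp _ _ _ (fun s => - (c * s)) expR); last exact: continuous_expR.
  by apply: cvgN; apply: cvgM; [exact: cvg_cst|exact: cvg_id].
have dE (z : R) : is_derive z 1 (fun s => - (expR (- (c * s)) / c)) (expR (- (c * z))).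
  apply: is_derive_eq; rewrite /GRing.scale /=; field.
  by rewrite gt_eqF.
rewrite (@ge0_continuous_FTC2y _ _ (fun s => - (expR (- (c * s)) / c)) _ 0).
- by rewrite sub0e -EFinN opprK.
- by move=> x _; exact: expR_ge0.
- by apply: continuous_subspaceT.
- rewrite -oppr0; apply: cvgN; rewrite -[X in _ --> X](mul0r c^-1); apply: cvgM; last exact: cvg_cst.
  apply: (@cvg_comp _ _ _ (fun z => c * z) (fun z => expR (- z)) _ (pinfty_nbhs R)); last exact: cvgr_expR.
  exact: gt0_cvgMry.
- by move=> x _; exact: ex_derive.
- by apply: cvgN; apply: cvgM; [apply/cvg_at_right_filter; exact: cE|exact: cvg_cst].
- by move=> z _; rewrite derive1E; apply: derive_val.
Qed.

Let a : R := p - q.*2%:R.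

(** The line is cut at [ln T0]; the bound of degree $2q+2$ is used on the left and that of degree
    $2q$ on the right. *)
Lemma integral_osc_bound (T0 : R) : 0 < T0 ->
  (\int[mu]_s (osc 1 s)%:E <=
   (T0 `^ (2 - a) / (2 - a) / (q.+1.*2)`!%:R +
    2 * (T0 `^ (- a) / a) / (q.*2)`!%:R)%:E)%E.
Proof.
move=> T00.
have a0 : 0 < a by rewrite /a subr_gt0.
have a2 : 0 < 2 - a by rewrite /a; move: p_lt_q; rewrite doubleS -addn2 natrD; lra.
pose sg := ln T0.
have E1 (s : R) : expR s ^+ q.+1.*2 * expR (- (p * s)) = expR ((2 - a) * s).
  by rewrite -expRM_natl -expRD /a doubleS -addn2 natrD; congr expR; ring.
have E2 (s : R) : expR s ^+ q.*2 * expR (- (p * s)) = expR (- (a * s)).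
  by rewrite -expRM_natl -expRD /a; congr expR; ring.
rewrite -(setUv `]-oo, sg]%classic) ge0_integral_setU //; last 4 first.
- exact: measurableC.
- by apply: measurable_osc; rewrite setUv.
- by move=> s _; rewrite lee_fin osc_ge0.
- exact/disj_setPCl.
rewrite EFinD; apply: leeD.
- apply: (@le_trans _ _ (\int[mu]_(s in `]-oo, sg]) ((q.+1.*2)`!%:R^-1 * expR ((2 - a) * s))%:E)%E).
    apply: ge0_le_integral => //.
    + by move=> s _; rewrite lee_fin osc_ge0.
    + exact: measurable_osc.
    + apply/measurable_EFinP; apply: measurable_funTS; apply: continuous_measurable_fun => s.
      apply: cvgM; first exact: cvg_cst.
      apply: (@continuous_comp _ _ _ (fun s => (2 - a) * s) expR); last exact: continuous_expR.
      by apply: cvgM; [exact: cvg_cst|exact: cvg_id].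
    move=> s _; rewrite lee_fin /osc mul1r.
    apply: (le_trans (ler_wpM2r (expR_ge0 _) (cos_rem_le _ _))).
    by rewrite mulrAC E1 mulrC.
  have -> : sg = - (- sg) by rewrite opprK.
  rewrite ge0_integration_by_substitutionNy; last 2 first.
  - apply: continuous_subspaceT => s; apply: cvgM; first exact: cvg_cst.
    apply: (@continuous_comp _ _ _ (fun s => (2 - a) * s) expR); last exact: continuous_expR.
    by apply: cvgM; [exact: cvg_cst|exact: cvg_id].
  - by move=> s _; rewrite mulr_ge0 ?expR_ge0 // invr_ge0.
  under eq_integral do rewrite /= mulrN EFinM.
  rewrite ge0_integralZl //; last first.
    apply/measurable_EFinP; apply: measurable_funTS; apply: continuous_measurable_fun => s.
    apply: (@continuous_comp _ _ _ (fun s => - ((2 - a) * s)) expR); last exact: continuous_expR.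
    by apply: cvgN; apply: cvgM; [exact: cvg_cst|exact: cvg_id].
  rewrite integral_expRN_tail // -EFinM lee_fin mulrN opprK mulrC.
  by rewrite /powR gt_eqF.
- rewrite setCitvl; apply: (@le_trans _ _ (\int[mu]_(s in `[sg, +oo[)
     ((2 / (q.*2)`!%:R) * expR (- (a * s)))%:E)%E); last first.
    under eq_integral do rewrite EFinM.
    rewrite ge0_integralZl //; last first.
      apply/measurable_EFinP; apply: measurable_funTS; apply: continuous_measurable_fun => s.
      apply: (@continuous_comp _ _ _ (fun s => - (a * s)) expR); last exact: continuous_expR.
      by apply: cvgN; apply: cvgM; [exact: cvg_cst|exact: cvg_id].
    rewrite integral_expRN_tail // -EFinM lee_fin.
    by rewrite /powR gt_eqF // mulNr mulrAC.
  rewrite -integral_itv_obnd_cbnd; last first.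
    apply/measurable_EFinP; apply: measurable_funTS; apply: continuous_measurable_fun => s.
    apply: cvgM; first exact: cvg_cst.
    apply: (@continuous_comp _ _ _ (fun s => - (a * s)) expR); last exact: continuous_expR.
    by apply: cvgN; apply: cvgM; [exact: cvg_cst|exact: cvg_id].
  apply: ge0_le_integral => //.
  + by move=> s _; rewrite lee_fin osc_ge0.
  + exact: measurable_osc.
  + apply/measurable_EFinP; apply: measurable_funTS; apply: continuous_measurable_fun => s.
    apply: cvgM; first exact: cvg_cst.
    apply: (@continuous_comp _ _ _ (fun s => - (a * s)) expR); last exact: continuous_expR.
    by apply: cvgN; apply: cvgM; [exact: cvg_cst|exact: cvg_id].
  move=> s _; rewrite lee_fin /osc mul1r.
  apply: (le_trans (ler_wpM2r (expR_ge0 _) (cos_rem_le2 _ _))).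
  by rewrite -E2 le_eqVlt; apply/orP; left; apply/eqP; ring.
Qed.

Let K : R := \int[mu]_s (osc 1 s).

Lemma integral_osc1_lty : (\int[mu]_s (osc 1 s)%:E < +oo)%E.
Proof. by apply: le_lt_trans (integral_osc_bound ltr01) _; exact: ltry. Qed.

Lemma integral_osc1E : (\int[mu]_s (osc 1 s)%:E)%E = K%:E.
Proof.
rewrite /K /Rintegral fineK // ge0_fin_numE ?integral_osc1_lty //.
by apply: integral_ge0 => s _; rewrite lee_fin osc_ge0.
Qed.

Let p_gt0 : 0 < p.
Proof. exact: le_lt_trans q_lt_p. Qed.

Lemma integral_oscE x : (\int[mu]_s (osc x s)%:E)%E = (`|x| `^ p * K)%:E.
Proof.
wlog x0 : x / 0 <= x.
  move=> H; have [|xn] := lerP 0 x; first exact: H.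
  have <- : (\int[mu]_s (osc (- x) s)%:E)%E = (\int[mu]_s (osc x s)%:E)%E.
    by apply: eq_integral => s _; rewrite /osc mulNr cos_remN.
  by rewrite H ?normrN // oppr_ge0 ltW.
move: x0; rewrite le_eqVlt => /predU1P[<-|x0].
  rewrite normr0 powR0 ?gt_eqF // mul0r; apply: integral0_eq => s _.
  by rewrite /osc mul0r cos_rem_at0 mul0r.
rewrite (gtr0_norm x0).
have := integral_osc_scale x0; rewrite integral_osc1E => E.
have xp : 0 < x `^ (- p) by exact: powR_gt0.
have -> : (\int[mu]_s (osc x s)%:E =
    (x `^ p)%:E * ((x `^ (- p))%:E * \int[mu]_s (osc x s)%:E))%E.
  rewrite muleA -EFinM -powRD; last by apply/implyP => _; rewrite gt_eqF.
  by rewrite subrr powRr0 mul1e.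
by rewrite -E -EFinM.
Qed.

Lemma integrable_osc x : mu.-integrable setT (fun s => (osc x s)%:E).
Proof.
apply/integrableP; split; first exact: measurable_osc.
have -> : (\int[mu]_s `|(osc x s)%:E| = \int[mu]_s (osc x s)%:E)%E.
  by apply: eq_integral => s _; rewrite gee0_abs // lee_fin osc_ge0.
by rewrite integral_oscE ltry.
Qed.

Lemma integral_signed_mean_osc j x :
  mu.-integrable setT (fun s => (signed_mean (-1) 1 j (osc^~ s) x)%:E) /\
  \int[mu]_s (signed_mean (-1) 1 j (osc^~ s) x) =
  signed_mean (-1) 1 j (fun z => `|z| `^ p) x * K.
Proof.
elim: j x => [|j IH] x /=.
  by split; [exact: integrable_osc|rewrite /Rintegral integral_oscE].
have [i1 e1] := IH (x + 1); have [i2 e2] := IH (x - 1).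
have E s : (signed_mean (-1) 1 j (osc^~ s) (x + 1) +
    -1 * signed_mean (-1) 1 j (osc^~ s) (x - 1)) / 2 =
    2^-1 * (signed_mean (-1) 1 j (osc^~ s) (x + 1) -
     signed_mean (-1) 1 j (osc^~ s) (x - 1)) by field.
have iB : mu.-integrable setT (fun s => (signed_mean (-1) 1 j (osc^~ s) (x + 1) -
     signed_mean (-1) 1 j (osc^~ s) (x - 1))%:E).
  exact: (integrableB measurableT i1 i2).
split.
  under eq_fun do rewrite E EFinM.
  exact: (integrableZl measurableT _ iB).
under eq_Rintegral do rewrite E.
by rewrite RintegralZl // RintegralB // e1 e2; field.
Qed.

Lemma Bernoulli_sub (y : R) n : 0 <= y <= 1 -> 1 - n%:R * y <= (1 - y) ^+ n.
Proof.
move=> /andP[y0 y1]; elim: n => [|n IH]; first by rewrite mul0r subr0 expr0.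
rewrite exprS -natr1.
apply: le_trans (ler_wpM2l _ IH); last by lra.
have : 0 <= n%:R * y ^+ 2 by rewrite mulr_ge0 // sqr_ge0.
by rewrite expr2; nra.
Qed.

(** Only $t=e^s$ in $[\pi/2-1/\sqrt n,\pi/2]$ is kept. There, with $x=\pi/2-t$, one has
    $\sin^nt\ge(1-x^2/2)^n\ge1-nx^2/2\ge1/2$ and $t^{-p}\ge(\pi/2)^{-p}$; the range of $s$ has
    length at least $(2/\pi)/\sqrt n$. *)
Lemma sin_integral_ge n : (1 < n)%N -> ~~ odd n ->
  ((2^-1 * (2 / pi) `^ (p + 1) / Num.sqrt n%:R)%:E <=
   \int[mu]_s (sin (expR s) ^+ n * expR (- (p * s)))%:E)%E.
Proof.
move=> n1 en.
have n2 : 2 <= n%:R :> R by rewrite ler_nat.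
have pi2 := pi_ge2 R.
pose sn : R := Num.sqrt n%:R.
have sn2 : sn ^+ 2 = n%:R by rewrite sqr_sqrtr.
have sn1 : 1 < sn by rewrite -(ltr_pXn2r (_ : 0 < 2)%N) ?nnegrE ?sqrtr_ge0 // sn2 expr1n; lra.
pose h := sn^-1.
have h0 : 0 < h by rewrite invr_gt0; lra.
have h1 : h < 1 by rewrite invf_lt1; lra.
pose s1 := ln (pi / 2 - h : R); pose s2 := ln (pi / 2 : R).
have u0 : 0 < pi / 2 - h :> R by lra.
have v0 : 0 < pi / 2 :> R by lra.
have s12 : s1 < s2 by rewrite ltr_ln ?posrE //; lra.
pose c : R := 2^-1 * (pi / 2) `^ (- p).
have mf : measurable_fun setT (fun s : R => (sin (expR s) ^+ n * expR (- (p * s)))%:E).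
  apply/measurable_EFinP; apply: continuous_measurable_fun => s; apply: cvgM.
    apply: (@continuous_comp _ _ _ (fun s => sin (expR s)) (fun x => x ^+ n)).
      apply: (@continuous_comp _ _ _ expR sin); [exact: continuous_expR|exact: continuous_sin].
    exact: exprn_continuous.
  apply: (@continuous_comp _ _ _ (fun s => - (p * s)) expR); last exact: continuous_expR.
  by apply: cvgN; apply: cvgM; [exact: cvg_cst|exact: cvg_id].
have f0 s : 0 <= sin (expR s) ^+ n * expR (- (p * s)) by rewrite mulr_ge0 ?expR_ge0 ?exprn_even_ge0.
have sub : (\int[mu]_(s in `[s1, s2]) (sin (expR s) ^+ n * expR (- (p * s)))%:E <=
     \int[mu]_s (sin (expR s) ^+ n * expR (- (p * s)))%:E)%E.
  by apply: ge0_subset_integral => // s _; rewrite lee_fin.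
apply: le_trans sub.
apply: (@le_trans _ _ (\int[mu]_(s in `[s1, s2]) (cst c%:E) s)%E); last first.
  apply: ge0_le_integral => //.
  - by move=> s _; rewrite lee_fin mulr_ge0 ?powR_ge0.
  - exact: measurable_funTS.
  move=> s /=; rewrite in_itv /= => /andP[a1 a2]; rewrite lee_fin; apply: ler_pM => //.
  - exact: powR_ge0.
  - have e1 : pi / 2 - h <= expR s by rewrite -[leLHS]lnK ?posrE // ler_expR.
    have e2 : expR s <= pi / 2 by rewrite -[leRHS]lnK ?posrE // ler_expR.
    pose x := pi / 2 - expR s.
    have -> : expR s = pi / 2 - x by rewrite /x; ring.
    have -> : sin (pi / 2 - x) = cos x by rewrite sinB sin_pihalf cos_pihalf mul1r mul0r subr0.
    have x0 : 0 <= x by rewrite /x; lra.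
    have xh : x <= h by rewrite /x; lra.
    have x2 : x ^+ 2 <= n%:R^-1.
      by rewrite -sn2 -exprVn -/h; apply: lerXn2r => //; rewrite nnegrE ltW.
    have nx : n%:R * (x ^+ 2 / 2) <= 2^-1.
      have := ler_wpM2l (ler0n R n) x2; rewrite divff; last by lra.
      by lra.
    have y0 : 0 <= x ^+ 2 / 2 by rewrite divr_ge0 // sqr_ge0.
    have y1 : x ^+ 2 / 2 <= 1 by nra.
    have cx : 1 - x ^+ 2 / 2 <= cos x.
      have : 1 - cos x <= x ^+ 2 / 2 := cos_rem_le 0 x; lra.
    apply: (@le_trans _ _ ((1 - x ^+ 2 / 2) ^+ n)).
      by apply: le_trans (Bernoulli_sub n _); [lra|rewrite y0 y1].
    by apply: lerXn2r; rewrite ?nnegrE; lra.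
  rewrite /powR gt_eqF // ler_expR mulNr lerN2 ler_pM2l //.
rewrite integral_cst //=.
rewrite lebesgue_measure_itv /= lte_fin s12.
rewrite -EFinB -EFinM lee_fin.
have L : h / (pi / 2) <= s2 - s1.
  have := @le_ln1Dx R (- (h / (pi / 2))).
  have hh : h / (pi / 2) < 1 by rewrite ltr_pdivrMr; lra.
  rewrite ltrN2 => /(_ hh).
  have -> : 1 - h / (pi / 2) = (pi / 2 - h) / (pi / 2) by field; lra.
  by rewrite ln_div ?posrE // -/s1 -/s2; lra.
apply: le_trans (ler_wpM2l _ L); last by rewrite mulr_ge0 ?powR_ge0.
have -> : (2 / pi) `^ (p + 1) = (pi / 2) `^ (- p) / (pi / 2) :> R.
  have -> : 2 / pi = (pi / 2)^-1 :> R by field; lra.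
  rewrite -powR_inv1; last exact: ltW.
  rewrite -powRrM -powRD; last by apply/implyP => _; rewrite gt_eqF.
  by congr (_ `^ _); ring.
by rewrite /c /h /sn le_eqVlt; apply/orP; left; apply/eqP; ring.
Qed.

(** The difference of [osc] has the same sign for every [s], because an even power of sin is
    nonnegative. So nothing cancels under the integral, and its absolute value is the sine
    integral. *)
Lemma signed_mean_powR_sin l : (q < l)%N ->
  2^-1 * (2 / pi) `^ (p + 1) / Num.sqrt l.*2%:R <=
  `|signed_mean (-1) 1 l.*2 (fun z => `|z| `^ p) 0| * K.
Proof.
move=> ql.
have K0 : 0 <= K by rewrite -lee_fin -integral_osc1E; apply: integral_ge0 => s _; rewrite lee_fin osc_ge0.
have E s : signed_mean (-1) 1 l.*2 (osc^~ s) 0 =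
    (-1) ^+ (q.+1 + l) * (sin (expR s) ^+ l.*2 * expR (- (p * s))).
  rewrite mulrA -signed_mean_cos_rem // mulrC -signed_meanZ.
  by apply: eq_signed_mean => z; rewrite /osc mulrC.
have [iD eD] := integral_signed_mean_osc l.*2 0.
have F s : sin (expR s) ^+ l.*2 * expR (- (p * s)) =
   (-1) ^+ (q.+1 + l) * signed_mean (-1) 1 l.*2 (osc^~ s) 0.
  by rewrite E mulrA -expr2 sqrr_sign mul1r.
have iF : mu.-integrable setT (fun s : R => (sin (expR s) ^+ l.*2 * expR (- (p * s)))%:E).
  under eq_fun do rewrite F EFinM.
  exact: (integrableZl measurableT _ iD).
have eF : \int[mu]_s (sin (expR s) ^+ l.*2 * expR (- (p * s))) =
   (-1) ^+ (q.+1 + l) * (signed_mean (-1) 1 l.*2 (fun z => `|z| `^ p) 0 * K).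
  under eq_Rintegral do rewrite F.
  by rewrite RintegralZl // eD.
have := @sin_integral_ge l.*2; rewrite odd_double => /(_ _ isT).
have l2 : (1 < l.*2)%N by case: (l) ql.
move=> /(_ l2); rewrite -[X in (_ <= X)%E](@fineK _ _) ?integrable_fin_num //.
rewrite lee_fin => /le_trans; apply.
rewrite -[leLHS]/(\int[mu]_s (sin (expR s) ^+ l.*2 * expR (- (p * s)))) eF.
apply: le_trans (ler_norm _) _.
by rewrite !normrM normrX normrN normr1 expr1n mul1r (ger0_norm K0).
Qed.

Lemma signed_mean_powR_large l (T0 : R) : (q < l)%N -> 0 < T0 ->
  T0 ^+ 2 = q.*2.+1%:R * q.*2.+2%:R ->
  (q.*2)`!%:R * T0 `^ a * (a * (2 - a)) / 8 * (2 / pi) `^ (p + 1) / Num.sqrt l.*2%:R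
  <= `|signed_mean (-1) 1 l.*2 (fun z => `|z| `^ p) 0|.
Proof.
move=> ql T00 T02.
have a0 : 0 < a by rewrite /a subr_gt0.
have a2 : 0 < 2 - a by rewrite /a; move: p_lt_q; rewrite doubleS -addn2 natrD; lra.
have f0 : 0 < (q.*2)`!%:R :> R by rewrite ltr0n fact_gt0.
have Ta0 : 0 < T0 `^ a by exact: powR_gt0.
(* At this [T0] the two bounds on the remainder agree up to the factor 2, so both pieces scale like
   $1/((2q)!\,T_0^a)$. Their sum has numerator [4 - a], rounded up to 4. *)
have KB : K <= 4 / ((q.*2)`!%:R * T0 `^ a * (a * (2 - a))).
  rewrite -lee_fin -integral_osc1E; apply: le_trans (integral_osc_bound T00) _.
  rewrite lee_fin.
  have -> : T0 `^ (2 - a) = T0 ^+ 2 / T0 `^ a.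
    rewrite powRB; last by apply/implyP => _; rewrite gt_eqF.
    by rewrite powR_mulrn // ltW.
  rewrite powRN T02 doubleS !factS !natrM.
  rewrite [leLHS](_ : _ = (4 - a) / ((q.*2)`!%:R * T0 `^ a * (a * (2 - a)))); last first.
    have h1 : q.*2.+1%:R != 0 :> R by rewrite pnatr_eq0.
    have h2 : q.*2.+2%:R != 0 :> R by rewrite pnatr_eq0.
    move: h1 h2 Ta0 f0; move: (q.*2.+1%:R : R) (q.*2.+2%:R : R) (T0 `^ a) ((q.*2)`!%:R : R).
    move: a a0 a2 => b b0 b2 u v w f h1 h2 w0 f0; field.
    by rewrite (gt_eqF f0) (gt_eqF b0) (gt_eqF b2) (gt_eqF w0) h1 h2.
  by rewrite ler_pM2r ?invr_gt0 ?mulr_gt0 //; lra.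
have := le_trans (signed_mean_powR_sin ql) (ler_wpM2l (normr_ge0 _) KB).
set D := `| _ |; set c := (2 / pi) `^ _; set r := Num.sqrt _.
set B := (q.*2)`!%:R * _ * _.
have B0 : 0 < B by rewrite !mulr_gt0.
rewrite -ler_pdivrMr ?divr_gt0 // => /(le_trans _); apply.
have -> : (8 : R)^-1 = 2^-1 * 4^-1 by field.
by rewrite le_eqVlt; apply/orP; left; apply/eqP; rewrite invf_div; ring.
Qed.

End PowerAsCosineIntegral.

(** * Numerical estimates *)

Section Numerics.
Variable R : realType.
Implicit Types (x p a w : R) (n k : nat).

Lemma pi_ge3 : 3 <= pi :> R.
Proof.
rewrite leNgt; apply/negP => pi3.
have pi2 := pi_ge2 R.
pose x : R := pi / 2.
have H : 1 - x ^+ 2 / 2 + x ^+ 4 / 24 - x ^+ 6 / 720 <= cos x.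
  have : 0 <= x ^+ 6 / 720 - (x ^+ 4 / 24 - (x ^+ 2 / 2 - (1 - cos x))) := cos_rem_ge0 3 x.
  by lra.
rewrite /x cos_pihalf -/x in H.
have y1 : 0 <= x ^+ 2 by exact: sqr_ge0.
have y2 : x ^+ 2 <= 9 / 4 by rewrite /x; nra.
have e4 : x ^+ 4 = (x ^+ 2) ^+ 2 by rewrite -exprM.
have e6 : x ^+ 6 = (x ^+ 2) ^+ 3 by rewrite -exprM.
rewrite e4 e6 in H; move: (x ^+ 2) y1 y2 H => y y1 y2 H.
have : y ^+ 3 <= 9 / 4 * y ^+ 2 by rewrite exprS; apply: ler_wpM2r => //; exact: sqr_ge0.
by nra.
Qed.

Lemma pi_le : pi <= 16 / 5 :> R.
Proof.
rewrite leNgt; apply/negP => pi3.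
have H : cos (8 / 5 : R) <= 1 - (8 / 5) ^+ 2 / 2 + (8 / 5) ^+ 4 / 24.
  have : 0 <= (8 / 5 : R) ^+ 4 / 24 - ((8 / 5) ^+ 2 / 2 - (1 - cos (8 / 5))) := cos_rem_ge0 2 _.
  by lra.
have : 0 <= cos (8 / 5 : R) by apply: cos_ge0_pihalf; lra.
by lra.
Qed.

(** Repeated squaring from $e^{1/16}\ge17/16$, rounded down each time. The value 2.63 is just large
    enough for $2e^3\ge36$ in [large_order_numeric]. *)
Lemma expR1_ge : 263 / 100 <= expR 1 :> R.
Proof.
have -> : expR 1 = ((((expR (16%:R^-1)) ^+ 2) ^+ 2) ^+ 2) ^+ 2 :> R.
  by rewrite -!exprM -expRM_natl; congr expR; field.
have sq (u c d : R) : 0 <= c -> c <= u -> d <= c * c -> d <= u ^+ 2 by move=> *; nra.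
have H : 17 / 16 <= expR (16%:R^-1 : R) by have := expR_ge1Dx (16%:R^-1 : R); lra.
apply: (sq _ (1623 / 1000)); [lra| |lra].
apply: (sq _ (1274 / 1000)); [lra| |lra].
apply: (sq _ (11289 / 10000)); [lra| |lra].
by apply: (sq _ (17 / 16)); lra.
Qed.

Lemma ler_powX (n : nat) (c u : R) : 0 <= c -> c <= u -> c ^+ n <= u ^+ n.
Proof. by move=> c0 cu; apply: lerXn2r => //; rewrite nnegrE; lra. Qed.

Lemma expR1_le3 : expR 1 <= 3 :> R.
Proof.
have H : 5 / 6 <= expR (- 6%:R^-1 : R) by have := expR_ge1Dx (- 6%:R^-1 : R); lra.
have H6 := ler_powX 6 (ltac:(lra) : (0 : R) <= 5 / 6) H.
have E : expR (- 6%:R^-1 : R) ^+ 6 = (expR 1)^-1.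
  by rewrite -expRM_natl -expRN; congr expR; field.
rewrite E in H6; have e0 := expR_gt0 (1 : R).
have : expR 1 * (expR 1)^-1 = 1 :> R by rewrite divff ?gt_eqF.
clear E H; move: ((expR 1)^-1) H6 => y H6 H1.
have y3 : 3^-1 <= y by lra.
by nra.
Qed.

(** A weak Stirling bound, by induction with $(1+1/(m+2))^m\le e\le3$. The shift by 2 lets $n=2q$ be
    compared with $p/5$, as $p<2q+2$. *)
Lemma fact_ge n : ((n%:R + 2) / 5) ^+ n <= n`!%:R :> R.
Proof.
elim: n => [|n IH]; first by rewrite expr0.
case: n IH => [|[|n]] IH; try (by rewrite /factorial /= ?expr1 ?expr2; lra).
set m := n.+2 in IH *.
have m2 : 2 <= m%:R :> R by rewrite ler_nat.
rewrite factS natrM exprS -natr1.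
have -> : ((m%:R + 1 + 2) / 5) ^+ m = ((m%:R + 2) / 5) ^+ m * (1 + (m%:R + 2)^-1) ^+ m :> R.
  by rewrite -exprMn; congr (_ ^+ _); field; lra.
have H : (1 + (m%:R + 2)^-1) ^+ m <= 3 :> R.
  apply: le_trans expR1_le3.
  have -> : 1 = m%:R * m%:R^-1 :> R by rewrite divff; lra.
  rewrite expRM_natl divff; last by lra.
  apply: ler_powX; first by rewrite addr_ge0 // invr_ge0; lra.
  apply: le_trans (expR_ge1Dx _) _; rewrite ler_expR lef_pV2 ?posrE; lra.
have q0 : 0 <= ((m%:R + 2) / 5) ^+ m :> R by rewrite exprn_ge0 // divr_ge0; lra.
have f0 : 0 <= m`!%:R :> R by [].
apply: (@le_trans _ _ ((m%:R + 1 + 2) / 5 * (m`!%:R * 3))).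
  apply: ler_wpM2l; first by lra.
  by apply: ler_pM => //; rewrite exprn_ge0 // addr_ge0 // invr_ge0; lra.
by nra.
Qed.

(** The bound on the integral constant has [a * (2 - a)] in its denominator and degenerates near
    even integers; the sine vanishes there at the same rate. This is how $|\sin(\pi p/2)|$ enters
    the constant. *)
Lemma sin_bound a (q : nat) : 0 < a -> a < 2 ->
  `|sin (pi * (q.*2%:R + a) / 2)| <= pi / 2 * (a * (2 - a)).
Proof.
move=> a0 a2; have pi3 := pi_ge3.
have -> : `|sin (pi * (q.*2%:R + a) / 2)| = `|sin (pi * a / 2)|.
  elim: q => [|q IH]; first by rewrite add0r.
  rewrite -IH doubleS -addn2 natrD.
  have -> : pi * (q.*2%:R + 2 + a) / 2 = pi * (q.*2%:R + a) / 2 + pi :> R by field.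
  by rewrite sinDpi normrN.
have sle x : 0 <= x -> sin x <= x.
  move=> x0; have := @nondecreasing_from0 R (@sin_rem R 0) (@cos_rem R 0) x x0 (is_derive_sin_rem 0).
  rewrite sin_rem_at0 => H.
  have : 0 <= x - sin x by apply: H => t _; exact: cos_rem_ge0.
  by lra.
have b0 : 0 <= pi * a / 2 by rewrite divr_ge0 // mulr_ge0 //; lra.
have b1 : pi * a / 2 <= pi by nra.
rewrite ger0_norm; last by apply: sin_ge0_pi; apply/andP.
have [a1|a1] := lerP a 1.
  by apply: le_trans (sle _ b0) _; nra.
have -> : sin (pi * a / 2) = sin (pi - pi * a / 2) by rewrite sinB sinpi cospi mul0r mulN1r sub0r opprK.
by apply: le_trans (sle _ _) _; nra.
Qed.

(** Besides [fact_ge] this uses $T_0\ge\frac7{10}p=\frac p5\cdot\frac72$. The critical case is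
    [q = 0] with [p] near 2, where $T_0/p$ tends to $1/\sqrt2>7/10$. *)
Lemma growth_ge p (q : nat) (T0 : R) : 1 <= p -> q.*2%:R < p -> p < q.+1.*2%:R ->
  0 < T0 -> T0 ^+ 2 = q.*2.+1%:R * q.*2.+2%:R ->
  (p / 5) `^ p * (7 / 2) `^ (p - q.*2%:R) <= (q.*2)`!%:R * T0 `^ (p - q.*2%:R).
Proof.
move=> p1 qp pq T00 T02; set a := p - q.*2%:R.
have a0 : 0 < a by rewrite /a; lra.
move: pq; rewrite doubleS -addn2 natrD => pq.
have T1 : 7 / 10 * p <= T0.
  rewrite -(ler_pXn2r (_ : 0 < 2)%N) ?nnegrE; [|by []|lra|exact: ltW].
  have E1 : q.*2.+1%:R = q.*2%:R + 1 :> R by rewrite natr1.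
  have E2 : q.*2.+2%:R = q.*2%:R + 2 :> R by rewrite -natrD addn2.
  rewrite T02 E1 E2 exprMn.
  have : 0 <= q.*2%:R :> R by [].
  by move: (q.*2%:R) qp pq => z *; nra.
have -> : (p / 5) `^ p = (p / 5) ^+ q.*2 * (p / 5) `^ a.
  rewrite -powR_mulrn; last by lra.
  rewrite -powRD; first by congr (_ `^ _); rewrite /a; ring.
  by apply/implyP => _; rewrite gt_eqF //; lra.
rewrite -mulrA -powRM; [|lra|lra].
apply: ler_pM; rewrite ?powR_ge0 // ?exprn_ge0 //; first by lra.
  by apply: le_trans (fact_ge _); apply: ler_powX; lra.
by apply: ge0_ler_powR; rewrite ?nnegrE; lra.
Qed.

(** $n/k\le1+1/k\le e^{1/k}$ and $(p+1)/(2k)\le2/3$, so the power is at most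
    $e^{2/3}\le3^{2/3}<2.1$. *)
Lemma ratio_pow_le p n k : 1 <= p -> p < k%:R -> (2 < k)%N -> (n <= k.+1)%N ->
  (n%:R / k%:R) `^ ((p + 1) / 2) <= 21 / 10.
Proof.
move=> p1 pk k3 nk.
have k3' : 3 <= k%:R :> R by rewrite ler_nat.
have e1 := @expR_gt0 R 1; have e3 := expR1_le3.
apply: (@le_trans _ _ (expR (k%:R^-1) `^ ((p + 1) / 2))).
  apply: ge0_ler_powR; rewrite ?nnegrE ?expR_ge0 //; first by lra.
  apply: le_trans (expR_ge1Dx _); rewrite ler_pdivrMr; last by lra.
  rewrite mulrDl mul1r mulVf; last by lra.
  by rewrite natr1 ler_nat.
rewrite -expRM.
apply: (@le_trans _ _ (expR (2 / 3))).
  by rewrite ler_expR mulrC ler_pdivrMr; lra.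
rewrite -(ler_pXn2r (_ : 0 < 3)%N) ?nnegrE ?expR_ge0 //.
have -> : expR (2 / 3) ^+ 3 = expR 1 ^+ 2 :> R.
  by rewrite -!expRM_natl; congr expR; field.
apply: (@le_trans _ _ (3 ^+ 2)); last by lra.
by apply: ler_powX => //; exact: ltW.
Qed.

(** Explains the base $2p/(e^2\pi^2k)$: its $\pi^2$ cancels the powers of $\pi/2$ from the sine
    integral, and its $k$ meets the [n] of the moment bound, leaving $\frac p{2e^2}\cdot\frac nk$.
    The remaining powers are at most $(p/6)^p$ because $2e^3\ge36$. *)
Lemma large_order_numeric p n k : 1 <= p -> p < k%:R -> (2 < k)%N -> (n <= k.+1)%N ->
  (0 < n)%N ->
  ((2 * p) / (expR 1 ^+ 2 * pi ^+ 2 * k%:R)) `^ ((p + 1) / 2) *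
    (p * n%:R / expR 1) `^ (p / 2) * (pi / 2) `^ (p + 1) * Num.sqrt n%:R
  <= 21 / 10 * (p / (2 * expR 1 ^+ 2)) `^ (2^-1) * (p / 6) `^ p.
Proof.
move=> p1 pk k3 nk n0.
have k3' : 3 <= k%:R :> R by rewrite ler_nat.
have n0' : 0 < n%:R :> R by rewrite ltr0n.
have pi3 := pi_ge3; have eg := expR1_ge.
set E := expR 1 in eg *.
have E0 : 0 < E by lra.
have pE0 : 0 <= p / E by rewrite divr_ge0; lra.
have nk0 : 0 <= n%:R / k%:R :> R by rewrite divr_ge0.
have -> : Num.sqrt n%:R = n%:R `^ 2^-1 :> R by rewrite powR12_sqrt.
have -> : (p * n%:R / E) `^ (p / 2) = (p / E) `^ (p / 2) * n%:R `^ (p / 2).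
  by rewrite -powRM //; congr (_ `^ _); rewrite mulrAC.
have -> : (pi / 2) `^ (p + 1) = ((pi / 2) ^+ 2) `^ ((p + 1) / 2) :> R.
  rewrite -powR_mulrn; last by lra.
  by rewrite -powRrM; congr (_ `^ _); field.
set B := _ / (E ^+ 2 * _ * _).
have B0 : 0 <= B by rewrite divr_ge0 ?mulr_ge0 ?sqr_ge0 //; lra.
rewrite [leLHS](_ : _ = (B * (pi / 2) ^+ 2 * n%:R) `^ ((p + 1) / 2) * (p / E) `^ (p / 2)); last first.
  have -> : (B * (pi / 2) ^+ 2 * n%:R) `^ ((p + 1) / 2) = B `^ ((p + 1) / 2) *
      ((pi / 2) ^+ 2) `^ ((p + 1) / 2) * n%:R `^ ((p + 1) / 2).
    by rewrite powRM ?(mulr_ge0 B0) ?sqr_ge0 // powRM ?sqr_ge0.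
  have -> : n%:R `^ ((p + 1) / 2) = n%:R `^ (p / 2) * n%:R `^ 2^-1 :> R.
    rewrite -powRD; first by congr (_ `^ _); ring.
    by apply/implyP => _; rewrite gt_eqF.
  by ring.
have -> : B * (pi / 2) ^+ 2 * n%:R = (p / (2 * E ^+ 2)) * (n%:R / k%:R).
  by rewrite /B; field; rewrite !gt_eqF //; lra.
set W := p / (2 * E ^+ 2).
have W0 : 0 < W by rewrite divr_gt0 ?mulr_gt0 ?exprn_gt0 //; lra.
have W0' := ltW W0.
rewrite powRM //.
have -> : W `^ ((p + 1) / 2) = W `^ 2^-1 * W `^ (p / 2).
  rewrite -powRD; first by congr (_ `^ _); ring.
  by apply/implyP => _; rewrite gt_eqF.
have RL := ratio_pow_le p1 pk k3 nk.
set Q := (n%:R / k%:R) `^ _ in RL *.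
have Q0 : 0 <= Q by exact: powR_ge0.
have H : W `^ (p / 2) * (p / E) `^ (p / 2) <= (p / 6) `^ p.
  rewrite -powRM //.
  have -> : (p / 6) `^ p = ((p / 6) ^+ 2) `^ (p / 2).
    rewrite -powR_mulrn; last by lra.
    by rewrite -powRrM; congr (_ `^ _); field.
  apply: ge0_ler_powR; rewrite ?nnegrE ?sqr_ge0 ?(mulr_ge0 W0' pE0) //; first by lra.
  have -> : W * (p / E) = p ^+ 2 / (2 * E ^+ 3) by rewrite /W; field; rewrite gt_eqF.
  rewrite exprMn; apply: ler_wpM2l; first exact: sqr_ge0.
  have -> : (6^-1 : R) ^+ 2 = 36^-1 by field.
  rewrite lef_pV2 ?posrE ?mulr_gt0 ?exprn_gt0 //.
  have := ler_powX 3 (ltac:(lra) : (0 : R) <= 263 / 100) eg.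
  by lra.
rewrite [leLHS](_ : _ = Q * W `^ 2^-1 * (W `^ (p / 2) * (p / E) `^ (p / 2))); last by ring.
apply: ler_pM => //; rewrite ?mulr_ge0 ?powR_ge0 //.
by apply: ler_wpM2r => //; exact: powR_ge0.
Qed.

(** Passing from $(p/6)^p$ to $(p/5)^p$ gains $(6/5)^p(7/2)^a$, which together with $p^2$ pays for
    the numerical factors. For [q = 0] the gain from [a = p] is used, otherwise [p >= 2]. *)
Lemma growth_numeric p a F (q : nat) : 1 <= p -> a = p - q.*2%:R -> 0 < a ->
  (p / 5) `^ p * (7 / 2) `^ a <= F ->
  4 * pi * (21 / 20) * (p / (2 * expR 1 ^+ 2)) `^ 2^-1 * (p / 6) `^ p <= p ^+ 2 * F.
Proof.
move=> p1 aE a0 G.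
have pi3 := pi_ge3; have pi16 := pi_le; have eg := expR1_ge.
have p0 : 0 <= p / 6 by lra.
have p5 : (p / 5) `^ p = (p / 6) `^ p * (6 / 5) `^ p.
  by rewrite -powRM //; congr (_ `^ _); field.
have P6 : 0 <= (p / 6) `^ p by exact: powR_ge0.
have ee : 12 <= 2 * expR 1 ^+ 2 :> R by nra.
have ee0 : 0 < 2 * expR 1 ^+ 2 :> R by lra.
apply: le_trans (ler_wpM2l (sqr_ge0 _) G); rewrite p5.
rewrite [leRHS](_ : _ = (p ^+ 2 * ((6 / 5) `^ p * (7 / 2) `^ a)) * (p / 6) `^ p); last by ring.
apply: ler_wpM2r => //.
have sq c : 0 < c -> p <= (p ^+ 2 / c) ^+ 2 * (2 * expR 1 ^+ 2) ->
    (p / (2 * expR 1 ^+ 2)) `^ 2^-1 <= p ^+ 2 / c.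
  move=> c0 H.
  have pc : 0 <= p ^+ 2 / c by rewrite divr_ge0 ?sqr_ge0 // ltW.
  have sqp (u : R) : 0 <= u -> u = (u ^+ 2) `^ 2^-1.
    by move=> u0; rewrite -powR_mulrn // -powRrM divff // powRr1.
  rewrite (sqp _ pc).
  have d0 : 0 <= p / (2 * expR 1 ^+ 2) by rewrite divr_ge0; lra.
  apply: ge0_ler_powR; rewrite ?nnegrE ?sqr_ge0 //.
  by rewrite ler_pdivrMr.
have lp (b x y : R) : 1 <= b -> x <= y -> b `^ x <= b `^ y by move=> b1 xy; apply: ler_powR.
have A1 : 1 <= (7 / 2) `^ a :> R by have := lp (7 / 2) 0 a; rewrite powRr0; apply; lra.
have [q0|qn0] := posnP q.
  have ap : a = p by rewrite aE q0 double0 subr0.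
  (* 3.46 is just below $\sqrt{12}$, from $2e^2\ge12$ and $p\le p^4$. *)
  have w := sq (346 / 100) ltac:(lra).
  have {}w : (p / (2 * expR 1 ^+ 2)) `^ 2^-1 <= p ^+ 2 / (346 / 100).
    apply: w; have p3 : p <= p ^+ 4.
      by rewrite -[leLHS]expr1 ler_weXn2l.
    have -> : (p ^+ 2 / (346 / 100)) ^+ 2 = p ^+ 4 / (346 / 100) ^+ 2 by field.
    by nra.
  have P1 : 6 / 5 <= (6 / 5) `^ p :> R by have := lp (6 / 5) 1 p; rewrite powRr1; [apply; lra|lra].
  have P2 : 7 / 2 <= (7 / 2) `^ a :> R by rewrite ap; have := lp (7 / 2) 1 p; rewrite powRr1; [apply; lra|lra].
  have PP : 6 / 5 * (7 / 2) <= (6 / 5) `^ p * (7 / 2) `^ a :> R by apply: ler_pM; lra.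
  apply: (@le_trans _ _ (4 * (16 / 5) * (21 / 20) * (p ^+ 2 / (346 / 100)))).
    by apply: ler_pM; rewrite ?powR_ge0 ?mulr_ge0 //; lra.
  have -> : 4 * (16 / 5) * (21 / 20) * (p ^+ 2 / (346 / 100)) =
     p ^+ 2 * (4 * (16 / 5) * (21 / 20) / (346 / 100)) by ring.
  by apply: ler_wpM2l; rewrite ?sqr_ge0 //; lra.
have p2 : 2 <= p.
  have : 2 <= q.*2%:R :> R by rewrite (ler_nat R 2) -[2%N]/(1.*2) leq_double.
  by lra.
(* 9.79 is just below $\sqrt{96}$: now $8p\le p^4$. *)
have w := sq (979 / 100) ltac:(lra).
have {}w : (p / (2 * expR 1 ^+ 2)) `^ 2^-1 <= p ^+ 2 / (979 / 100).
  apply: w; have p3 : 8 * p <= p ^+ 4.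
    rewrite [p ^+ 4]exprSr; apply: ler_wpM2r; first by lra.
    have -> : (8 : R) = 2 ^+ 3 by ring.
    by apply: ler_powX; lra.
  have -> : (p ^+ 2 / (979 / 100)) ^+ 2 = p ^+ 4 / (979 / 100) ^+ 2 by field.
  by nra.
have P1 : (6 / 5) ^+ 2 <= (6 / 5) `^ p :> R by have := lp (6 / 5) 2 p; rewrite (powR_mulrn 2); [apply; lra|lra].
have PP : (6 / 5) ^+ 2 * 1 <= (6 / 5) `^ p * (7 / 2) `^ a :> R by apply: ler_pM; lra.
apply: (@le_trans _ _ (4 * (16 / 5) * (21 / 20) * (p ^+ 2 / (979 / 100)))).
  by apply: ler_pM; rewrite ?powR_ge0 ?mulr_ge0 //; lra.
have -> : 4 * (16 / 5) * (21 / 20) * (p ^+ 2 / (979 / 100)) =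
   p ^+ 2 * (4 * (16 / 5) * (21 / 20) / (979 / 100)) by ring.
by apply: ler_wpM2l; rewrite ?sqr_ge0 //; lra.
Qed.

End Numerics.

(** * The ratio of difference to mean for all orders up to k *)

Section DifferenceRatio.
Variables (R : realType) (p : R) (k : nat).
Hypotheses (p1 : 1 <= p) (podd : forall z : int, p <> 2 * z%:~R).
Hypotheses (k3 : (2 < k)%N) (pk : p < k%:R).

(** This will be $\rho$. The bound on $\gamma$ contains it divided by [p * k]. *)
Definition gap_const : R := `|sin (pi * p / 2)|
  * ((2 * p) / ((expR 1) ^+ 2 * pi ^+ 2 * k%:R)) `^ ((p + 1) / 2) / (4 * p ^+ 2).

Let g (z : R) := `|z| `^ p.

Lemma small_order_gap j : j%:R <= p ->
  exists h t : R, 0 < signed_mean 1 h j g t /\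
    gap_const * signed_mean 1 h j g t <= `|signed_mean (-1) h j g t|.
Proof.
have p1' := p1; have pk' := pk.
move=> jp; have [A0 AD] := small_order_ratio p1 jp.
exists (p + 1)^-1, 1; split => //.
apply: le_trans (ler_norm _); apply: le_trans AD; apply: ler_wpM2r; first exact: ltW.
have k0 : 0 < k%:R :> R by lra.
have pi3 := pi_ge3 R; have eg := expR1_ge R; have e3 := expR1_le3 R.
set E := expR 1 in eg e3.
(* As [p < k] and $2e<\pi^2$, the base is at most $e^{-3}$; so the constant dictated by large orders
   is also small enough for small ones. *)
have T1 : ((2 * p) / ((expR 1) ^+ 2 * pi ^+ 2 * k%:R)) `^ ((p + 1) / 2) <= expR (- (3 / 2 * p)).
  apply: (@le_trans _ _ (expR (- 3) `^ ((p + 1) / 2))).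
    apply: ge0_ler_powR; rewrite ?nnegrE ?expR_ge0 //; first by lra.
      by rewrite divr_ge0 ?mulr_ge0 ?sqr_ge0 ?expR_ge0 //; lra.
    rewrite expRN -/E.
    have -> : expR 3 = E ^+ 3 :> R by rewrite -expRM_natl mulr1.
    have hE : 0 < E by lra.
    have E2 : 0 < E ^+ 2 by rewrite exprn_gt0.
    have E3 : 0 < E ^+ 3 by rewrite exprn_gt0.
    have P2 : 9 <= pi ^+ 2 :> R by rewrite expr2; nra.
    have den : 0 < E ^+ 2 * pi ^+ 2 * k%:R by rewrite !mulr_gt0 //; lra.
    have a1 : 2 * p * E <= 6 * k%:R by nra.
    have a2 : 9 * k%:R <= pi ^+ 2 * k%:R :> R by apply: ler_wpM2r => //; exact: ltW.
    rewrite ler_pdivrMr // [leRHS]mulrC ler_pdivlMr //.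
    rewrite [leLHS](_ : _ = E ^+ 2 * (2 * p * E)); last by ring.
    rewrite -[leRHS]mulrA; apply: ler_wpM2l; first exact: ltW.
    by lra.
  rewrite -expRM ler_expR; lra.
have s1 : `|sin (pi * p / 2)| <= 1 by rewrite ler_norml sin_geN1 sin_le1.
rewrite /gap_const.
apply: ler_pM; rewrite ?mulr_ge0 ?powR_ge0 ?invr_ge0 //.
- by rewrite mulr_ge0 ?sqr_ge0.
- by rewrite -[leRHS]mul1r; apply: ler_pM; rewrite ?powR_ge0.
- by rewrite lef_pV2 ?posrE ?mulr_gt0 ?exprn_gt0; nra.
Qed.

(** The strict inequality on the left is where [p] not being even is used. *)
Lemma even_floor : exists q : nat, q.*2%:R < p /\ p < q.+1.*2%:R.
Proof.
have p1' := p1; have pk' := pk.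
exists (Num.trunc (p / 2)).
have p2 : 0 <= p / 2 by lra.
have /andP[q1 q2] := truncn_itv p2.
rewrite -!muln2 !natrM; split; last by lra.
rewrite lt_neqAle; apply/andP; split; last by lra.
apply/eqP => E; apply: (podd (z := (Num.trunc (p / 2))%:Z)).
exact: etrans (esym E) (mulrC _ _).
Qed.

Lemma large_order_even_gap l : p < l.*2%:R -> (l.*2 <= k.+1)%N ->
  gap_const * signed_mean 1 1 l.*2 g 0 <= `|signed_mean (-1) 1 l.*2 g 0|.
Proof.
have p1' := p1; have pk' := pk.
move=> pl lk; have [q [q1 q2]] := even_floor.
have ql : (q < l)%N by rewrite -ltn_double -(ltr_nat R); lra.
pose T0 : R := Num.sqrt (q.*2.+1%:R * q.*2.+2%:R).
have T00 : 0 < T0 by rewrite sqrtr_gt0 mulr_gt0.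
have T02 : T0 ^+ 2 = q.*2.+1%:R * q.*2.+2%:R by rewrite sqr_sqrtr // mulr_ge0.
apply: le_trans (signed_mean_powR_large q1 q2 ql T00 T02).
set a := p - q.*2%:R.
have a0 : 0 < a by rewrite /a; lra.
have a2 : a < 2 by rewrite /a; move: q2; rewrite doubleS -addn2 natrD; lra.
have l0 : (0 < l.*2)%N by rewrite double_gt0; exact: leq_ltn_trans ql.
have M := moment_bound p1 l0.
have pi3 := pi_ge3 R; have pi16 := pi_le R; have eg := expR1_ge R; have e3 := expR1_le3 R.
have S : `|sin (pi * p / 2)| <= pi / 2 * (a * (2 - a)).
  have -> : p = q.*2%:R + a by rewrite /a; ring.
  exact: sin_bound.
have N := large_order_numeric p1 pk k3 lk l0.
have G := growth_ge p1 q1 q2 T00 T02.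
rewrite -/a in G.
set X := (_ / _) `^ ((p + 1) / 2) in N.
set Y := (p * _ / _) `^ (p / 2) in N M.
set Z := (pi / 2) `^ (p + 1) in N.
set r := Num.sqrt _ in N *.
set F := _ * T0 `^ a in G *.
have X0 : 0 <= X by exact: powR_ge0.
have Y0 : 0 <= Y by exact: powR_ge0.
have Z0 : 0 < Z by apply: powR_gt0; lra.
have r0 : 0 < r by rewrite sqrtr_gt0 ltr0n.
have -> : (2 / pi) `^ (p + 1) = Z^-1 :> R.
  have -> : 2 / pi = (pi / 2) `^ (-1) :> R.
    by rewrite powR_inv1 ?invf_div //; lra.
  by rewrite /Z -powRN -powRrM mulN1r.
have W := growth_numeric p1 (erefl a) a0 G.
have pp : 0 < 4 * p ^+ 2 by rewrite mulr_gt0 ?exprn_gt0 //; lra.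
have XYZ : 2 * pi * (X * Y * Z * r) <= p ^+ 2 * F.
  apply: le_trans W; set w := _ `^ 2^-1 in N *; set v := _ `^ p in N *.
  have -> : 4 * pi * (21 / 20) * w * v = 2 * pi * (21 / 10 * w * v) by field.
  by apply: ler_wpM2l => //; lra.
apply: (@le_trans _ _ (pi / 2 * (a * (2 - a)) * X / (4 * p ^+ 2) * (2 * Y))).
  apply: ler_pM => //.
  - by rewrite /gap_const !mulr_ge0 // ?powR_ge0 // invr_ge0 ltW.
  - by apply: signed_mean_ge0 => z; exact: powR_ge0.
  - by rewrite /gap_const; apply: ler_wpM2r; [rewrite invr_ge0 ltW|exact: ler_wpM2r].
have aa : 0 <= a * (2 - a) by rewrite mulr_ge0; lra.
rewrite ler_pdivlMr // ler_pdivlMr //.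
rewrite [leLHS](_ : _ = (a * (2 - a)) / 8 * ((2 * pi * (X * Y * Z * r)) / p ^+ 2)); last first.
  by field; lra.
rewrite [leRHS](_ : _ = (a * (2 - a)) / 8 * F); last by ring.
apply: ler_wpM2l; first by rewrite divr_ge0.
by rewrite ler_pdivrMr ?exprn_gt0 // 1?mulrC //; lra.
Qed.

Lemma signed_mean_pos j (x : R) : (0 < j)%N -> 0 < signed_mean 1 1 j g x.
Proof.
have p1' := p1; have pk' := pk.
have gp z : z != 0 -> 0 < g z by move=> z0; apply: powR_gt0; rewrite normr_gt0.
case: j => // j _.
elim: j x => [|j IH] x; last by rewrite signed_meanS mul1r divr_gt0 // addr_gt0.
rewrite /= mul1r divr_gt0 //.
have [E|n1] := eqVneq (x + 1) 0.
  by rewrite ltr_wpDl ?powR_ge0 // gp //; apply/eqP; lra.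
by rewrite ltr_wpDr ?powR_ge0 // gp.
Qed.

(** An odd order above [p] is moved to the next even one: $|z|^p$ is even, so the difference of
    order $j+1$ at 0 averages two equal values, the difference of order $j$ at 1, and likewise for
    the mean. This is why [large_order_even_gap] goes up to order [k.+1]. *)
Lemma difference_ratio j : (j <= k)%N ->
  exists h t : R, 0 < signed_mean 1 h j g t /\
    gap_const * signed_mean 1 h j g t <= `|signed_mean (-1) h j g t|.
Proof.
have p1' := p1; have pk' := pk.
move=> jk; have [jp|pj] := lerP j%:R p; first exact: small_order_gap.
have gN z : g (- z) = g z by rewrite /g normrN.
have j0 : (0 < j)%N by rewrite -(ltr_nat R); lra.
have [oj|ej] := boolP (odd j).
  exists 1, 1; split; first exact: signed_mean_pos.
  have [l lE] : exists l, j.+1 = l.*2.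
    by exists (j.+1)./2; rewrite -[LHS]odd_double_half /= oj.
  have := @large_order_even_gap l; rewrite -lE.
  have pj1 : p < j.+1%:R by apply: lt_trans pj _; rewrite ltr_nat.
  move=> /(_ pj1 jk); rewrite !signed_meanS !add0r.
  rewrite !signed_mean_even ?eqxx ?orbT // expr1n !mul1r.
  rewrite -signr_odd oj expr1 mulN1r mulN1r opprK.
  have half (y : R) : (y + y) / 2 = y by field.
  by rewrite !half.
exists 1, 0; split; first exact: signed_mean_pos.
have jE : j = (j./2).*2 by rewrite -[LHS]odd_double_half (negbTE ej).
by rewrite jE; apply: large_order_even_gap; rewrite -jE // ltnW.
Qed.

Lemma gap_const_gt0 : 0 < gap_const.
Proof.
have p1' := p1; have pk' := pk.
have [q [q1 q2]] := even_floor.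
have k0 : 0 < k%:R :> R by lra.
have pi3 := pi_ge3 R.
have s0 : sin (pi * p / 2) != 0.
  pose a := p - q.*2%:R.
  have -> : p = q.*2%:R + a by rewrite /a; ring.
  rewrite -normr_gt0.
  have -> : `|sin (pi * (q.*2%:R + a) / 2)| = `|sin (pi * a / 2)|.
    elim: (q) => [|q' IH]; first by rewrite add0r.
    rewrite -IH doubleS -addn2 natrD.
    have -> : pi * (q'.*2%:R + 2 + a) / 2 = pi * (q'.*2%:R + a) / 2 + pi :> R by field.
    by rewrite sinDpi normrN.
  rewrite normr_gt0 gt_eqF // sin_gt0_pi //.
  have a0 : 0 < a by rewrite /a; lra.
  have a2 : a < 2 by rewrite /a; move: q2; rewrite doubleS -addn2 natrD; lra.
  by apply/andP; split; nra.
have P : 0 < ((2 * p) / ((expR 1) ^+ 2 * pi ^+ 2 * k%:R)) `^ ((p + 1) / 2).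
  by apply: powR_gt0; rewrite divr_gt0 ?mulr_gt0 ?exprn_gt0 ?expR_gt0 //; lra.
have Q : 0 < 4 * p ^+ 2 by rewrite mulr_gt0 ?exprn_gt0 //; lra.
by rewrite /gap_const; apply: divr_gt0 => //; apply: mulr_gt0 => //; rewrite normr_gt0.
Qed.

Lemma gap_const_le1 : gap_const <= 1.
Proof.
have p1' := p1; have pk' := pk.
have [h [t [A0 AD]]] := small_order_gap (j := 0) ltac:(lra).
have g0 : 0 < g t := A0.
have : gap_const * g t <= `|g t| := AD.
by rewrite (ger0_norm (ltW g0)) -{2}[g t]mul1r (ler_pM2r g0).
Qed.

End DifferenceRatio.

(** * The clause gadget *)

Section GadgetCost.
Variable R : realType.
Implicit Types (p : R) (y : nat -> R).

(* The p-th power of the norm of the vector of the affine forms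
   sum_i al g i y_i + be g, for g < L. *)
Definition gadget_cost p k L (al : nat -> nat -> R) (be : nat -> R) y : R :=
  \sum_(g < L) `|\sum_(i < k) al g i * y i + be g| `^ p.

End GadgetCost.

Section Gadget.
Variable R : realType.
Implicit Types (e h x p : R) (y : nat -> R) (w : seq R).

Fixpoint words (k : nat) : seq (seq R) :=
  if k is k'.+1 then
    [seq 0 :: w | w <- words k'] ++
    ([seq 1 :: w | w <- words k'] ++ [seq -1 :: w | w <- words k'])
  else [:: [::]].

Definition nz w : nat := count (fun a => a != 0) w.

(** On words, this is the product of the nonzero entries if [e = -1], and 1 if [e = 1]; thus
    differences and means are treated together. *)
Fixpoint wt e w : R := if w is a :: w' then (if a == -1 then e else 1) * wt e w' else 1.

Definition dot k w y : R := \sum_(i < k) nth 0 w i * y i.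

Definition usign e (z : R) : R := if z == -1 then e else 1.

(** The elementary symmetric polynomial of degree [j] in the [usign e (y i)]. At a sign vector these
    are the [y i] themselves if [e = -1], and all 1 if [e = 1]. *)
Fixpoint es e k j y : R :=
  if k is k'.+1 then
    es e k' j (fun i => y i.+1) +
    (if j is j'.+1 then usign e (y 0%N) * es e k' j' (fun i => y i.+1) else 0)
  else (j == 0%N)%:R.

Lemma size_words k w : w \in words k -> size w = k.
Proof.
elim: k w => [|k IH] w /=; first by rewrite inE => /eqP ->.
rewrite !mem_cat => /or3P[] /mapP[w' /IH <- ->] //.
Qed.

Lemma nz_words k w : w \in words k -> (nz w <= k)%N.
Proof. by move=> /size_words <-; exact: count_size. Qed.

Lemma dot_cons k a w y : dot k.+1 (a :: w) y = a * y 0%N + dot k w (fun i => y i.+1).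
Proof. by rewrite /dot big_ord_recl. Qed.

(** Fix a support of size [j]. As [y] is a sign vector, the products of the entries of [w] and [y]
    run over all sign vectors when [w] does. The sum over [w] is therefore $2^j$ times a signed
    mean, and [wt] leaves the product of the [usign e (y i)] over the support. *)
Lemma sum_words e h (g : R -> R) j k y x : e * e = 1 ->
  (forall i, (i < k)%N -> y i = 1 \/ y i = -1) ->
  \sum_(w <- words k | nz w == j) wt e w * g (x + h * dot k w y) =
  es e k j y * 2 ^+ j * signed_mean e h j g x.
Proof.
move=> ee; elim: k j y x => [|k IH] j y x yE.
  rewrite /= big_mkcond big_seq1 /= /nz /= /dot big_ord0 mulr0 addr0 eq_sym.
  by case: j => [|j] /=; rewrite ?mul1r ?mul0r.
have yE' i : (i < k)%N -> y i.+1 = 1 \/ y i.+1 = -1 by move=> ik; exact: yE.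
rewrite /= !big_cat /= !big_map /=.
have n10 : (1 : R) != 0 by exact: oner_neq0.
have nN10 : (-1 : R) != 0 by rewrite oppr_eq0.
have E0 : \sum_(w <- words k | nz (0 :: w) == j) wt e (0 :: w) * g (x + h * dot k.+1 (0 :: w) y) =
    es e k j (fun i => y i.+1) * 2 ^+ j * signed_mean e h j g x.
  rewrite -IH //; apply: eq_big => [w|w _]; first by rewrite /nz /= eqxx.
  by rewrite dot_cons mul0r add0r /= eq_sym oppr_eq0 (negbTE n10) mul1r.
rewrite E0 mulrDl mulrDl; congr (_ + _).
case: j {E0} => [|j].
  rewrite !mul0r !big_pred0 ?addr0 // => w; by rewrite /nz /= ?n10 ?nN10.
have E1 : \sum_(w <- words k | nz (1 :: w) == j.+1) wt e (1 :: w) * g (x + h * dot k.+1 (1 :: w) y) =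
    es e k j (fun i => y i.+1) * 2 ^+ j * signed_mean e h j g (x + h * y 0%N).
  rewrite -IH //; apply: eq_big => [w|w _]; first by rewrite /nz /= n10.
  rewrite dot_cons mul1r mulrDr addrA /=.
  have -> : (1 == -1 :> R) = false by apply/eqP; lra.
  by rewrite mul1r.
have E2 : \sum_(w <- words k | nz (-1 :: w) == j.+1) wt e (-1 :: w) * g (x + h * dot k.+1 (-1 :: w) y) =
    e * (es e k j (fun i => y i.+1) * 2 ^+ j * signed_mean e h j g (x - h * y 0%N)).
  rewrite -IH // mulr_sumr; apply: eq_big => [w|w _]; first by rewrite /nz /= nN10.
  by rewrite dot_cons mulN1r mulrDr addrA mulrN /= eqxx mulrA.
rewrite E1 E2 /= exprS /usign.
have [->|->] := yE 0%N (ltn0Sn _).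
  have -> : (1 == -1 :> R) = false by apply/eqP; lra.
  by rewrite !mulr1; field.
rewrite eqxx !mulrN1 opprK; set S1 := signed_mean e h j g (x - h); set S2 := signed_mean e h j g (x + h).
set Z := es _ _ _ _.
have -> : e * Z * (2 * 2 ^+ j) * ((S2 + e * S1) / 2) = Z * 2 ^+ j * (e * S2 + (e * e) * S1) by field.
by rewrite ee; ring.
Qed.

Lemma sum_es e c k y :
  \sum_(j < k.+1) c ^+ j * es e k j y = \prod_(i < k) (1 + c * usign e (y i)).
Proof.
elim: k y => [|k IH] y; first by rewrite big_ord_recl !big_ord0 /= expr0 mulr1 addr0.
have big0 k' j y' : (k' < j)%N -> es e k' j y' = 0.
  elim: k' j y' => [|k' IHk] [|j] y' //= kj; rewrite !IHk ?mulr0 ?addr0 //.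
  exact: ltnW.
rewrite [LHS]big_ord_recl [RHS]big_ord_recl -[\prod_(i < k) _](IH (fun i => y i.+1)) mulrDl mul1r /=.
under eq_bigr do rewrite /bump /= mulrDr.
rewrite big_split /= addrA; congr (_ + _).
  rewrite addr0 [RHS]big_ord_recl [X in _ + X = _]big_ord_recr /=.
  by rewrite (big0 k (1 + k)%N) ?add1n // mulr0 addr0.
rewrite mulr_sumr; apply: eq_bigr => i _; rewrite add1n add0n exprS.
by ring.
Qed.

Variables (p rho : R) (k : nat).
Hypotheses (p1 : 1 <= p) (rho0 : 0 < rho).

(** Words of level [j] get weights $2^{-k-j}(1\pm\varepsilon_j)/A_j$, nonnegative since the
    hypothesis says $|\varepsilon_j|\le1$. By [sum_es] at 1 and at -1, the means add up to
    $2^{-k}\sum_j\binom kj=1$ and the differences to $\rho\,2^{-k}\prod_i(1-y_i)$. *)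
Lemma word_gadget :
  (forall j, (j <= k)%N -> exists h t : R,
     0 < signed_mean 1 h j (fun z => `|z| `^ p) t /\
     rho * signed_mean 1 h j (fun z => `|z| `^ p) t <=
       `|signed_mean (-1) h j (fun z => `|z| `^ p) t|) ->
  exists L al be, forall y, (forall i, (i < k)%N -> y i = 1 \/ y i = -1) ->
    gadget_cost p k L al be y = 1 + rho * [forall i : 'I_k, y i == -1]%:R.
Proof.
move=> H; pose g (z : R) := `|z| `^ p.
have p0 : p != 0 by rewrite gt_eqF //; exact: lt_le_trans p1.
have {H} /choice [ht Hht] : forall j, exists ht : R * R, (j <= k)%N ->
     0 < signed_mean 1 ht.1 j g ht.2 /\
     rho * signed_mean 1 ht.1 j g ht.2 <= `|signed_mean (-1) ht.1 j g ht.2|.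
  move=> j; have [/H [h [t ht]]|] := leqP j k; first by exists (h, t).
  by exists (0, 0).
pose A j := signed_mean 1 (ht j).1 j g (ht j).2.
pose D j := signed_mean (-1) (ht j).1 j g (ht j).2.
pose eps j := rho * (-1) ^+ j * A j / D j.
have A0 j : (j <= k)%N -> 0 < A j by move=> /Hht[].
have D0 j : (j <= k)%N -> D j != 0.
  move=> jk; rewrite -normr_gt0; have [a0 ad] := Hht j jk.
  by apply: lt_le_trans ad; exact: mulr_gt0.
have eps1 j : (j <= k)%N -> `|eps j| <= 1.
  move=> jk; have [a0 ad] := Hht j jk.
  rewrite /eps !normrM normfV normrX normrN normr1 expr1n mulr1.
  by rewrite ler_pdivrMr ?normr_gt0 ?D0 // mul1r (gtr0_norm rho0) (gtr0_norm (A0 j jk)).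
pose wgt w := 2 ^- (k + nz w) * (1 + eps (nz w) * wt (-1) w) / A (nz w).
have wtN w : `|wt (-1) w| = 1.
  by elim: w => [|a w IH] /=; rewrite ?normr1 // normrM IH mulr1; case: ifP; rewrite ?normrN normr1.
have wgt0 w : w \in words k -> 0 <= wgt w.
  move=> /nz_words wk; rewrite /wgt divr_ge0 ?(ltW (A0 _ wk)) // mulr_ge0 ?invr_ge0 ?exprn_ge0 //.
  have : `|eps (nz w) * wt (-1) w| <= 1 by rewrite normrM wtN mulr1 eps1.
  by rewrite ler_norml; lra.
(* A p-th root, because the cost raises each row to the power [p]. *)
pose W w := wgt w `^ p^-1.
pose rows := words k.
exists (size rows), (fun r i => W (nth [::] rows r) * (ht (nz (nth [::] rows r))).1 * nth 0 (nth [::] rows r) i),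
  (fun r => W (nth [::] rows r) * (ht (nz (nth [::] rows r))).2) => y yE.
have -> : gadget_cost p k (size rows) (fun r i => W (nth [::] rows r) *
      (ht (nz (nth [::] rows r))).1 * nth 0 (nth [::] rows r) i)
      (fun r => W (nth [::] rows r) * (ht (nz (nth [::] rows r))).2) y =
    \sum_(w <- rows) wgt w * g ((ht (nz w)).2 + (ht (nz w)).1 * dot k w y).
  rewrite /gadget_cost (big_nth [::]) big_mkord; apply: eq_bigr => r _.
  set w := nth _ _ _.
  have wr : w \in words k by apply: mem_nth.
  have -> : \sum_(i < k) W w * (ht (nz w)).1 * nth 0 w i * y i + W w * (ht (nz w)).2 =
     W w * ((ht (nz w)).2 + (ht (nz w)).1 * dot k w y).
    rewrite /dot mulrDr addrC; congr (_ + _).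
    by rewrite !mulr_sumr; apply: eq_bigr => i _; rewrite !mulrA.
  rewrite normrM powRM // ger0_norm ?powR_ge0 //; congr (_ * _).
  by rewrite -powRrM mulVf // powRr1 // wgt0.
have -> : \sum_(w <- rows) wgt w * g ((ht (nz w)).2 + (ht (nz w)).1 * dot k w y) =
  \sum_(j < k.+1) \sum_(w <- rows | nz w == j) wgt w * g ((ht j).2 + (ht j).1 * dot k w y).
  rewrite [RHS](exchange_big_dep xpredT) //= big_seq [RHS]big_seq.
  apply: eq_bigr => w /nz_words wk.
  have wk' : (nz w < k.+1)%N by [].
  by rewrite (big_pred1 (Ordinal wk')).
have term (j : 'I_k.+1) : \sum_(w <- rows | nz w == j) wgt w * g ((ht j).2 + (ht j).1 * dot k w y) =
   2 ^- k * (1 ^+ j * es 1 k j y) + 2 ^- k * rho * ((-1) ^+ j * es (-1) k j y).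
  have jk : (j <= k)%N by rewrite -ltnS.
  transitivity (2 ^- (k + j) / A j *
     (\sum_(w <- rows | nz w == j) wt 1 w * g ((ht j).2 + (ht j).1 * dot k w y) +
      eps j * \sum_(w <- rows | nz w == j) wt (-1) w * g ((ht j).2 + (ht j).1 * dot k w y))).
    rewrite mulr_sumr -big_split /= mulr_sumr; apply: eq_bigr => w /eqP <-.
    have -> : wt 1 w = 1 by elim: (w) => [|a w' IH] //=; rewrite IH mulr1; case: ifP.
    by rewrite /wgt; ring.
  rewrite !sum_words ?mulrNN ?mulr1 // -/(A j) -/(D j) expr1n mul1r /eps exprD.
  have d0 := D0 j jk; have a0 := A0 j jk.
  have an : A j != 0 by rewrite gt_eqF.
  by field; rewrite d0 an /= ?andbT ?expf_neq0.
under eq_bigr do rewrite term.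
rewrite big_split /= -!mulr_sumr !sum_es.
have -> : \prod_(i < k) (1 + 1 * usign 1 (y i)) = 2 ^+ k.
  rewrite -[RHS]/(2 ^+ k) -[in RHS](card_ord k) -prodr_const; apply: eq_bigr => i _.
  by rewrite /usign if_same mulr1.
have -> : \prod_(i < k) (1 + -1 * usign (-1) (y i)) = 2 ^+ k * [forall i : 'I_k, y i == -1]%:R.
  case: forallP => [al|nal]; rewrite ?mulr1 ?mulr0.
    rewrite -[in RHS](card_ord k) -prodr_const; apply: eq_bigr => i _.
    by rewrite /usign (al i) mulrNN mulr1.
  have /existsP [i yi] : [exists i : 'I_k, y i != -1].
    by rewrite -negb_forall; apply/negP => /forallP.
  by rewrite (bigD1 i) //= /usign (negbTE yi) mulr1 subrr mul0r.
have k0 : 2 ^+ k != 0 :> R by rewrite expf_neq0.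
by rewrite mulVf // mulrA [_ * rho * _]mulrAC mulVf // mul1r.
Qed.

End Gadget.

Section PenaltyGadget.
Variables (R : realType) (p : R) (k L : nat) (al : nat -> nat -> R) (be : nat -> R) (alpha : R).

(* The k extra rows alpha * y_i penalise the values |y_i| >= 3. *)
Definition pen_al (g i : nat) : R :=
  if (g < L)%N then al g i else if (g - L == i)%N then alpha else 0.
Definition pen_be (g : nat) : R := if (g < L)%N then be g else 0.

Lemma penalty_cost (y : nat -> R) :
  gadget_cost p k (L + k) pen_al pen_be y =
  gadget_cost p k L al be y + \sum_(i < k) `|alpha * y i| `^ p.
Proof.
rewrite /gadget_cost big_split_ord /=; congr (_ + _); apply: eq_bigr => g _.
  by rewrite /pen_be ltn_ord; under eq_bigr do rewrite /pen_al ltn_ord.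
rewrite /pen_be ltnNge leq_addr /= addr0; congr (`| _ | `^ _).
under eq_bigr do rewrite /pen_al ltnNge leq_addr /= addKn.
rewrite (bigD1 g) //= eqxx big1 ?addr0 // => i ig.
by rewrite eq_sym (negbTE (_ : val i != g)) ?mul0r.
Qed.

Lemma gadget_cost_ge0 (y : nat -> R) L' al' be' : 0 <= gadget_cost p k L' al' be' y.
Proof. by apply: sumr_ge0 => i _; exact: powR_ge0. Qed.

Lemma penalty_far (y : nat -> R) : 0 < alpha -> 0 <= p ->
  (forall i, (i < k)%N -> 1 <= `|y i|) -> (exists2 i, (i < k)%N & 3 <= `|y i|) ->
  alpha `^ p * (k%:R + 3 `^ p - 1) <= gadget_cost p k (L + k) pen_al pen_be y.
Proof.
move=> a0 p0 y1 [i0 i0k y3]; rewrite penalty_cost.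
rewrite -[leLHS]add0r; apply: lerD; first exact: gadget_cost_ge0.
rewrite (bigD1 (Ordinal i0k)) //=.
have pw u v : 0 <= u -> u <= `|v| -> alpha `^ p * u `^ p <= `|alpha * v| `^ p.
  move=> u0 uv; rewrite normrM (gtr0_norm a0) -powRM //; last exact: ltW.
  have a0' := ltW a0.
  by apply: ge0_ler_powR; rewrite ?nnegrE ?mulr_ge0 //; exact: ler_wpM2l.
have -> : alpha `^ p * (k%:R + 3 `^ p - 1) =
    alpha `^ p * 3 `^ p + \sum_(i < k | i != Ordinal i0k) alpha `^ p * 1 `^ p.
  rewrite powR1 mulr1 sumr_const cardC1 card_ord -mulr_natr.
  have -> : k%:R = k.-1%:R + 1 :> R by rewrite natr1 prednK // (leq_ltn_trans _ i0k).
  by ring.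
apply: lerD; first exact: pw.
by apply: ler_sum => i _; apply: pw => //; exact: y1.
Qed.

End PenaltyGadget.

(** * From formulas to lattices *)

Section Encoding.

Definition codes (k n : nat) (phi : formula k n) : seq nat :=
  flatten [seq map (@enc_literal n) C | C : k.-tuple (literal n) <- phi].

Lemma enc_literal_half n (l : literal n) : (enc_literal l)./2 = l.1.
Proof. by rewrite /enc_literal addnC half_bit_double. Qed.

Lemma enc_literal_odd n (l : literal n) : odd (enc_literal l) = l.2.
Proof. by rewrite /enc_literal oddD odd_double; case: l.2. Qed.

Lemma size_codes k n (phi : formula k n) : size (codes phi) = (size phi * k)%N.
Proof.
by elim: phi => //= C phi IH; rewrite size_cat size_map size_tuple IH mulSn.
Qed.

Lemma nth_codes k n (phi : formula k n) (c : nat) (i : 'I_k) C0 : (c < size phi)%N ->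
  nth 0%N (codes phi) (c * k + i) = enc_literal (tnth (nth C0 phi c) i).
Proof.
rewrite /codes; elim: phi c => //= C phi IH [|c] cs.
  rewrite mul0n add0n nth_cat size_map size_tuple ltn_ord.
  by rewrite /= (nth_map (tnth C i)) ?size_tuple // -tnth_nth.
rewrite nth_cat size_map size_tuple mulSn -addnA ltnNge leq_addr /= addKn.
exact: IH.
Qed.

Lemma mem_codes k n (phi : formula k n) (l : literal n) (C : k.-tuple (literal n)) :
  C \in phi -> l \in C -> enc_literal l \in codes phi.
Proof.
move=> Cp lC; apply/flattenP; exists (map (@enc_literal n) C); first exact: map_f.
exact: map_f.
Qed.

End Encoding.

(** * The matrix and target of a formula *)

Section Instance.
Variables (K : comUnitRingType) (k L : nat) (al : nat -> nat -> K) (be : nat -> K).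
Local Open Scope ring_scope.

Definition sgn (c : nat) : K := if odd c then 1 else -1.

(** A sum over positions, since a variable may occur several times in a clause. The form
    $\pm(2x_v-1)$ is split: $\pm2$ goes to the matrix and the constant to the target. *)
Definition row_entry (code : nat -> nat) (c g j : nat) : K :=
  \sum_(i < k) (if (code (c * k + i)%N)./2 == j
                then 2%:R * sgn (code (c * k + i)%N) * al g i else 0).

Definition row_target (code : nat -> nat) (c g : nat) : K :=
  \sum_(i < k) sgn (code (c * k + i)%N) * al g i - be g.

Variables (n : nat) (phi : formula k n).
Local Notation m := (size phi).
Local Notation code := (nth 0%N (codes phi)).

(** A variable that occurs nowhere has a zero column in the clause rows; [B_entry] gives it a unit
    row. *)
Definition used (j : nat) : bool := has (fun c => c./2 == j) (codes phi).

Definition B_entry (i j : nat) : K :=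
  if (i < L * m)%N then row_entry code (i %/ L) (i %% L) j
  else ((i - L * m == j)%N && ~~ used j)%:R.

Definition t_entry (i : nat) : K :=
  if (i < L * m)%N then row_target code (i %/ L) (i %% L) else 0.

Definition B_mx : 'M[K]_((L * m + n)%N, n) := \matrix_(i, j) B_entry i j.
Definition t_mx : 'cV[K]_((L * m + n)%N) := \col_i t_entry i.

Definition yval (C : k.-tuple (literal n)) (x : 'I_n -> K) (i : nat) : K :=
  if (insub i : option 'I_k) is Some i' then
    (if (tnth C i').2 then 1 else -1) * (2%:R * x (tnth C i').1 - 1)
  else 0.

Lemma yvalE C x (i : 'I_k) :
  yval C x i = (if (tnth C i).2 then 1 else -1) * (2%:R * x (tnth C i).1 - 1).
Proof. by rewrite /yval valK. Qed.

Lemma clause_row_sum c g (x : 'I_n -> K) C0 : (c < m)%N -> (g < L)%N ->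
  \sum_(j < n) B_entry (c * L + g) j * x j =
  \sum_(i < k) 2%:R * (if (tnth (nth C0 phi c) i).2 then 1 else -1) * al g i
     * x (tnth (nth C0 phi c) i).1.
Proof.
move=> cm gL.
have lt : (c * L + g < L * m)%N.
  rewrite [(L * m)%N]mulnC; apply: (@leq_trans (c.+1 * L)); first by rewrite mulSn addnC ltn_add2r.
  by rewrite leq_mul2r cm orbT.
have L0 : (0 < L)%N by exact: leq_ltn_trans gL.
rewrite /B_entry lt divnMDl // divn_small // addn0 modnMDl modn_small //.
under eq_bigr do rewrite /row_entry mulr_suml.
rewrite exchange_big /=; apply: eq_bigr => i _.
rewrite (nth_codes _ C0) // /sgn enc_literal_odd enc_literal_half.
set l := tnth _ _; rewrite (bigD1 l.1) //= eqxx big1 ?addr0 // => j jl.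
by rewrite eq_sym (negbTE (_ : val j != l.1)) ?mul0r.
Qed.

Lemma clause_row c g (x : 'I_n -> K) C0 : (c < m)%N -> (g < L)%N ->
  \sum_(j < n) B_entry (c * L + g) j * x j - t_entry (c * L + g) =
  \sum_(i < k) al g i * yval (nth C0 phi c) x i + be g.
Proof.
move=> cm gL; rewrite (clause_row_sum _ C0) //.
have lt : (c * L + g < L * m)%N.
  rewrite [(L * m)%N]mulnC; apply: (@leq_trans (c.+1 * L)); first by rewrite mulSn addnC ltn_add2r.
  by rewrite leq_mul2r cm orbT.
have L0 : (0 < L)%N by exact: leq_ltn_trans gL.
rewrite /t_entry lt divnMDl // divn_small // addn0 modnMDl modn_small //.
rewrite /row_target opprB addrCA [RHS]addrC; congr (_ + _).
rewrite -sumrB; apply: eq_bigr => i _; rewrite (nth_codes _ C0) // /sgn enc_literal_odd yvalE.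
by ring.
Qed.

Lemma extra_row (i : 'I_n) (x : 'I_n -> K) :
  \sum_(j < n) B_entry (L * m + i) j * x j - t_entry (L * m + i) =
  (~~ used i)%:R * x i.
Proof.
rewrite /t_entry ltnNge leq_addr /= subr0 /B_entry ltnNge leq_addr /=.
rewrite (bigD1 i) //= addKn eqxx /= big1 ?addr0 // => j ji.
by rewrite eq_sym (negbTE (_ : val j != i)) // mul0r.
Qed.

End Instance.

Lemma sum_nat_blocks (V : nmodType) (F : nat -> V) (L m : nat) :
  (\sum_(0 <= i < L * m) F i = \sum_(0 <= c < m) \sum_(0 <= g < L) F (c * L + g)%N)%R.
Proof.
elim: m => [|m IH]; first by rewrite muln0 !big_geq.
rewrite mulnS addnC (big_cat_nat (leq0n _) (leq_addr L (L * m)%N)) /= IH big_nat_recr //=.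
congr (_ + _)%R; rewrite -{1}[(L * m)%N]add0n big_addn addKn.
by apply: eq_bigr => g _; rewrite addnC mulnC.
Qed.

(** * Cost of lattice points, and linear independence *)

Section Correctness.
Variables (R : realType) (p : R) (k L : nat) (al : nat -> nat -> R) (be : nat -> R).
Hypothesis p1 : 1 <= p.
Variables (n : nat) (phi : formula k n).
Local Notation m := (size phi).
Local Notation B := (B_mx L al phi).
Local Notation t := (t_mx L al be phi).

Let p_gt0 : 0 < p. Proof. exact: lt_le_trans p1. Qed.

Definition cost (d : nat) (x : 'cV[R]_d) : R := \sum_(i < d) `|x i 0| `^ p.

Lemma cost_instance (x : 'cV[int]_n) :
  cost (B *m map_mx intr x - t) =
  \sum_(C <- phi) gadget_cost p k L al be (yval C (fun j => (x j 0)%:~R)) +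
  \sum_(j < n) `|(~~ used phi j)%:R * (x j 0)%:~R| `^ p.
Proof.
pose F i := `|\sum_(j < n) B_entry L al phi i j * (x j 0)%:~R - t_entry L al be phi i| `^ p.
have -> : cost (B *m map_mx intr x - t) = \sum_(i < L * m + n) F i.
  apply: eq_bigr => i _; rewrite !mxE /F; congr (`| _ - _ | `^ _).
  by apply: eq_bigr => j _; rewrite !mxE.
rewrite big_split_ord /=; congr (_ + _); last first.
  by apply: eq_bigr => j _; rewrite /F extra_row.
rewrite -(big_mkord xpredT F) sum_nat_blocks.
have C0E : (0 < m)%N -> k.-tuple (literal n) by case: (phi) => // C.
case: (posnP m) => [m0|/C0E C0]; first by rewrite m0 big_geq // (size0nil m0) big_nil.
rewrite (big_nth C0); apply: eq_big_nat => c /andP[_ cm].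
rewrite big_mkord; apply: eq_bigr => g _; congr (`| _ | `^ _).
exact: clause_row.
Qed.

(** Intervals instead of values, so that the rounded gadget is covered; the exact one has [C1 = C2]
    and [C3 = C4]. *)
Variables (C1 C2 C3 C4 : R).
Hypothesis H1 : forall y, (forall i, (i < k)%N -> y i = 1 \/ y i = -1) ->
  (exists2 i, (i < k)%N & y i = 1) -> C1 <= gadget_cost p k L al be y <= C2.
Hypothesis H2 : forall y, (forall i, (i < k)%N -> y i = -1) ->
  C3 <= gadget_cost p k L al be y <= C4.
Hypothesis H3 : forall y, (forall i, (i < k)%N -> 1 <= `|y i|) ->
  (exists2 i, (i < k)%N & 3 <= `|y i|) -> C3 <= gadget_cost p k L al be y.
Hypothesis C13 : C1 <= C3.

Lemma sum_count_const (P : pred (k.-tuple (literal n))) (a b : R) :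
  \sum_(C <- phi) (if P C then a else b) =
  (count P phi)%:R * a + (m - count P phi)%:R * b.
Proof.
have sz : m = (count P phi + count (predC P) phi)%N by rewrite count_predC.
rewrite sz addKn; elim: (phi) => [|C phi' IH]; first by rewrite big_nil !mul0r addr0.
by rewrite big_cons IH /= !natrD; case: (P C) => /=; ring.
Qed.

Lemma cost_assignment (a : {ffun 'I_n -> bool}) : exists x : 'cV[int]_n,
  cost (B *m map_mx intr x - t) <=
  (count (sat_clause a) phi)%:R * C2 + (m - count (sat_clause a) phi)%:R * C4.
Proof.
exists (\col_j (if used phi j then (a j)%:Z else 0)).
rewrite cost_instance [X in _ + X]big1 ?addr0; last first.
  move=> j _; rewrite mxE; case: (used phi j); rewrite ?mul0r ?mulr0 normr0 powR0 //;
  by rewrite gt_eqF.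
rewrite -sum_count_const big_seq [leRHS]big_seq; apply: ler_sum => C Cphi.
have yE (i : 'I_k) : yval C (fun j => (((\col_j (if used phi j then (a j)%:Z else 0)) : 'cV[int]_n) j 0)%:~R : R) i
    = if a (tnth C i).1 == (tnth C i).2 then 1 else -1.
  have uE : used phi (tnth C i).1.
    apply/hasP; exists (enc_literal (tnth C i)); last by rewrite enc_literal_half.
    exact: mem_codes Cphi (mem_tnth _ _).
  rewrite yvalE mxE uE; by case: (a _); case: (_.2); rewrite /= ?mulr1 ?mulr0; ring.
set y := yval _ _ in yE *.
case: ifPn => [/hasP [l lC /eqP al']|/hasPn nal].
  have y1' i : (i < k)%N -> y i = 1 \/ y i = -1.
    by move=> ik; rewrite -[i]/(val (Ordinal ik)) yE; case: ifP; [left|right].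
  have y2 : exists2 i, (i < k)%N & y i = 1.
    by have /tnthP [i lE] := lC; exists (i : nat) => //; rewrite yE -lE al' eqxx.
  by have /andP[] := H1 y1' y2.
have y3 i : (i < k)%N -> y i = -1.
  move=> ik; rewrite -[i]/(val (Ordinal ik)) yE ifN //.
  by apply: nal; exact: mem_tnth.
by have /andP[] := H2 y3.
Qed.

(** Each $2x-1$ is odd. If one of them reaches absolute value 3 in a clause, that clause costs at
    least [C3], enough whatever the rounded assignment does to it. Otherwise all its variables are 0
    or 1 and rounding changes nothing. *)
Lemma cost_lattice (x : 'cV[int]_n) : exists a : {ffun 'I_n -> bool},
  (count (sat_clause a) phi)%:R * C1 + (m - count (sat_clause a) phi)%:R * C3
  <= cost (B *m map_mx intr x - t).
Proof.
pose a := [ffun j => 0 < x j 0 :> int]; exists a.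
rewrite -sum_count_const cost_instance -[leLHS]addr0; apply: lerD; last first.
  by apply: sumr_ge0 => j _; exact: powR_ge0.
apply: ler_sum => C _; set y := yval _ _.
have yN (i : 'I_k) : `|y i| = `|2 * x (tnth C i).1 0 - 1|%:~R.
  rewrite /y yvalE normrM intr_norm rmorphB rmorphM /=.
  by case: (_.2); rewrite ?normrN normr1 mul1r.
have y1 i : (i < k)%N -> 1 <= `|y i|.
  move=> ik; rewrite -[i]/(val (Ordinal ik)) yN ler1z; lia.
have [/existsP [i i3]|/existsPn all1] := boolP [exists i : 'I_k, (3 <= `|2 * x (tnth C i).1 0 - 1| :> int)].
  have : C3 <= gadget_cost p k L al be y.
    apply: H3 => //; exists (i : nat) => //; rewrite yN.
    by rewrite (_ : 3 = (3%:Z)%:~R) // ler_int.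
  by case: ifP => // _; exact: le_trans.
have yE (i : 'I_k) : y i = if a (tnth C i).1 == (tnth C i).2 then 1 else -1.
  have xi : x (tnth C i).1 0 = 0 \/ x (tnth C i).1 0 = 1 by have := all1 i; lia.
  rewrite /y yvalE ffunE; case: xi => ->; case: (_.2); rewrite /= ?mulr1 ?mulr0; ring.
case: ifPn => [/hasP [l lC /eqP al']|/hasPn nal].
  have y1' i : (i < k)%N -> y i = 1 \/ y i = -1.
    by move=> ik; rewrite -[i]/(val (Ordinal ik)) yE; case: ifP; [left|right].
  have y2 : exists2 i, (i < k)%N & y i = 1.
    by have /tnthP [i lE] := lC; exists (i : nat) => //; rewrite yE -lE al' eqxx.
  by have /andP[] := H1 y1' y2.
have y3 i : (i < k)%N -> y i = -1.
  move=> ik; rewrite -[i]/(val (Ordinal ik)) yE ifN //.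
  by apply: nal; exact: mem_tnth.
by have /andP[] := H2 y3.
Qed.

Lemma lpnormE d (x : 'cV[R]_d) : lpnorm p x = cost x `^ p^-1.
Proof. by []. Qed.

Lemma cost_ge0 d (x : 'cV[R]_d) : 0 <= cost x.
Proof. by apply: sumr_ge0 => i _; exact: powR_ge0. Qed.

Lemma dist_le d (M : 'M[R]_(d, n)) (u : 'cV[R]_d) (x : 'cV[int]_n) c :
  cost (M *m map_mx intr x - u) <= c -> dist p (lattice M) u <= c `^ p^-1.
Proof.
move=> xc; have c0 : 0 <= c by exact: le_trans (cost_ge0 _) xc.
apply: (@le_trans _ _ (lpnorm p (M *m map_mx intr x - u))).
  apply: ge_inf; first by exists 0 => _ [z _ <-]; exact: powR_ge0.
  by exists (M *m map_mx intr x) => //; exists x.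
rewrite lpnormE; apply: ge0_ler_powR; rewrite ?nnegrE ?cost_ge0 //.
by rewrite invr_ge0 ltW.
Qed.

Lemma dist_ge d (M : 'M[R]_(d, n)) (u : 'cV[R]_d) c : 0 <= c ->
  (forall x : 'cV[int]_n, c <= cost (M *m map_mx intr x - u)) ->
  c `^ p^-1 <= dist p (lattice M) u.
Proof.
move=> c0 H; apply: lb_le_inf.
  exists (lpnorm p (M *m map_mx intr 0 - u)), (M *m map_mx intr 0) => //.
  by exists 0.
move=> _ [_ [x _ <-] <-]; rewrite lpnormE.
apply: ge0_ler_powR; rewrite ?nnegrE ?cost_ge0 //.
by rewrite invr_ge0 ltW.
Qed.

(** The penalty row of a position where the variable $v$ occurs isolates $\pm2\alpha x_v$; the other
    variables have unit rows. So the penalty rows also provide the linear independence. *)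
Lemma instance_row_free (alpha : R) : alpha != 0 ->
  (forall i, (i < k)%N -> exists2 g, (g < L)%N & forall i', (i' < k)%N ->
     al g i' = if i' == i then alpha else 0) ->
  row_free B^T.
Proof.
move=> a0 Hg; apply: inj_row_free => v vB.
have rowE (i : 'I_(L * m + n)) : \sum_(j < n) B_entry L al phi i j * v 0 j = 0.
  have := congr1 (fun M : 'rV_(L * m + n) => M 0 i) vB; rewrite !mxE => E.
  by rewrite -[RHS]E; apply: eq_bigr => j _; rewrite !mxE mulrC.
apply/rowP => j; rewrite [RHS]mxE.
have [uj|nuj] := boolP (used phi j); last first.
  have := extra_row (K := R) L al be phi j (fun j => v 0 j).
  have := rowE (rshift (L * m) j) => /= ->.
  by rewrite /t_entry ltnNge leq_addr /= subrr nuj mul1r.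
have [c0 c0in /eqP c0j] := hasP uj.
have [ci ciE c0E] : exists2 ci, (ci < size (codes phi))%N & c0 = nth 0%N (codes phi) ci.
  by exists (index c0 (codes phi)); rewrite ?index_mem // nth_index.
have k0 : (0 < k)%N.
  by have := leq_ltn_trans (leq0n _) ciE; rewrite size_codes muln_gt0 => /andP[].
have cm : (ci %/ k < m)%N by rewrite ltn_divLR // -size_codes.
have ik : (ci %% k < k)%N by rewrite ltn_mod.
have C0 : k.-tuple (literal n) by case: (phi) cm => // C.
pose i := Ordinal ik.
have lj : (tnth (nth C0 phi (ci %/ k)) i).1 = j.
  have E := nth_codes i C0 cm; rewrite /= -divn_eq -c0E in E.
  apply: val_inj; exact: etrans (esym (enc_literal_half _)) (etrans (congr1 half (esym E)) c0j).
have [g gL galE] := Hg _ ik.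
have lt : (ci %/ k * L + g < L * m + n)%N.
  apply: (@leq_trans (L * m)); last exact: leq_addr.
  rewrite [(L * m)%N]mulnC; apply: (@leq_trans ((ci %/ k).+1 * L)); first by rewrite mulSn addnC ltn_add2r.
  by rewrite leq_mul2r cm orbT.
have := rowE (Ordinal lt); rewrite /= (clause_row_sum _ _ C0) //.
rewrite (bigD1 i) //= galE // eqxx big1 ?addr0; last first.
  by move=> i' ii'; rewrite galE // (negbTE (_ : val i' != i)) // mulr0 mul0r.
rewrite lj => /eqP; rewrite !mulf_eq0 (negbTE a0) orbF pnatr_eq0 /=.
by case: (_.2); rewrite ?oppr_eq0 oner_eq0 /= => /eqP.
Qed.

End Correctness.

Local Close Scope ring_scope.
Local Close Scope classical_set_scope.

(** * The reduction as a program *)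

Section WrittenArrays.
Variable T : Type.
Implicit Types (f v : nat -> T) (idx : nat -> nat).

Lemma written_id f idx v n i : (forall j, idx j = j) -> i < n ->
  written f idx v n i = v i.
Proof.
move=> idE; elim: n => //= n IH; rewrite ltnS leq_eqVlt idE.
by case: eqP => [->|_ /= /IH].
Qed.

Lemma written_flag (f v : nat -> nat) idx n i : (forall i, f i = 0) -> (forall j, v j = 1) ->
  written f idx v n i = has (fun j => idx j == i) (iota 0 n) :> nat.
Proof.
move=> f0 v1; elim: n => [|n IH]; first exact: f0.
have -> : iota 0 n.+1 = iota 0 n ++ [:: n] by rewrite -addn1 iotaD.
rewrite has_cat /= orbF v1 IH eq_sym.
by case: eqP; rewrite ?orbT ?orbF.
Qed.

End WrittenArrays.

Section ExpressionLibrary.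
Implicit Types (e : nexp) (f : nat -> nat -> nat).

Definition eadd := NB NAdd.
Definition esub := NB NSub.
Definition emul := NB NMul.
Definition ediv := NB NDiv.
(** Truncated subtraction turns comparisons into the values 0 and 1, so case distinctions become
    arithmetic. *)
Definition ele e1 e2 := esub (NC 1) (esub e1 e2).
Definition elt e1 e2 := ele (eadd e1 (NC 1)) e2.
Definition eeq e1 e2 := emul (ele e1 e2) (ele e2 e1).
Definition ehalf e := ediv e (NC 2).
Definition ebit e := esub e (emul (NC 2) (ehalf e)).
Definition emod e1 e2 := esub e1 (emul (ediv e1 e2) e2).

Lemma neval_ele f e1 e2 : neval f (ele e1 e2) = (neval f e1 <= neval f e2).
Proof. by rewrite /=; case: leqP => /= ?; lia. Qed.

Lemma neval_elt f e1 e2 : neval f (elt e1 e2) = (neval f e1 < neval f e2).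
Proof. by rewrite neval_ele /= addn1. Qed.

Lemma neval_eeq f e1 e2 : neval f (eeq e1 e2) = (neval f e1 == neval f e2).
Proof. by rewrite /=; case: eqP => /= ?; nia. Qed.

Lemma neval_ehalf f e : neval f (ehalf e) = (neval f e)./2.
Proof. by rewrite /= divn2. Qed.

Lemma neval_ebit f e : neval f (ebit e) = odd (neval f e).
Proof. by rewrite /= divn2 mul2n; have := odd_double_half (neval f e); lia. Qed.

Lemma neval_emod f e1 e2 : neval f (emod e1 e2) = neval f e1 %% neval f e2.
Proof. by rewrite /= {1}(divn_eq (neval f e1) (neval f e2)) addKn. Qed.

Lemma neval_NC f m : neval f (NC m) = m. Proof. by []. Qed.
Lemma neval_NR f a e : neval f (NR a e) = f a (neval f e). Proof. by []. Qed.
Lemma neval_eadd f e1 e2 : neval f (eadd e1 e2) = neval f e1 + neval f e2.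
Proof. by []. Qed.
Lemma neval_esub f e1 e2 : neval f (esub e1 e2) = neval f e1 - neval f e2.
Proof. by []. Qed.
Lemma neval_emul f e1 e2 : neval f (emul e1 e2) = neval f e1 * neval f e2.
Proof. by []. Qed.
Lemma neval_ediv f e1 e2 : neval f (ediv e1 e2) = neval f e1 %/ neval f e2.
Proof. by []. Qed.

Definition en : nexp := NR 0 (NC 0).
Definition em : nexp := NR 0 (NC 1).

End ExpressionLibrary.

(** * Matrix entries as combinations of computed naturals *)

Section Terms.
Local Arguments neval : simpl never.
Variables (K : comUnitRingType) (k L : nat) (al : nat -> nat -> K) (be : nat -> K).
Local Open Scope ring_scope.
Import GRing.Theory.

(** Gadget coefficients are constants of the program, while the bits selecting them are computed
    from the input. Keeping them apart lets one description serve real and integer coefficients. *)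
Definition tsum (ts : seq (K * nexp)) (f : nat -> nat -> nat) : K :=
  \sum_(t <- ts) t.1 * (neval f t.2)%:R.

Variables (ei ej : nexp).

(** The offset 2 skips the two header cells of [enc_formula]. *)
Definition ecode (i : nat) : nexp :=
  NR 0 (eadd (NC 2) (eadd (emul (ediv ei (NC L)) (NC k)) (NC i))).
Definition esel (g : nat) : nexp :=
  emul (elt ei (emul (NC L) em)) (eeq (emod ei (NC L)) (NC g)).
Definition eused : nexp := NR 2 ej.
Definition eplus (g i : nat) : nexp := emul (esel g) (ebit (ecode i)).
Definition eminus (g i : nat) : nexp := emul (esel g) (esub (NC 1) (ebit (ecode i))).
Definition ehere (i : nat) : nexp := eeq (ehalf (ecode i)) ej.
Definition eextra : nexp :=
  emul (ele (emul (NC L) em) ei)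
    (emul (eeq (esub ei (emul (NC L) em)) ej) (esub (NC 1) eused)).

Definition B_terms : seq (K * nexp) :=
  [seq (2%:R * al gi.1 gi.2, emul (eplus gi.1 gi.2) (ehere gi.2)) |
     gi <- allpairs pair (iota 0 L) (iota 0 k)] ++
  [seq (- (2%:R * al gi.1 gi.2), emul (eminus gi.1 gi.2) (ehere gi.2)) |
     gi <- allpairs pair (iota 0 L) (iota 0 k)] ++ [:: (1, eextra)].

Definition t_terms : seq (K * nexp) :=
  [seq (al gi.1 gi.2, eplus gi.1 gi.2) |
     gi <- allpairs pair (iota 0 L) (iota 0 k)] ++
  [seq (- al gi.1 gi.2, eminus gi.1 gi.2) |
     gi <- allpairs pair (iota 0 L) (iota 0 k)] ++
  [seq (- be g, esel g) | g <- iota 0 L].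

Lemma B_terms_wf : nwf ei -> nwf ej -> all (fun t => nwf t.2) B_terms.
Proof.
move=> wi wj; rewrite /B_terms !all_cat !all_map /= wi wj /= !andbT.
by apply/andP; split; apply/allP => gi _ /=; rewrite !wi !wj.
Qed.

Lemma t_terms_wf : nwf ei -> all (fun t => nwf t.2) t_terms.
Proof.
move=> wi; rewrite /t_terms !all_cat !all_map.
by apply/and3P; split; apply/allP => gi _ /=; rewrite !wi.
Qed.

Lemma B_terms_reads b : (0 < b)%N -> b != 2%N -> ~~ nreads b ei -> ~~ nreads b ej ->
  all (fun t => ~~ nreads b t.2) B_terms.
Proof.
move=> b0 b2 ri rj; have z : (0 == b)%N = false by case: b b0 {b2 ri rj}.
have t2 : (2 == b)%N = false by rewrite eq_sym (negbTE b2).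
rewrite /B_terms !all_cat !all_map /= (negbTE ri) (negbTE rj) z t2 /= !andbT.
by apply/andP; split; apply/allP => gi _ /=; rewrite !(negbTE ri) !(negbTE rj) !z.
Qed.

Lemma t_terms_reads b : (0 < b)%N -> ~~ nreads b ei ->
  all (fun t => ~~ nreads b t.2) t_terms.
Proof.
move=> b0 ri; have z : (0 == b)%N = false by case: b b0 {ri}.
rewrite /t_terms !all_cat !all_map.
by apply/and3P; split; apply/allP => gi _ /=; rewrite !(negbTE ri) !z.
Qed.

Variables (n : nat) (phi : formula k n) (f : nat -> nat -> nat) (i j : nat).
Hypotheses (f_in : forall x, f 0%N x = nth 0%N (enc_formula phi) x)
  (eiE : neval f ei = i) (L0 : (0 < L)%N).
Local Notation m := (size phi).
Local Notation code := (nth 0%N (codes phi)).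

Lemma neval_em : neval f em = m. Proof. exact: f_in. Qed.
Lemma neval_en : neval f en = n. Proof. exact: f_in. Qed.

Lemma neval_ecode x : neval f (ecode x) = code (i %/ L * k + x)%N.
Proof. by rewrite neval_NR !neval_eadd neval_emul neval_ediv f_in eiE. Qed.

Lemma neval_esel g : neval f (esel g) = ((i < L * m)%N && (i %% L == g)%N) :> nat.
Proof.
rewrite /esel neval_emul neval_elt neval_eeq neval_emod eiE neval_emul neval_em mulnb.
by rewrite !neval_NC.
Qed.

Lemma pick_sum (F : nat -> K) :
  \sum_(0 <= g < L) F g * (i %% L == g)%N%:R = F (i %% L)%N.
Proof.
rewrite big_mkord.
have gL : (i %% L < L)%N by rewrite ltn_mod.
rewrite (bigD1 (Ordinal gL)) //= eqxx mulr1 big1 ?addr0 // => g gi.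
by rewrite eq_sym (negbTE (_ : val g != (i %% L)%N)) ?mulr0.
Qed.

Lemma sum_pairs (F : nat -> nat -> K) :
  \sum_(gi <- allpairs pair (iota 0 L) (iota 0 k)) F gi.1 gi.2 =
  \sum_(0 <= g < L) \sum_(0 <= x < k) F g x.
Proof. by rewrite big_allpairs /index_iota !subn0. Qed.

Lemma t_termsE : tsum t_terms f = t_entry L al be phi i.
Proof.
rewrite /tsum /t_terms !big_cat !big_map /=.
rewrite (sum_pairs (fun g x => al g x * (neval f (eplus g x))%:R)).
rewrite (sum_pairs (fun g x => - al g x * (neval f (eminus g x))%:R)).
have -> : \sum_(g <- iota 0 L) - be g * (neval f (esel g))%:R =
   \sum_(0 <= g < L) - be g * ((i < L * m)%N && (i %% L == g)%N)%:R.
  by rewrite /index_iota subn0; apply: eq_bigr => g _; rewrite neval_esel.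
rewrite addrA -big_split /= -big_split /=.
rewrite (eq_bigr (fun g => (\sum_(x < k) sgn K (code (i %/ L * k + x)%N) * al g x - be g) *
   ((i < L * m)%N && (i %% L == g)%N)%:R)); last first.
  move=> g _; rewrite -big_split /= mulrBl mulNr; congr (_ - _).
  rewrite mulr_suml big_mkord; apply: eq_bigr => x _.
  have ep : neval f (eplus g x) = (((i < L * m) && (i %% L == g)) * odd (code (i %/ L * k + x)))%N.
    by rewrite /eplus neval_emul neval_esel neval_ebit neval_ecode.
  have eq : neval f (eminus g x) = (((i < L * m) && (i %% L == g)) * (1 - odd (code (i %/ L * k + x))))%N.
    by rewrite /eminus neval_emul neval_esub neval_esel neval_ebit neval_ecode neval_NC.
  rewrite ep eq !natrM /sgn; case: (odd _) => /=; rewrite ?subn0 ?subnn; ring.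
rewrite /t_entry; case: ifP => im; first exact: (pick_sum (fun g => \sum_(x < k) sgn K (code (i %/ L * k + x)%N) * al g x - be g)).
by rewrite big1 // => g _; exact: mulr0.
Qed.

Hypotheses (f_used : forall x, f 2%N x = used phi x) (ejE : neval f ej = j).

Lemma B_termsE : tsum B_terms f = B_entry L al phi i j.
Proof.
rewrite /tsum /B_terms !big_cat !big_map big_seq1 /= mul1r.
rewrite (sum_pairs (fun g x => 2%:R * al g x * (neval f (emul (eplus g x) (ehere x)))%:R)).
rewrite (sum_pairs (fun g x => - (2%:R * al g x) * (neval f (emul (eminus g x) (ehere x)))%:R)).
have -> : neval f eextra = [&& (L * m <= i)%N, (i - L * m == j)%N & ~~ used phi j] :> nat.
  rewrite /eextra neval_emul neval_ele (neval_emul f (eeq _ _)) neval_eeq !neval_esub.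
  rewrite neval_emul neval_em eiE ejE neval_NR ejE f_used !neval_NC.
  by case: (used _ _); rewrite ?subnn ?subn0 ?muln0 ?muln1 ?mulnb ?andbF ?andbT.
rewrite addrA -big_split /=.
rewrite (eq_bigr (fun g => row_entry (K := K) k al code (i %/ L) g j *
   ((i < L * m)%N && (i %% L == g)%N)%:R)); last first.
  move=> g _; rewrite -big_split /= /row_entry mulr_suml big_mkord; apply: eq_bigr => x _.
  have hh : neval f (ehere x) = ((code (i %/ L * k + x)%N)./2 == j).
    by rewrite /ehere neval_eeq neval_ehalf neval_ecode ejE.
  have ep : neval f (emul (eplus g x) (ehere x)) =
     (((i < L * m) && (i %% L == g)) * odd (code (i %/ L * k + x)) * ((code (i %/ L * k + x))./2 == j))%N.
    by rewrite neval_emul hh /eplus neval_emul neval_esel neval_ebit neval_ecode.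
  have eq : neval f (emul (eminus g x) (ehere x)) =
     (((i < L * m) && (i %% L == g)) * (1 - odd (code (i %/ L * k + x))) * ((code (i %/ L * k + x))./2 == j))%N.
    by rewrite neval_emul hh /eminus neval_emul neval_esub neval_esel neval_ebit neval_ecode neval_NC.
  rewrite ep eq !natrM /sgn; case: (_ == j); case: (odd _) => /=; rewrite ?subn0 ?subnn; ring.
rewrite /B_entry; case: ltnP => im; first by rewrite /= addr0; exact: (pick_sum (fun g => row_entry k al code (i %/ L) g j)).
by rewrite big1 ?add0r // => g _; rewrite mulr0.
Qed.

End Terms.

Lemma has_nth (T : Type) (x0 : T) (P : pred T) (s : seq T) :
  has P s = has (fun x => P (nth x0 s x)) (iota 0 (size s)).
Proof. by rewrite -{1}(mkseq_nth x0 s) has_map. Qed.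

Section UsedFlags.
Local Arguments neval : simpl never.
Variable R : realType.
Variables (k : nat).

Definition flag_prog : prog R :=
  fill R 2 4 6 (emul (NC k) em) (ehalf (NR 0 (eadd (NC 2) (NV 4)))) (NC 1).

Lemma flag_exec n (phi : formula k n) s V :
  (forall x, nats s 0 x = nth 0 (enc_formula phi) x) -> (forall x, nats s 2 x = 0) ->
  bounded V s -> 0 < V -> k * size phi <= V ->
  exists N s', [/\ exec flag_prog s N s',
    N <= fcost (emul (NC k) em) V (scost (ehalf (NR 0 (eadd (NC 2) (NV 4)))) (NC 1) V) V,
    reals s' = reals s,
    forall b i, ~~ scratch 0 b -> b != 2 -> b != 4 -> b != 6 -> nats s' b i = nats s b i &
    (forall x, nats s' 2 x = used phi x) /\ bounded V s'].
Proof.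
move=> s0 s2 bs V0 kV.
have eb : neval (nats s) (emul (NC k) em) = k * size phi.
  by rewrite neval_emul neval_NC (neval_em s0).
have [|||||||||||||||||N [s' [x c r u [w b]]]] := @fill_exec R 2 4 6 (emul (NC k) em)
  (ehalf (NR 0 (eadd (NC 2) (NV 4)))) (NC 1) s V (k * size phi) => //.
exists N, s'; split => //.
  by apply: leq_trans c _; exact: fcost_le.
split => // y; rewrite w written_flag //.
have -> : used phi y = has (fun x => (nth 0 (codes phi) x)./2 == y) (iota 0 (size (codes phi))).
  by rewrite /used (has_nth 0).
rewrite size_codes mulnC.
congr (nat_of_bool _); apply: eq_in_has => j _.
rewrite neval_ehalf [neval _ _]/(env s 4 j 0 (2 + env s 4 j 4 0)).
by rewrite /env /update /= s0.
Qed.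

End UsedFlags.

(** * The reduction on the real machine *)

Section RealReduction.
Variable R : realType.
Import GRing.Theory.

Definition rsum (ts : seq (R * nexp)) : rexp R :=
  foldr (fun t acc => RB RAdd (RB RMul (RC t.1) (RN R t.2)) acc) (RC 0%R) ts.

Lemma reval_rsum ts f : reval f (rsum ts) = tsum ts f.
Proof.
rewrite /tsum; elim: ts => [|t ts IH] /=; first by rewrite big_nil.
by rewrite big_cons IH.
Qed.

Lemma rwf_rsum ts : all (fun t => nwf t.2) ts -> rwf (rsum ts).
Proof. by elim: ts => //= t ts IH /andP[-> /IH]. Qed.

Lemma rreads_rsum b ts : all (fun t => ~~ nreads b t.2) ts -> ~~ rreads b (rsum ts).
Proof. by elim: ts => //= t ts IH /andP[/negbTE -> /IH]. Qed.

Lemma enc_formula_le k n (phi : formula k n) x :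
  nth 0 (enc_formula phi) x <= 2 * (n + size phi) + 2.
Proof.
case: x => [|[|x]] /=; [lia|lia|].
have [xs|xs] := ltnP x (size (codes phi)); last by rewrite nth_default.
have /flattenP [w /mapP [C Cphi ->] /mapP [l lC ->]] := mem_nth 0 xs.
rewrite /enc_literal; have := ltn_ord l.1; move: (nat_of_ord _) (l.2) => a b an.
by case: b; rewrite -muln2 /=; lia.
Qed.

Lemma init_bounded k n (phi : formula k n) V : 2 * (n + size phi) + 2 <= V ->
  bounded V (init_state R (enc_formula phi)).
Proof.
move=> VV a i _; rewrite /=; case: ifP => // _.
exact: leq_trans (enc_formula_le phi i) VV.
Qed.

Variables (k L : nat) (al : nat -> nat -> R) (be : nat -> R) (D q : R).
Hypothesis L0 : 0 < L.

Definition ed : nexp := eadd (emul (NC L) em) en.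
Definition erow : nexp := ediv (NV 4) en.
Definition ecol : nexp := emod (NV 4) en.
Definition rB := rsum (B_terms k L al erow ecol).
Definition rt := rsum (t_terms k L al be (NV 4)).
Definition rr : rexp R := RB RPow (RB RMul (RN R em) (RC D)) (RC q).

(** Cell 1 of array 0 holds the number of clauses, which all other steps read through [em]; the
    dimension overwrites it last. *)
Definition reduction : prog R :=
  Seq (flag_prog R k)
  (Seq (rfill 2 4 6 (emul ed en) (NV 4) rB)
  (Seq (rfill 1 4 6 ed (NV 4) rt)
  (Seq (rstore 0 (NC 0) rr) (store R 0 (NC 1) ed)))).

Definition Vbd (A : nat) : nat := (L * A + A) * (A + 1) + k * A + 2 * A + 2.

Lemma is_poly_Vbd : is_poly Vbd.
Proof.
have pi := is_poly_id; have pc := is_polyC.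
rewrite /Vbd; apply: is_polyD => //; apply: is_polyD; last by apply: is_polyM.
apply: is_polyD; last by apply: is_polyM.
by apply: is_polyM; apply: is_polyD => //; apply: is_polyM.
Qed.

Definition total_cost V : nat :=
  fcost (emul (NC k) em) V (scost (ehalf (NR 0 (eadd (NC 2) (NV 4)))) (NC 1) V) V
  + fcost (emul ed en) V (rscost (NV 4) rB V) V
  + fcost ed V (rscost (NV 4) rt V) V
  + rscost (NC 0) rr V + scost (NC 1) ed V.

Lemma reduction_exec n (phi : formula k n) : exists N st,
  [/\ exec reduction (init_state R (enc_formula phi)) N st,
      N <= total_cost (Vbd (n + size phi)) &
      outputs_cvp st (B_mx L al phi) (t_mx L al be phi) (((size phi)%:R * D) `^ q)%R].
Proof.
set m := size phi; set V := Vbd _; set s0 := init_state _ _.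
have b0 : bounded V s0 by apply: init_bounded; rewrite /V /Vbd; nia.
have [|||||N1 [s1 [x1 c1 r1 u1 [w1 b1]]]] := @flag_exec R k n phi s0 V => //.
  by rewrite /V /Vbd; nia.
  by rewrite -/m /V /Vbd; nia.
have in1 x : nats s1 0 x = nth 0 (enc_formula phi) x by rewrite u1.
have edE (f : nat -> nat -> nat) : (forall x, f 0 x = nth 0 (enc_formula phi) x) ->
    neval f ed = L * m + n.
  by move=> fE; rewrite neval_eadd neval_emul neval_NC (neval_em fE) (neval_en fE).
have eb2 : neval (nats s1) (emul ed en) = (L * m + n) * n.
  by rewrite neval_emul edE // (neval_en in1).
have wB : rwf rB by apply/rwf_rsum/B_terms_wf.
have wt : rwf rt by apply/rwf_rsum/t_terms_wf.
have rB6 : ~~ rreads 6 rB by apply/rreads_rsum/B_terms_reads.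
have rt6 : ~~ rreads 6 rt by apply/rreads_rsum/t_terms_reads.
have [||||||||||||N2 [s2 [x2 c2 u2 r2 [w2 b2]]]] :=
  @rfill_exec R 2 4 6 (emul ed en) (NV 4) rB s1 V ((L * m + n) * n) => //.
  by rewrite /V /Vbd -/m; nia.
have in2 x : nats s2 0 x = nth 0 (enc_formula phi) x by rewrite u2.
have [||||||||||||N3 [s3 [x3 c3 u3 r3 [w3 b3]]]] :=
  @rfill_exec R 1 4 6 ed (NV 4) rt s2 V (L * m + n) => //.
  exact: edE.
  by rewrite /V /Vbd -/m; nia.
have in3 x : nats s3 0 x = nth 0 (enc_formula phi) x by rewrite u3.
have [||||N4 [s4 [x4 u4 r4 c4]]] := @rstore_exec R 0 (NC 0) rr s3 V => //.
have in4 x : nats s4 0 x = nth 0 (enc_formula phi) x by rewrite u4.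
have b4 : bounded V s4 by move=> a i oa; rewrite u4 ?b3 // own_scratch.
have [|||N5 [s5 [x5 r5 u5 c5]]] := @store_exec R 0 (NC 1) ed s4 V => //.
exists (N1 + (N2 + (N3 + (N4 + N5)))), s5; split.
- by apply: exec_seq x1 _; apply: exec_seq x2 _; apply: exec_seq x3 _; apply: exec_seq x4 x5.
- rewrite /total_cost.
  have f2 := fcost_le (emul ed en) (rscost (NV 4) rB V) V (_ : (L * m + n) * n <= V).
  have f3 := fcost_le ed (rscost (NV 4) rt V) V (_ : L * m + n <= V).
  have v2 : (L * m + n) * n <= V by rewrite /V /Vbd -/m; nia.
  have v3 : L * m + n <= V by rewrite /V /Vbd -/m; nia.
  move: (f2 v2) (f3 v3) c1 c2 c3 c4 c5; lia.
have ctr (s : state R) j : neval (env s 4 j) (NV 4) = j by rewrite /= /env /update eqxx.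
split.
- by split; rewrite u5 //; [exact: in4|exact: edE].
- rewrite r5 r4 // /update eqxx /= /real_op_fun.
  by rewrite [u in (u%:R * _)%R](_ : _ = m) //; exact: neval_em in3.
- move=> i; rewrite r5 r4 //; transitivity (reals s3 1 i) => //; rewrite w3 written_id // reval_rsum mxE.
  by apply: (@t_termsE R k L al be (NV 4) n phi) => //; move=> x; rewrite /env /update /= in2.
- move=> i j; rewrite r5 r4 //; transitivity (reals s3 2 (i * n + j)) => //; rewrite r3 // w2.
  have ijlt : i * n + j < (L * m + n) * n.
    have : i.+1 * n <= (L * m + n) * n by rewrite leq_mul2r ltn_ord orbT.
    by have := ltn_ord j; rewrite mulSn; move: (i * n) ((L * m + n) * n) => x y; lia.
  rewrite written_id // reval_rsum mxE.
  have n0 : 0 < n by exact: leq_ltn_trans (ltn_ord j).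
  have enE x : neval (env s1 4 x) en = n by rewrite /= /env /update /= in1.
  apply: (@B_termsE R k L al erow ecol n phi).
  + by move=> x; rewrite /env /update /= in1.
  + by rewrite neval_ediv ctr enE divnMDl // divn_small ?addn0.
  + exact: L0.
  + by move=> x; rewrite /env /update /= w1.
  + by rewrite neval_emod ctr enE modnMDl modn_small.
Qed.

Lemma is_poly_total : is_poly (fun A => total_cost (Vbd A) + (L * A + A)).
Proof.
have pi := is_poly_id; have pc := is_polyC.
apply: is_polyD; last by apply: is_polyD => //; apply: is_polyM.
apply: (is_poly_comp (f := total_cost)); last exact: is_poly_Vbd.
rewrite /total_cost.
apply: is_polyD; last exact: is_poly_scost.
apply: is_polyD; last exact: is_poly_rscost.
apply: is_polyD; last by apply: is_poly_fcost; exact: is_poly_rscost.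
apply: is_polyD; last by apply: is_poly_fcost; exact: is_poly_rscost.
by apply: is_poly_fcost; exact: is_poly_scost.
Qed.

End RealReduction.

(** * Calibration of the radius *)

Section RationalWords.
Local Open Scope ring_scope.

Definition trip (z : int) : seq nat := [:: nat_of_bool (z < 0)%R; `|z|%N; 1%N].

Lemma enc_rat_int (z : int) : enc_rat z%:~R = trip z.
Proof. by rewrite /enc_rat numq_int denq_int ltrz0. Qed.

Definition entries d n (B : 'M[int]_(d, n)) (t : 'cV[int]_d) : seq int :=
  [seq t i 0 | i <- enum 'I_d] ++ [seq B i j | i <- enum 'I_d, j <- enum 'I_n].

Lemma enc_cvp_int d n (B : 'M[int]_(d, n)) (t : 'cV[int]_d) (r : nat) :
  enc_cvp (map_mx intr B) (map_mx intr t) r%:R =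
  [:: n; d; 0; r; 1]%N ++ flatten (map trip (entries B t)).
Proof.
rewrite /enc_cvp pmulrn enc_rat_int /trip ltz_nat /= map_cat flatten_cat.
congr [:: _, _, _, _, _ & _ ++ _]; congr flatten.
  by rewrite -map_comp; apply: eq_map => i /=; rewrite mxE enc_rat_int.
rewrite map_allpairs; apply: eq_allpairs => i j.
by rewrite mxE enc_rat_int.
Qed.

Lemma nth_trip zs x : (x < 3 * size zs)%N ->
  nth 0%N (flatten (map trip zs)) x = nth 0%N (trip (nth 0 zs (x %/ 3))) (x %% 3).
Proof.
elim: zs x => [|z zs IH] x /=; first by rewrite muln0.
case: x => [|[|[|x]]] // xs.
have -> : (x.+3 %/ 3 = (x %/ 3).+1)%N by lia.
have -> : (x.+3 %% 3 = x %% 3)%N by lia.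
by rewrite /= IH //; lia.
Qed.

Lemma nth_allpairs_iota (T : Type) (x0 : T) (F : nat -> nat -> T) a d n x : (x < d * n)%N ->
  nth x0 [seq F i j | i <- iota a d, j <- iota 0 n] x = F (a + x %/ n)%N (x %% n)%N.
Proof.
elim: d a x => [|d IH] a x //= xd.
have n0 : (0 < n)%N by move: xd; case: (n) => //; rewrite muln0.
rewrite nth_cat size_map size_iota; case: ltnP => xn.
  by rewrite (nth_map 0%N) ?size_iota // nth_iota // add0n divn_small // addn0 modn_small.
rewrite IH; last by rewrite -(ltn_add2l n) subnKC // -mulSn.
by rewrite -[in RHS](subnK xn) modnDr divnDr ?dvdnn // divnn n0 addn1 addnS addSn.
Qed.

Lemma entriesE d n (B : 'M[int]_(d, n)) (t : 'cV[int]_d) (tE : nat -> int)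
    (bE : nat -> nat -> int) : (forall i, t i 0 = tE i) -> (forall i j, B i j = bE i j) ->
  size (entries B t) = (d + d * n)%N /\
  forall e, (e < d + d * n)%N -> nth 0 (entries B t) e =
    if (e < d)%N then tE e else bE ((e - d) %/ n)%N ((e - d) %% n)%N.
Proof.
move=> Ht HB.
have -> : entries B t = [seq tE i | i <- iota 0 d] ++ [seq bE i j | i <- iota 0 d, j <- iota 0 n].
  rewrite /entries -!val_enum_ord -map_comp allpairs_mapl allpairs_mapr; congr (_ ++ _).
    exact: eq_map.
  exact: eq_allpairs.
split; first by rewrite size_cat size_map size_allpairs !size_iota.
move=> e ed; rewrite nth_cat size_map size_iota; case: ltnP => de.
  by rewrite (nth_map 0%N) ?size_iota // nth_iota.
by rewrite nth_allpairs_iota // -(ltn_add2l d) subnKC.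
Qed.

(** A discrete machine has only naturals: an integer entry is kept as the difference of two of them,
    one for each sign of the coefficients. *)
Definition epos (ts : seq (int * nexp)) : nexp :=
  foldr (fun t acc => eadd (emul (NC (if 0 <= t.1 then `|t.1|%N else 0%N)) t.2) acc) (NC 0) ts.
Definition eneg (ts : seq (int * nexp)) : nexp :=
  foldr (fun t acc => eadd (emul (NC (if 0 <= t.1 then 0%N else `|t.1|%N)) t.2) acc) (NC 0) ts.

Lemma tsum_split ts f : tsum ts f = (neval f (epos ts))%:Z - (neval f (eneg ts))%:Z.
Proof.
elim: ts => [|t ts IH]; first by rewrite /tsum big_nil.
rewrite /tsum big_cons -/(tsum ts f) IH /= !PoszD !PoszM natz.
case: (lerP 0 t.1) => h; [rewrite (gez0_abs h)|rewrite (ltz0_abs h)]; ring.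
Qed.

Lemma nwf_epos ts : all (fun t => nwf t.2) ts -> nwf (epos ts) /\ nwf (eneg ts).
Proof. by elim: ts => //= t ts IH /andP[-> /IH[-> ->]]. Qed.

Lemma nreads_epos b ts : all (fun t => ~~ nreads b t.2) ts ->
  ~~ nreads b (epos ts) /\ ~~ nreads b (eneg ts).
Proof. by elim: ts => //= t ts IH /andP[/negbTE -> /IH[H1 H2]]. Qed.

End RationalWords.

(** * Writing a CVP instance into interleaved memory *)

Section Writer.
Local Arguments neval : simpl never.
Variables (R : realType) (k L : nat) (al : nat -> nat -> int) (be : nat -> int).
Hypothesis L0 : 0 < L.
Local Notation x4 := (NV 4).
Local Notation ed := (ed L).

(** The word has five header cells, namely rank, dimension and the three of the radius, followed by
    three cells per entry. [eent] is the entry to which position [x4] belongs, and [ecomp] the cell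
    within it. *)
Definition eent : nexp := ediv (esub x4 (NC 5)) (NC 3).
Definition ecomp : nexp := emod (esub x4 (NC 5)) (NC 3).
Definition eist : nexp := elt eent ed.
Definition tT := t_terms k L al be eent.
Definition bT := B_terms k L al (ediv (esub eent ed) en) (emod (esub eent ed) en).
Definition eP : nexp := eadd (emul eist (epos tT)) (emul (esub (NC 1) eist) (epos bT)).
Definition eN : nexp := eadd (emul eist (eneg tT)) (emul (esub (NC 1) eist) (eneg bT)).
(** Sign, absolute value and denominator 1; the two truncated differences add up to the absolute
    value. *)
Definition etrip : nexp := eadd (emul (eeq ecomp (NC 0)) (elt eP eN))
  (eadd (emul (eeq ecomp (NC 1)) (eadd (esub eP eN) (esub eN eP))) (eeq ecomp (NC 2))).
Definition ehead : nexp := eadd (emul (eeq x4 (NC 0)) en) (eadd (emul (eeq x4 (NC 1)) ed)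
  (eadd (emul (eeq x4 (NC 3)) (NV 20)) (eeq x4 (NC 4)))).
Definition eword : nexp := eadd (emul (elt x4 (NC 5)) ehead) (emul (ele (NC 5) x4) etrip).
Definition elen : nexp := eadd (NC 5) (emul (NC 3) (eadd ed (emul ed en))).
Definition eslot : nexp := eadd (emul x4 (NV 10)) (NV 8).

Definition writer : prog R := fill R 1 4 6 elen eslot eword.

Lemma eword_wf : nwf eword.
Proof.
have w1 : nwf eent by [].
have [w2 w3] : nwf (epos tT) /\ nwf (eneg tT) by apply/nwf_epos/t_terms_wf.
have [w4 w5] : nwf (epos bT) /\ nwf (eneg bT) by apply/nwf_epos/B_terms_wf.
by rewrite /= w2 w3 w4 w5.
Qed.

Lemma eword_reads b : b \in [:: 1; 6] -> ~~ nreads b eword.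
Proof.
move=> b16.
have [r2 r3] : ~~ nreads b (epos tT) /\ ~~ nreads b (eneg tT).
  by apply/nreads_epos/t_terms_reads; move: b16; rewrite !inE => /orP[]/eqP->.
have [r4 r5] : ~~ nreads b (epos bT) /\ ~~ nreads b (eneg bT).
  by apply/nreads_epos/B_terms_reads; move: b16; rewrite !inE => /orP[]/eqP->.
rewrite /eword /ehead /etrip /eP /eN /eist.
move: (epos tT) (eneg tT) (epos bT) (eneg bT) r2 r3 r4 r5 => A B C D.
move=> /negbTE rA /negbTE rB /negbTE rC /negbTE rD; rewrite /= rA rB rC rD.
by move: b16; rewrite !inE => /orP[]/eqP->.
Qed.

Variables (n : nat) (psi : formula k n).
Local Notation m := (size psi).
Local Notation d := (L * m + n).

Definition wordlen : nat := 5 + 3 * (d + d * n).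

Definition word (r : nat) : seq nat :=
  enc_cvp (map_mx (intr : int -> rat) (B_mx L al psi))
    (map_mx (intr : int -> rat) (t_mx L al be psi)) (r%:R)%R.

Lemma size_word r : size (word r) = wordlen.
Proof.
rewrite /word enc_cvp_int size_cat /wordlen; congr (_ + _)%N.
have [<- _] := @entriesE d n (B_mx L al psi) (t_mx L al be psi) _ _
  (fun i => mxE _ _ i 0%R) (fun i j => mxE _ _ i j).
by elim: (entries _ _) => //= z zs ->; rewrite mulnS.
Qed.

Lemma neval_ed f : (forall x, f 0 x = nth 0 (enc_formula psi) x) -> neval f ed = d.
Proof. by move=> fE; rewrite neval_eadd neval_emul neval_NC (neval_em fE) (neval_en fE). Qed.

Lemma neval_NV f a : neval f (NV a) = f a 0. Proof. by []. Qed.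

Lemma eword_eval f r x : (forall x, f 0 x = nth 0 (enc_formula psi) x) ->
  (forall x, f 2 x = used psi x) -> f 4 0 = x -> f 20 0 = r -> x < wordlen ->
  neval f eword = nth 0 (word r) x.
Proof.
move=> f0 f2 f4 f20 xl; have dE := neval_ed f0; have nE := neval_en f0.
rewrite /word enc_cvp_int.
rewrite /eword neval_eadd 2!neval_emul neval_elt neval_ele neval_NV neval_NC f4.
case: ltnP => x5.
  rewrite mul1n mul0n addn0 /ehead 3!neval_eadd 3!neval_emul 4!neval_eeq !neval_NV !neval_NC.
  rewrite dE nE f4 f20.
  by case: x x5 {xl f4} => [|[|[|[|[|x]]]]] // _; rewrite /= ?mul0n ?mul1n ?add0n ?addn0.
rewrite mul0n add0n mul1n nth_cat /= ltnNge x5 /=.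
have [zsz znth] := @entriesE d n (B_mx L al psi) (t_mx L al be psi) _ _
  (fun i => mxE _ _ i 0%R) (fun i j => mxE _ _ i j).
set u := x - 5; have ul : u < 3 * (d + d * n) by rewrite /u; move: xl; rewrite /wordlen; lia.
rewrite nth_trip ?zsz //.
have eE : neval f eent = u %/ 3 by rewrite /eent neval_ediv neval_esub neval_NV f4 !neval_NC.
have cE : neval f ecomp = u %% 3 by rewrite /ecomp neval_emod neval_esub neval_NV f4 !neval_NC.
set e := u %/ 3 in eE *; have el : e < d + d * n by rewrite /e ltn_divLR // mulnC.
have tE : tsum tT f = t_entry L al be psi e by apply: (@t_termsE _ k L al be eent n psi).
have [P [N [PE NE zE]]] : exists P N : nat, [/\ neval f eP = P, neval f eN = N &
    nth 0%R (entries (B_mx L al psi) (t_mx L al be psi)) e = (P%:Z - N%:Z)%R].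
  have iE : neval f eist = (e < d) by rewrite /eist neval_elt eE dE.
  have -> : neval f eP = (e < d) * neval f (epos tT) + (1 - (e < d)) * neval f (epos bT).
    by rewrite -iE.
  have -> : neval f eN = (e < d) * neval f (eneg tT) + (1 - (e < d)) * neval f (eneg bT).
    by rewrite -iE.
  rewrite znth //; case: ltnP => de.
    exists (neval f (epos tT)), (neval f (eneg tT)).
    by rewrite -tE tsum_split; split => //; rewrite subnn mul0n addn0 mul1n.
  exists (neval f (epos bT)), (neval f (eneg bT)).
  rewrite !mul0n !add0n subn0 !mul1n; split => //.
  rewrite -tsum_split; symmetry; apply: (@B_termsE _ k L al _ _ n psi) => //.
  + by rewrite neval_ediv neval_esub eE dE nE.
  + by rewrite neval_emod neval_esub eE dE nE.
have -> : neval f etrip = neval f (eeq ecomp (NC 0)) * neval f (elt eP eN) +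
  (neval f (eeq ecomp (NC 1)) * (neval f eP - neval f eN + (neval f eN - neval f eP)) +
   neval f (eeq ecomp (NC 2))) by [].
rewrite zE !neval_eeq neval_elt PE NE cE !neval_NC.
have : u %% 3 < 3 by rewrite ltn_mod.
case: (u %% 3) => [|[|[|]]] //= _; rewrite ?mul0n ?mul1n ?add0n ?addn0 //.
- by congr nat_of_bool; lia.
- by lia.
Qed.

Variables (V J j r : nat) (s : state R).
Hypotheses (s0 : forall x, nats s 0 x = nth 0 (enc_formula psi) x)
  (s2 : forall x, nats s 2 x = used psi x)
  (s8 : nats s 8 0 = j) (s10 : nats s 10 0 = J) (s20 : nats s 20 0 = r) (jJ : j < J)
  (bs : bounded V s) (lV : wordlen <= V)
  (fresh : forall a i, odd a -> i %% J = j -> nats s a i = 0).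

Definition wcost V := fcost elen V (scost eslot eword V) V.

(** Array 1 represents array 0 of the simulated program, so the word goes there with stride [J] and
    offset [j]; [fresh] supplies the zeros of the rest of the initial state. *)
Lemma writer_exec : exists N s', [/\ exec writer s N s', N <= wcost V,
  forall a i, ~~ scratch 0 a -> (odd a -> i %% J != j) -> a != 4 -> a != 6 ->
    nats s' a i = nats s a i,
  bounded V s' & sim J j (init_state R (word r)) s'].
Proof.
have J0 : 0 < J by exact: leq_ltn_trans jJ.
have lenE : neval (nats s) elen = wordlen.
  rewrite /elen neval_eadd neval_emul neval_eadd neval_emul (neval_ed s0) (neval_en s0).
  by rewrite !neval_NC.
have idxE q : neval (env s 4 q) eslot = q * J + j.
  by rewrite /eslot neval_eadd neval_emul !neval_NV /env /update /= s8 s10.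
have [|||||||||||||||||N [s' [x c re u [w b]]]] := @fill_exec R 1 4 6 elen eslot eword s V wordlen => //.
- exact: eword_wf.
- exact: eword_reads.
- exact: eword_reads.
have mJ a : (a * J + j) %% J = j by rewrite modnMDl modn_small.
exists N, s'; split => //.
- by apply: leq_trans c _; exact: fcost_le.
- move=> a i na ia a4 a6; have [a1|a1] := eqVneq a 1; last exact: u.
  rewrite a1 w written_notin // => q _; rewrite idxE.
  by apply/eqP => qi; have := ia; rewrite a1 -qi mJ eqxx => /(_ isT).
split.
- move=> a i; case: a => [|a]; last first.
    have na : ~~ scratch 0 a.+1.*2.+1 by rewrite /scratch oddS odd_double.
    have ne c' : ~~ odd c' -> a.+1.*2.+1 != c'.
      by apply: contraNneq => <-; rewrite oddS odd_double.
    have -> : nats s' a.+1.*2.+1 (i * J + j) = nats s a.+1.*2.+1 (i * J + j).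
      by apply: u => //; exact: ne.
    have -> : nats s a.+1.*2.+1 (i * J + j) = 0 by apply: fresh; rewrite ?mJ // oddS odd_double.
    by [].
  rewrite /= w -idxE; have [il|il] := ltnP i wordlen.
    rewrite (@written_in _ _ (fun q => neval (env s 4 q) eslot)) //; last first.
      by move=> q q' _ _; rewrite !idxE => /addIn /eqP; rewrite eqn_pmul2r // => /eqP.
    by apply: eword_eval.
  rewrite written_notin; last first.
    move=> q ql; rewrite !idxE eqn_add2r eqn_pmul2r //.
    by apply/eqP => qi; rewrite qi ltnNge il in ql.
  by rewrite idxE fresh // nth_default // size_word.
- by rewrite u.
- by rewrite u.
Qed.

Lemma attempt_exec (P : prog R) N0 st : discrete P -> exec P (init_state R (word r)) N0 st ->
  exists N s', [/\ exec (Seq writer (simp P)) s N s', N <= wcost V + 14 * bits J * N0,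
    forall a i, ~~ scratch 0 a -> (odd a -> i %% J != j) -> a != 4 -> a != 6 ->
      nats s' a i = nats s a i,
    bounded V s' &
    nats s' 1 j = nats st 0 0 /\ bits (nats st 0 0) <= bits n + N0].
Proof.
move=> dP xP; have [N1 [s1 [x1 c1 u1 b1 si]]] := writer_exec.
have [N2 [t2 [x2 [h1 h2 h3] fr c2]]] := sim_exec jJ xP dP si.
do 2!eexists; split; first exact: exec_seq x1 x2.
- by rewrite leq_add.
- by move=> a i na ia a4 a6; rewrite fr // u1.
- by move=> a i oa; rewrite fr ?b1 ?own_scratch //; move: oa => /andP[/negbTE ->].
- split; first by rewrite -(h1 0 0).
  exact: (bits_exec xP 0 0).
Qed.

End Writer.

Section Test.
Variable R : realType.

(** Cell [j] of array 1 is the accepting cell of run [j]. Array 30 is never written and serves as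
    the constant 0. *)
Definition test (a : nat) : prog R :=
  IfNLe (Indirect 1 8) (Direct 30) (NConst (Direct a) 0) (NConst (Direct a) 1).

Lemma test_exec a (s : state R) j v : nats s 8 0 = j -> nats s 1 j = v -> nats s 30 0 = 0 ->
  exists N s', [/\ exec (test a) s N s', N <= bits j + bits v + 4 &
    forall b i, nats s' b i = if (b, i) == (a, 0) then nat_of_bool (v != 0) else nats s b i].
Proof.
move=> s8 s1 s30.
have g1 : nget s (Indirect 1 8) = v by rewrite nget_indirect s8.
exists (nread_cost s (Indirect 1 8) + nread_cost s (Direct 30) + 2),
  (nset s (Direct a) (v != 0)); split => //.
- apply: exec_ifn; rewrite g1 nget_direct s30 leqn0.
  have [v0|v0] := eqVneq v 0.
    by have := exec_nconst (Direct a) 0 s; rewrite acost_direct bits0.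
  have := exec_nconst (Direct a) 1 s; rewrite acost_direct.
  by rewrite /bits trunc_log1.
- by rewrite /nread_cost g1 nget_direct s30 acost_direct acost_indirect s8 bits0; lia.
Qed.

End Test.

Section PositiveFormula.
Variables (k n : nat) (phi : formula k n).

(** With the same variables and number of clauses as [phi], it keeps the flags of array 2 valid, and
    its distance is, up to rounding, that of any satisfiable formula of this size. *)
Definition positive : formula k n :=
  [seq [tuple of [seq (l.1, true) | l <- C]] | C : k.-tuple (literal n) <- phi].

Lemma size_positive : size positive = size phi.
Proof. exact: size_map. Qed.

Lemma codes_positive : codes positive = [seq c./2.*2.+1 | c <- codes phi].
Proof.
rewrite /codes /positive map_flatten -!map_comp; congr flatten; apply: eq_map => C /=.
rewrite -!map_comp; apply: eq_map => l /=.
by rewrite enc_literal_half /enc_literal /= addn1.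
Qed.

Lemma used_positive j : used positive j = used phi j.
Proof.
rewrite /used codes_positive has_map; apply: eq_has => c /=.
by rewrite uphalf_double.
Qed.

Lemma sat_positive : (0 < k) -> all (sat_clause [ffun=> true]) positive.
Proof.
move=> k0; apply/allP => _ /mapP[C _ ->]; apply/hasP.
exists ((tnth C (Ordinal k0)).1, true); last by rewrite ffunE.
by apply: map_f; exact: mem_tnth.
Qed.

Lemma enc_positive x : nth 0 (enc_formula positive) x =
  if x < 2 + k * size phi then
    (x < 2) * nth 0 (enc_formula phi) x + (2 <= x) * (2 * (nth 0 (enc_formula phi) x)./2 + 1)
  else 0.
Proof.
case: x => [|[|x]]; rewrite /= ?mul1n ?mul0n ?addn0 ?size_positive //.
rewrite -/(codes positive) -/(codes phi) codes_positive !ltnS.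
have sz : size (codes phi) = k * size phi by rewrite size_codes mulnC.
case: ltnP => xs; last by rewrite nth_default // size_map sz.
by rewrite (nth_map 0) ?sz // add0n mul2n addn1.
Qed.

Lemma enc_default x : 2 + k * size phi <= x -> nth 0 (enc_formula phi) x = 0.
Proof.
case: x => [|[|x]] // xs; apply: nth_default; rewrite /= -/(codes phi) size_codes mulnC.
exact: xs.
Qed.

End PositiveFormula.

Section Update.
Variables (T : Type) (f : nat -> nat -> T).

Lemma update_eq a i v : update f (a, i) v a i = v.
Proof. by rewrite /update eqxx. Qed.

Lemma update_neq a i0 v b i : b != a -> update f (a, i0) v b i = f b i.
Proof. by move=> ba; rewrite /update xpair_eqE (negbTE ba). Qed.

End Update.

(** * The program for Gap-SAT and its run *)

Section SatProgram.
Local Arguments neval : simpl never.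
Variables (R : realType) (k L : nat) (al : nat -> nat -> int) (be : nat -> int).
Variables (P : prog R) (E F K : nat).

Definition ecount (e : nexp) : nexp := eadd (NC 2) (emul (NC k) e).
Definition esaved : nexp := NR 24 (NV 4).
Definition epositive : nexp := eadd (emul (elt (NV 4) (NC 2)) esaved)
  (emul (ele (NC 2) (NV 4)) (eadd (emul (NC 2) (ehalf esaved)) (NC 1))).

Definition attempt : prog R := Seq (writer R k L al be) (simp P).

(* Array 8 holds the candidate radius, array 20 the radius of the instance. *)
Definition body : prog R :=
  Seq (store R 8 (NC 0) (eadd (NV 8) (NC 1)))
  (Seq (store R 20 (NC 0) (emul (NC E) (NV 8))) (Seq attempt (test R 14))).

(** The formula is saved in array 24 before array 0 is turned into the positive one. The modulus
    [K * m + 2] reserves residues 1 to [K * m + 1] for calibration and residue 0 for the last run.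
    Array 16 is the constant 1 against which the loop flag is tested. *)
Definition prepare : prog R :=
  Seq (flag_prog R k)
  (Seq (fill R 24 4 6 (ecount em) (NV 4) (NR 0 (NV 4)))
  (Seq (fill R 0 4 6 (ecount (NR 24 (NC 1))) (NV 4) epositive)
  (Seq (store R 10 (NC 0) (eadd (emul (NC K) em) (NC 2))) (store R 16 (NC 0) (NC 1))))).

(** Array 8 is both the candidate and the index of the run, so the radius is computed from it before
    it is reset to 0 for the last run. *)
Definition finish : prog R :=
  Seq (fill R 0 4 6 (ecount (NR 24 (NC 1))) (NV 4) esaved)
  (Seq (store R 20 (NC 0) (emul (NC F) (NV 8)))
  (Seq (store R 8 (NC 0) (NC 0)) (Seq attempt (test R 0)))).

Definition sat_prog : prog R :=
  Seq prepare (Seq (WhileNLt (Direct 14) (Direct 16) body) finish).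

Lemma discrete_sat_prog : discrete sat_prog.
Proof. by rewrite /= !discrete_comp ?discrete_simp. Qed.

Hypothesis L0 : 0 < L.
Hypotheses (dP : discrete P) (E0 : 0 < E) (F0 : 0 < F).
Variables (n : nat) (phi : formula k n).
Local Notation m := (size phi).
Local Notation J := (K * m + 2).
Local Notation phi' := (positive phi).
Variables (V NP : nat).
Hypotheses (V1 : 2 * (n + m) + 3 <= V) (V2 : 2 + k * m <= V) (V3 : wordlen L phi <= V)
  (V4 : J * (E + F + 1) <= V).
Variables (D D' gamma : R).
Hypotheses (D0 : (0 <= D')%R) (DK : (D' <= (K * m)%:R)%R).
Hypothesis calib : forall q, 0 < q < J -> exists N0 st,
  [/\ exec P (init_state R (word L al be phi' (E * q))) N0 st, N0 <= NP,
      (D' <= (E * q)%:R)%R -> accepting st & (gamma * (E * q)%:R < D')%R -> ~ accepting st].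
Hypothesis final : forall q, 0 < q < J -> exists N0 st,
  [/\ exec P (init_state R (word L al be phi (F * q))) N0 st, N0 <= NP,
      (D <= (F * q)%:R)%R -> accepting st & (gamma * (F * q)%:R < D)%R -> ~ accepting st].

(** The last clause keeps blank the memory of the runs to come, including residue 0, which is set
    aside for the final one. *)
Definition Inv (j : nat) (s : state R) : Prop :=
  [/\ forall x, nats s 0 x = nth 0 (enc_formula phi') x,
      forall x, nats s 2 x = used phi x,
      forall x, nats s 24 x = nth 0 (enc_formula phi) x,
      [/\ nats s 8 0 = j, nats s 10 0 = J, nats s 16 0 = 1, nats s 30 0 = 0 & bounded V s]
    & forall a i, odd a -> i %% J = 0 \/ j < i %% J -> nats s a i = 0].

Definition run_cost : nat := wcost k L al be V + 14 * bits J * NP + (2 * V + NP + 6).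
Definition iter_cost : nat := scost (NC 0) (eadd (NV 8) (NC 1)) V
  + scost (NC 0) (emul (NC E) (NV 8)) V + run_cost.

Lemma odd_notin_vars b : odd b -> b \notin [:: 4; 6; 8; 14; 20].
Proof. by move=> ob; rewrite !inE !negb_or; apply/and5P; split; apply: contraTneq ob => ->. Qed.

Lemma run_exec (psi : formula k n) a s j r N0 st : size psi = m ->
  (forall x, nats s 0 x = nth 0 (enc_formula psi) x) ->
  (forall x, nats s 2 x = used psi x) ->
  nats s 8 0 = j -> nats s 10 0 = J -> nats s 20 0 = r -> nats s 30 0 = 0 -> j < J ->
  bounded V s -> (forall a i, odd a -> i %% J = j -> nats s a i = 0) ->
  exec P (init_state R (word L al be psi r)) N0 st -> N0 <= NP ->
  exists N s', [/\ exec (Seq attempt (test R a)) s N s', N <= run_cost,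
    forall b i, ~~ scratch 0 b -> (odd b -> i %% J != j) -> b != 4 -> b != 6 -> b != a ->
      nats s' b i = nats s b i,
    bounded V s' & nats s' a 0 = (nats st 0 0 != 0)].
Proof.
move=> szpsi s0 s2 s8 s10 s20 s30 jJ bs fr xP NPle.
have lV : wordlen L psi <= V by rewrite /wordlen szpsi.
have [N1 [s1 [x1 c1 u1 b1 [v1 bv]]]] := attempt_exec L0 s0 s2 s8 s10 s20 jJ bs lV fr dP xP.
have t8 : nats s1 8 0 = j by rewrite u1.
have t30 : nats s1 30 0 = 0 by rewrite u1.
have [N2 [s3 [x2 c2 u2]]] := test_exec a t8 v1 t30.
exists (N1 + N2), s3; split.
- exact: exec_seq x1 x2.
- have bj : bits j <= j.+1 := bits_le j; have bn : bits n <= n.+1 := bits_le n.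
  have jV : j < V by apply: leq_trans jJ _; apply: leq_trans V4; rewrite leq_pmulr // addn1.
  rewrite /run_cost.
  have : 14 * bits J * N0 <= 14 * bits J * NP by rewrite leq_mul2l NPle orbT.
  move: (14 * bits J * N0) (14 * bits J * NP) c1 => X Y c1 XY; lia.
- move=> b i nb ib b4 b6 ba; rewrite u2 xpair_eqE (negbTE ba); exact: u1.
- move=> b i ob; rewrite u2; case: ifP => // _; last exact: b1.
  by apply: (@leq_trans 1); [case: (_ != 0)|lia].
- by rewrite u2 eqxx.
Qed.

Lemma odd_scratch d b : odd b -> ~~ scratch d b.
Proof. by rewrite /scratch => ->. Qed.

Lemma body_exec j s : Inv j s -> j.+1 < J -> exists N s', [/\ exec body s N s', N <= iter_cost,
  Inv j.+1 s' & exists v : bool, [/\ nats s' 14 0 = v, (D' <= (E * j.+1)%:R)%R -> v &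
    (gamma * (E * j.+1)%:R < D')%R -> ~~ v]].
Proof.
move=> [i0 i2 i24 [i8 i10 i16 i30 bs] fr] jJ.
have jq : 0 < j.+1 < J by [].
have [N0 [st [xP NPle yes no]]] := calib jq.
have jV : j.+1 <= V by move: V4; nia.
have EV : E * j.+1 <= V by move: V4; nia.
have [N1 [s1 [x1 _ u1 c1]]] := @store_exec R 8 (NC 0) (eadd (NV 8) (NC 1)) s V isT isT bs.
have e1 : neval (nats s) (eadd (NV 8) (NC 1)) = j.+1.
  by rewrite neval_eadd neval_NV neval_NC i8 addn1.
rewrite neval_NC e1 in u1.
have b1 : bounded V s1.
  by move=> b i ob; rewrite u1 ?own_scratch // /update; case: ifP => _ //; exact: bs.
have [N2 [s2 [x2 _ u2 c2]]] := @store_exec R 20 (NC 0) (emul (NC E) (NV 8)) s1 V isT isT b1.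
have e2 : neval (nats s1) (emul (NC E) (NV 8)) = E * j.+1.
  by rewrite neval_emul neval_NV neval_NC u1 // update_eq.
rewrite neval_NC e2 in u2.
have b2 : bounded V s2.
  by move=> b i ob; rewrite u2 ?own_scratch // /update; case: ifP => _ //; exact: b1.
have keep b i : ~~ scratch 0 b -> b != 8 -> b != 20 -> nats s2 b i = nats s b i.
  by move=> nb b8 b20; rewrite u2 // update_neq // u1 // update_neq.
have s28 : nats s2 8 0 = j.+1 by rewrite u2 // update_neq // u1 // update_eq.
have s220 : nats s2 20 0 = E * j.+1 by rewrite u2 // update_eq.
have okeep b i : odd b -> nats s2 b i = nats s b i.
  move=> ob; have := odd_notin_vars ob; rewrite !inE !negb_or => /and5P[_ _ b8 _ b20].
  by apply: keep => //; exact: odd_scratch.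
have [|||||N3 [s3 [x3 c3 u3 b3 v3]]] :=
  @run_exec phi' 14 s2 j.+1 (E * j.+1) N0 st (size_positive phi) _ _ s28 _ s220 _ jJ b2 _ xP NPle.
- by move=> x; rewrite keep.
- by move=> x; rewrite keep // i2 used_positive.
- by rewrite keep.
- by rewrite keep.
- by move=> a i oa ij; rewrite okeep // fr // ij; right.
exists (N1 + (N2 + N3)), s3; split.
- by apply: exec_seq x1 _; apply: exec_seq x2 x3.
- by rewrite /iter_cost; lia.
- split.
  + by move=> x; rewrite u3 // keep.
  + by move=> x; rewrite u3 // keep.
  + by move=> x; rewrite u3 // keep.
  + split=> //; first [by rewrite u3 // keep | by rewrite u3].
  + move=> a i oa H; have := odd_notin_vars oa; rewrite !inE !negb_or => /and5P[a4 a6 _ a14 _].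
    rewrite u3 ?odd_scratch // ?okeep // => [|_].
      by apply: fr => //; case: H => H; [left|right; exact: ltnW].
    by case: H => [->//|H]; rewrite gtn_eqF.
- exists (nats st 0 0 != 0); split => //.
  + by move=> /yes /eqP.
  + by move=> /no; rewrite /accepting => H; apply/negP => /eqP.
Qed.

Lemma bits1 : bits 1 = 1. Proof. by rewrite /bits trunc_log1. Qed.

Lemma flag_read_cost (t : state R) (v : bool) : nats t 14 0 = v -> nats t 16 0 = 1 ->
  nread_cost t (Direct 14) + nread_cost t (Direct 16) = 4.
Proof.
move=> f1 f2; rewrite /nread_cost !nget_direct f1 f2 !acost_direct bits1.
by case: v {f1}; rewrite ?bits0 ?bits1.
Qed.

(** By contraposition of the two promises, rejection of [q.-1] gives the first bound and acceptance
    of [q] the second; in between the answers may be arbitrary. Since $Ej\le D'\le Km$ holds at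
    every rejected $j$, the search ends by $Km+1$. *)
Lemma loop_exec g j s : K * m < j + g -> Inv j s -> nats s 14 0 = 0 ->
  ((E * j)%:R <= D')%R ->
  exists N s' q, [/\ exec (WhileNLt (Direct 14) (Direct 16) body) s N s',
    N <= g * (iter_cost + 4) + 4, Inv q s' /\ 0 < q < J, ((E * q.-1)%:R <= D')%R
    & (D' <= gamma * (E * q)%:R)%R].
Proof.
elim: g j s => [|g IH] j s jg Ij f0 ED.
all: have jK : j <= K * m by rewrite -(ler_nat R); apply: le_trans DK; apply: le_trans ED;
  rewrite ler_nat leq_pmull.
  by move: jg; rewrite addn0 ltnNge jK.
have jJ : j.+1 < J by rewrite addn2 ltnS ltnS.
have [N1 [s1 [x1 c1 I1 [v [f1 yes no]]]]] := body_exec Ij jJ.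
have i16 : nats s 16 0 = 1 by case: Ij => _ _ _ [].
have i16' : nats s1 16 0 = 1 by case: I1 => _ _ _ [].
have lt01 : nget s (Direct 14) < nget s (Direct 16) by rewrite !nget_direct f0 i16.
have rc := @flag_read_cost s false f0 i16; have rc1 := flag_read_cost f1 i16'.
rewrite mulSn; case: (boolP v) => [vT|nv].
  have le10 : nget s1 (Direct 16) <= nget s1 (Direct 14) by rewrite !nget_direct f1 vT i16'.
  have := exec_while_step lt01 x1 (exec_while_stop body le10); rewrite rc rc1 => x2.
  exists (4 + N1 + 4), s1, j.+1; split => //; first by lia.
  by rewrite leNgt; apply/negP => /no; rewrite vT.
have ED1 : ((E * j.+1)%:R <= D')%R.
  by apply: ltW; rewrite ltNge; apply/negP => /yes; rewrite (negbTE nv).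
have [||||N2 [s2 [q [x2 c2 I2 h4 h5]]]] := IH j.+1 s1 => //; first by lia.
  by rewrite f1 (negbTE nv).
have := exec_while_step lt01 x1 x2; rewrite rc => x3.
by exists (4 + N1 + N2), s2, q; split => //; lia.
Qed.

Definition prepare_cost : nat :=
  fcost (emul (NC k) em) V (scost (ehalf (NR 0 (eadd (NC 2) (NV 4)))) (NC 1) V) V
  + fcost (ecount em) V (scost (NV 4) (NR 0 (NV 4)) V) V
  + fcost (ecount (NR 24 (NC 1))) V (scost (NV 4) epositive V) V
  + scost (NC 0) (eadd (emul (NC K) em) (NC 2)) V + scost (NC 0) (NC 1) V.

Lemma ctrE (s : state R) j : neval (env s 4 j) (NV 4) = j.
Proof. exact: update_eq. Qed.

Lemma savedE (s : state R) j : neval (env s 4 j) esaved = nats s 24 j.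
Proof. by rewrite /esaved neval_NR ctrE /env update_neq. Qed.

Lemma enc_le x : nth 0 (enc_formula phi) x < V.
Proof. by have := enc_formula_le phi x; move: V1; lia. Qed.

Lemma prepare_exec : exists N s, [/\ exec prepare (init_state R (enc_formula phi)) N s,
  N <= prepare_cost, Inv 0 s & nats s 14 0 = 0].
Proof.
set s0 := init_state _ _.
have b0 : bounded V s0 by apply: init_bounded; move: V1; lia.
have [|||||N1 [s1 [x1 c1 _ u1 [w1 b1]]]] := @flag_exec R k n phi s0 V => //.
- by apply: leq_trans V1; rewrite addn3.
- by apply: leq_trans V2; rewrite leq_addl.
have in1 x : nats s1 0 x = nth 0 (enc_formula phi) x by rewrite u1.
have eb1 : neval (nats s1) (ecount em) = 2 + k * m.
  by rewrite /ecount neval_eadd neval_emul !neval_NC (neval_em in1).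
have [|||||||||||||||||N2 [s2 [x2 c2 _ u2 [w2 b2]]]] :=
  @fill_exec R 24 4 6 (ecount em) (NV 4) (NR 0 (NV 4)) s1 V (2 + k * m) => //.
  by move=> _ j _; rewrite neval_NR ctrE /env update_neq // in1 ltnW // enc_le.
have in2 x : nats s2 0 x = nth 0 (enc_formula phi) x by rewrite u2.
have sv2 x : nats s2 24 x = nth 0 (enc_formula phi) x.
  rewrite w2; have [xs|xs] := ltnP x (2 + k * m).
    rewrite written_id //.
    by rewrite neval_NR ctrE /env update_neq // in1.
  rewrite written_notin; last by move=> j js; rewrite ctrE; apply/eqP => jx; rewrite jx ltnNge xs in js.
  by rewrite enc_default // u1.
have eb2 : neval (nats s2) (ecount (NR 24 (NC 1))) = 2 + k * m.
  by rewrite /ecount neval_eadd neval_emul !neval_NC neval_NR neval_NC sv2.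
have posE j : j < 2 + k * m -> neval (env s2 4 j) epositive = nth 0 (enc_formula phi') j.
  move=> js; rewrite enc_positive js -sv2 -savedE.
  have -> : neval (env s2 4 j) epositive =
    neval (env s2 4 j) (elt (NV 4) (NC 2)) * neval (env s2 4 j) esaved +
    neval (env s2 4 j) (ele (NC 2) (NV 4)) * (2 * neval (env s2 4 j) (ehalf esaved) + 1) by [].
  by rewrite neval_elt neval_ele neval_ehalf ctrE neval_NC.
have [|||||||||||||||||N3 [s3 [x3 c3 _ u3 [w3 b3]]]] :=
  @fill_exec R 0 4 6 (ecount (NR 24 (NC 1))) (NV 4) epositive s2 V (2 + k * m) => //.
  move=> _ j js; rewrite posE // enc_positive js.
  have := enc_le j; have := odd_double_half (nth 0 (enc_formula phi) j).
  by case: (ltnP j 2) => _; rewrite -muln2; lia.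
have in3 x : nats s3 0 x = nth 0 (enc_formula phi') x.
  rewrite w3; have [xs|xs] := ltnP x (2 + k * m).
    by rewrite written_id // ?posE // => j; exact: ctrE.
  rewrite written_notin; last by move=> j js; rewrite ctrE; apply/eqP => jx; rewrite jx ltnNge xs in js.
  by rewrite in2 enc_default // enc_positive ltnNge xs.
have [N4 [s4 [x4 _ u4 c4]]] :=
  @store_exec R 10 (NC 0) (eadd (emul (NC K) em) (NC 2)) s3 V isT isT b3.
have e4 : neval (nats s3) (eadd (emul (NC K) em) (NC 2)) = J.
  by rewrite neval_eadd neval_emul !neval_NC (neval_em in3) size_positive.
rewrite neval_NC e4 in u4.
have JV : J <= V by apply: leq_trans V4; rewrite leq_pmulr // addn1.
have b4 : bounded V s4.
  by move=> b i ob; rewrite u4 ?own_scratch // /update; case: ifP => _ //; exact: b3.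
have [N5 [s5 [x5 _ u5 c5]]] := @store_exec R 16 (NC 0) (NC 1) s4 V isT isT b4.
rewrite !neval_NC in u5.
have keep b i : ~~ scratch 0 b -> b \notin [:: 0; 2; 4; 6; 10; 16; 24] -> nats s5 b i = 0.
  move=> nb; rewrite !inE !negb_or => /and5P[b0' b2' b4' b6' /and3P[b10 b16 b24]].
  rewrite u5 // update_neq // u4 // update_neq // u3 // u2 // u1 //.
  by rewrite /s0 /= (negbTE b0').
exists (N1 + (N2 + (N3 + (N4 + N5)))), s5; split.
- by apply: exec_seq x1 _; apply: exec_seq x2 _; apply: exec_seq x3 _; apply: exec_seq x4 x5.
- rewrite /prepare_cost.
  have f2 := fcost_le (ecount em) (scost (NV 4) (NR 0 (NV 4)) V) V V2.
  have f3 := fcost_le (ecount (NR 24 (NC 1))) (scost (NV 4) epositive V) V V2.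
  by move: f2 f3 c1 c2 c3 c4 c5; lia.
- split.
  + by move=> x; rewrite u5 // update_neq // u4 // update_neq.
  + by move=> x; rewrite u5 // update_neq // u4 // update_neq // u3 // u2.
  + by move=> x; rewrite u5 // update_neq // u4 // update_neq // u3.
  + split.
    * exact: keep.
    * by rewrite u5 // update_neq // u4 // update_eq.
    * by rewrite u5 // update_eq.
    * exact: keep.
    * move=> b i ob; rewrite u5 ?own_scratch // /update; case: ifP => _; last exact: b4.
      by apply: leq_trans V1; rewrite addn3.
  + move=> a i oa _; apply: keep; first exact: odd_scratch.
    by rewrite !inE !negb_or; do !(apply/andP; split); apply: contraTneq oa => ->.
- exact: keep.
Qed.

Definition finish_cost : nat :=
  fcost (ecount (NR 24 (NC 1))) V (scost (NV 4) esaved V) V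
  + scost (NC 0) (emul (NC F) (NV 8)) V + scost (NC 0) (NC 0) V + run_cost.

Lemma finish_exec q s : Inv q s -> 0 < q < J -> exists N s', [/\ exec finish s N s',
  N <= finish_cost, (D <= (F * q)%:R)%R -> accepting s' &
  (gamma * (F * q)%:R < D)%R -> ~ accepting s'].
Proof.
move=> [i0 i2 i24 [i8 i10 i16 i30 bs] fr] qJ.
have [N0 [st [xP NPle yes no]]] := final qJ.
have eb : neval (nats s) (ecount (NR 24 (NC 1))) = 2 + k * m.
  by rewrite /ecount neval_eadd neval_emul !neval_NC neval_NR neval_NC i24.
have [|||||||||||||||||N1 [s1 [x1 c1 _ u1 [w1 b1]]]] :=
  @fill_exec R 0 4 6 (ecount (NR 24 (NC 1))) (NV 4) esaved s V (2 + k * m) => //.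
  by move=> _ j _; rewrite savedE bs.
have in1 x : nats s1 0 x = nth 0 (enc_formula phi) x.
  rewrite w1; have [xs|xs] := ltnP x (2 + k * m).
    by rewrite written_id // ?savedE // => j; exact: ctrE.
  rewrite written_notin; last by move=> j js; rewrite ctrE; apply/eqP => jx; rewrite jx ltnNge xs in js.
  by rewrite i0 enc_positive ltnNge xs enc_default.
have FV : F * q <= V by move: V4 qJ => ? /andP[]; nia.
have [N2 [s2 [x2 _ u2 c2]]] := @store_exec R 20 (NC 0) (emul (NC F) (NV 8)) s1 V isT isT b1.
have e2 : neval (nats s1) (emul (NC F) (NV 8)) = F * q.
  by rewrite neval_emul neval_NV neval_NC u1 // i8.
rewrite neval_NC e2 in u2.
have b2 : bounded V s2.
  by move=> b i ob; rewrite u2 ?own_scratch // /update; case: ifP => _ //; exact: b1.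
have [N3 [s3 [x3 _ u3 c3]]] := @store_exec R 8 (NC 0) (NC 0) s2 V isT isT b2.
rewrite !neval_NC in u3.
have b3 : bounded V s3.
  by move=> b i ob; rewrite u3 ?own_scratch // /update; case: ifP => _ //; exact: b2.
have keep b i : ~~ scratch 0 b -> b \notin [:: 0; 4; 6; 8; 20] -> nats s3 b i = nats s b i.
  move=> nb; rewrite !inE !negb_or => /and5P[b0' b4' b6' b8' b20].
  by rewrite u3 // update_neq // u2 // update_neq // u1.
have s38 : nats s3 8 0 = 0 by rewrite u3 // update_eq.
have s320 : nats s3 20 0 = F * q by rewrite u3 // update_neq // u2 // update_eq.
have J0 : 0 < J by rewrite addn2.
have [|||||N4 [s4 [x4 c4 u4 b4 v4]]] :=
  @run_exec phi 0 s3 0 (F * q) N0 st erefl _ _ s38 _ s320 _ J0 b3 _ xP NPle.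
- by move=> x; rewrite u3 // update_neq // u2 // update_neq.
- by move=> x; rewrite keep.
- by rewrite keep.
- by rewrite keep.
- move=> a i oa ij; rewrite keep; first by apply: fr => //; left.
    exact: odd_scratch.
  by rewrite !inE !negb_or; do !(apply/andP; split); apply: contraTneq oa => ->.
exists (N1 + (N2 + (N3 + N4))), s4; split.
- by apply: exec_seq x1 _; apply: exec_seq x2 _; apply: exec_seq x3 x4.
- rewrite /finish_cost.
  have f1 := fcost_le (ecount (NR 24 (NC 1))) (scost (NV 4) esaved V) V V2.
  by move: f1 c1 c2 c3 c4; lia.
- by move=> /yes /eqP H; rewrite /accepting v4 H.
- by move=> /no H; rewrite /accepting v4 => H2; apply: H => H3; apply: H2; rewrite H3.
Qed.

Definition sat_cost_bound : nat :=
  prepare_cost + ((K * m).+1 * (iter_cost + 4) + 4) + finish_cost.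

Lemma sat_prog_exec : exists N st q,
  [/\ exec sat_prog (init_state R (enc_formula phi)) N st, N <= sat_cost_bound,
      ((E * q.-1)%:R <= D')%R /\ (D' <= gamma * (E * q)%:R)%R /\ 0 < q,
      (D <= (F * q)%:R)%R -> accepting st & (gamma * (F * q)%:R < D)%R -> ~ accepting st].
Proof.
have [N1 [s1 [x1 c1 I1 f1]]] := prepare_exec.
have [||||N2 [s2 [q [x2 c2 [I2 q0] h1 h2]]]] := @loop_exec (K * m).+1 0 s1 => //.
  by rewrite muln0.
have [N3 [s3 [x3 c3 yes no]]] := finish_exec I2 q0.
exists (N1 + (N2 + N3)), s3, q; split => //.
- by apply: exec_seq x1 _; apply: exec_seq x2 x3.
- by rewrite /sat_cost_bound; lia.
- by split => //; split => //; case/andP: q0.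
Qed.

End SatProgram.

Local Open Scope classical_set_scope.
Local Open Scope ring_scope.

(** * The Karp reduction *)

Section PenalisedGadget.
Variables (R : realType) (p rho : R) (k L0 : nat) (al0 : nat -> nat -> R) (be0 : nat -> R).
Hypotheses (p1 : 1 <= p) (rho0 : 0 < rho).
Hypothesis G : forall y : nat -> R, (forall i, (i < k)%N -> y i = 1 \/ y i = -1) ->
  gadget_cost p k L0 al0 be0 y = 1 + rho * [forall i : 'I_k, y i == -1]%:R.

(* Chosen so that one coordinate of absolute value at least 3 costs as much as
   an unsatisfied clause. *)
Definition pen_weight : R := ((1 + rho) / (3 `^ p - 1)) `^ p^-1.
Definition sat_cost : R := 1 + k%:R * pen_weight `^ p.
Local Notation al := (pen_al L0 al0 pen_weight).
Local Notation be := (pen_be L0 be0).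

Lemma pow3_ge3 : 3 <= 3 `^ p :> R.
Proof. by rewrite -{1}(@powRr1 R 3) // ler_powR // ler1n. Qed.

Lemma pen_weightE : pen_weight `^ p = (1 + rho) / (3 `^ p - 1).
Proof.
have := pow3_ge3 => p3; have p10 := p1; have r00 := rho0.
rewrite /pen_weight -powRrM mulVf ?gt_eqF ?(lt_le_trans ltr01 p1) // powRr1 //.
by rewrite divr_ge0; lra.
Qed.

Lemma pen_weight_gt0 : 0 < pen_weight.
Proof.
have := pow3_ge3 => p3; have r00 := rho0.
by apply: powR_gt0; rewrite divr_gt0; lra.
Qed.

Lemma penalised_pm1 (y : nat -> R) : (forall i, (i < k)%N -> y i = 1 \/ y i = -1) ->
  gadget_cost p k (L0 + k) al be y = sat_cost + rho * [forall i : 'I_k, y i == -1]%:R.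
Proof.
move=> yE; rewrite penalty_cost G // /sat_cost.
have -> : \sum_(i < k) `|pen_weight * y i| `^ p = k%:R * pen_weight `^ p.
  rewrite -[k in RHS]card_ord mulr_natl -sumr_const; apply: eq_bigr => i _.
  rewrite normrM (gtr0_norm pen_weight_gt0).
  by case: (yE i (ltn_ord i)) => ->; rewrite ?normrN normr1 mulr1.
by ring.
Qed.

Lemma penalised_sat (y : nat -> R) : (forall i, (i < k)%N -> y i = 1 \/ y i = -1) ->
  (exists2 i, (i < k)%N & y i = 1) ->
  sat_cost <= gadget_cost p k (L0 + k) al be y <= sat_cost.
Proof.
move=> yE [i ik yi]; rewrite penalised_pm1 //.
have -> : [forall i : 'I_k, y i == -1] = false.
  apply/negbTE; rewrite negb_forall; apply/existsP; exists (Ordinal ik).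
  by rewrite /= yi; apply/eqP; lra.
by rewrite mulr0 addr0 lexx.
Qed.

Lemma penalised_unsat (y : nat -> R) : (forall i, (i < k)%N -> y i = -1) ->
  sat_cost + rho <= gadget_cost p k (L0 + k) al be y <= sat_cost + rho.
Proof.
move=> yE; rewrite penalised_pm1; last by move=> i ik; right; exact: yE.
have -> : [forall i : 'I_k, y i == -1] by apply/forallP => i; rewrite yE.
by rewrite mulr1 lexx.
Qed.

Lemma penalised_far (y : nat -> R) : (forall i, (i < k)%N -> 1 <= `|y i|) ->
  (exists2 i, (i < k)%N & 3 <= `|y i|) ->
  sat_cost + rho <= gadget_cost p k (L0 + k) al be y.
Proof.
move=> y1 y3; apply: le_trans (penalty_far _ _ _ pen_weight_gt0 _ y1 y3); last first.
  by apply: le_trans p1.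
rewrite /sat_cost pen_weightE; have p3 := pow3_ge3.
rewrite le_eqVlt; apply/orP; left; apply/eqP; field; lra.
Qed.

Lemma penalised_rows i : (i < k)%N -> exists2 g, (g < L0 + k)%N &
  forall i', (i' < k)%N -> al g i' = if i' == i then pen_weight else 0.
Proof.
move=> ik; exists (L0 + i)%N; first by rewrite ltn_add2l.
by move=> i' ik'; rewrite /pen_al ltnNge leq_addr /= addKn eq_sym.
Qed.

End PenalisedGadget.

Section ValSat.
Variables (R : realType) (k n : nat) (phi : formula k n).
Local Notation cnt a := (count (sat_clause a) phi).

Lemma max_count_attained : exists a : {ffun 'I_n -> bool},
  (\max_(a : {ffun 'I_n -> bool}) cnt a)%N = cnt a.
Proof.
have [|a ->] := @bigop.eq_bigmax _ (fun a : {ffun 'I_n -> bool} => cnt a); last by exists a.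
by apply/card_gt0P; exists [ffun=> false].
Qed.

Lemma count_le_max (a : {ffun 'I_n -> bool}) :
  (cnt a <= \max_(a : {ffun 'I_n -> bool}) cnt a)%N.
Proof. exact: leq_bigmax. Qed.

Lemma count_val (a : {ffun 'I_n -> bool}) : (0 < size phi)%N ->
  (cnt a)%:R <= val_sat R phi * (size phi)%:R.
Proof.
move=> m0; rewrite /val_sat mulfVK ?pnatr_eq0 ?gt_eqF //.
by rewrite ler_nat count_le_max.
Qed.

Lemma val_attained : (0 < size phi)%N -> exists a : {ffun 'I_n -> bool},
  (cnt a)%:R = val_sat R phi * (size phi)%:R.
Proof.
move=> m0; have [a E] := max_count_attained; exists a.
by rewrite /val_sat E mulfVK // pnatr_eq0 gt_eqF.
Qed.

End ValSat.

(** With $D=C+\rho(1-c)$ and $u=\rho(c-s)/D$, the root is at least $1+\ln(1+u)/p\ge1+\frac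
    u{(1+u)p}$. Here $u\le1/8$, because $c-s<2^{-k}$ and $k\ge3$, and $D\le\frac{14}9k$. The
    quotient $\frac89/\frac{14}9=\frac47$ is the value of $2^{k-1}/(2^k-1)$ at $k=3$, its
    maximum. *)
Lemma gap_arith (R : realType) (p rho c s C : R) (k : nat) :
  1 <= p -> (2 < k)%N -> 0 <= rho <= 1 -> 1 - 2 ^- k < s -> s <= c -> c <= 1 ->
  1 <= C -> C <= 1 + k%:R ->
  1 + 2 ^+ (k - 1) / (2 ^+ k - 1) * (c - s) * (rho / (p * k%:R))
  <= ((C + rho * (1 - s)) / (C + rho * (1 - c))) `^ p^-1.
Proof.
move=> p1 k3 /andP[r0 r1] hs hsc hc C1 Ck.
have k3' : 3 <= k%:R :> R by rewrite ler_nat.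
have K8 : 8 <= 2 ^+ k :> R.
  have -> : 8 = 2 ^+ 3 :> R by ring.
  by apply: ler_weXn2l => //; lra.
have kE : 2 ^+ k = 2 * 2 ^+ (k - 1) :> R by rewrite -exprS subn1 prednK // (ltn_trans _ k3).
have i8 : 2 ^- k <= 8^-1 :> R by rewrite lef_pV2 ?posrE //; lra.
set D := C + rho * (1 - c).
have rc : 0 <= rho * (1 - c) by apply: mulr_ge0; lra.
have D1 : 1 <= D by rewrite /D; lra.
have Dk : D <= 14 / 9 * k%:R.
  have : rho * (1 - c) <= 1 * 8^-1 by apply: ler_pM; lra.
  by rewrite /D; lra.
set u := rho * (c - s) / D.
have -> : (C + rho * (1 - s)) / D = 1 + u by rewrite /u /D; field; rewrite -/D; lra.
have cs0 : 0 <= c - s by lra.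
have u0 : 0 <= u by rewrite /u !mulr_ge0 ?invr_ge0 //; lra.
have u8 : u <= 8^-1.
  rewrite /u ler_pdivrMr; last by lra.
  have : rho * (c - s) <= 1 * 8^-1 by apply: ler_pM; lra.
  by lra.
have p0 : 0 < p by lra.
apply: (@le_trans _ _ (1 + ln (1 + u) / p)); last first.
  apply: le_trans (expR_ge1Dx _) _.
  by rewrite /powR gt_eqF ?ler_expR 1?mulrC //; lra.
rewrite lerD2l ler_pdivlMr //.
have lnu : u / (1 + u) <= ln (1 + u).
  have u1 : 0 < 1 + u by lra.
  have := @le_ln1Dx R ((1 + u)^-1 - 1).
  have i0 : 0 < (1 + u)^-1 by rewrite invr_gt0.
  have -> : 1 + ((1 + u)^-1 - 1) = (1 + u)^-1 by ring.
  rewrite lnV ?posrE // => H.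
  have : - ln (1 + u) <= (1 + u)^-1 - 1 by apply: H; lra.
  have -> : u / (1 + u) = 1 - (1 + u)^-1 by field; lra.
  by lra.
apply: le_trans lnu.
apply: (@le_trans _ _ (8 / 9 * u)); last first.
  rewrite mulrC; apply: ler_wpM2l => //.
  by rewrite -[8 / 9]invrK lef_pV2 ?posrE ?invr_gt0 ?invf_div; lra.
have -> : 2 ^+ (k - 1) / (2 ^+ k - 1) * (c - s) * (rho / (p * k%:R)) * p =
   (rho * (c - s)) * (2 ^+ (k - 1) / (2 ^+ k - 1) / k%:R).
  by field; rewrite ?gt_eqF //; lra.
have -> : 8 / 9 * u = (rho * (c - s)) * (8 / 9 / D) by rewrite /u; ring.
apply: ler_wpM2l; first exact: mulr_ge0.
apply: (@le_trans _ _ (4 / 7 / k%:R)).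
  apply: ler_wpM2r; first by rewrite invr_ge0; lra.
  by rewrite ler_pdivrMr; lra.
rewrite ler_pdivrMr; last by lra.
rewrite mulrAC ler_pdivlMr; lra.
Qed.

Section Part1.
Variables (R : realType) (p : R) (k : nat) (s c : R).
Hypotheses (p1 : 1 <= p) (podd : forall z : int, p <> 2 * z%:~R).
Hypotheses (kmax : Num.max 2 p < k%:R) (hs : 1 - 2 ^- k < s) (hsc : s <= c) (hc : c <= 1).

(** The best cost per clause is at most $C+\rho(1-c)$ for YES and above $C+\rho(1-s)$ for NO;
    [gamma] is the p-th root of the quotient. *)
Lemma karp_reduction_exists : exists gamma : R,
  1 + (2 ^+ (k - 1)) / (2 ^+ k - 1) * (c - s)
      * (`|sin (pi * p / 2)| / (4 * p ^+ 3 * k%:R))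
      * ((2 * p) / ((expR 1) ^+ 2 * pi ^+ 2 * k%:R)) `^ ((p + 1) / 2) <= gamma
  /\ karp_reduction_gapsat_cvp k s c p gamma.
Proof.
have [k2 pk] : 2 < k%:R :> R /\ p < k%:R by move: kmax; rewrite gt_max => /andP[].
have k3 : (2 < k)%N by rewrite -(ltr_nat R).
have p10 := p1; have hs0 := hs; have hsc0 := hsc; have hc0 := hc.
have p0 : 0 < p by lra.
pose rho := gap_const p k.
have rho0 : 0 < rho by exact: gap_const_gt0.
have rho1 : rho <= 1 by exact: gap_const_le1.
have [L0 [al0 [be0 G]]] := word_gadget p1 rho0 (difference_ratio p1 podd k3 pk).
pose w := pen_weight p rho; pose C := sat_cost p rho k.
pose L := (L0 + k)%N; pose al := pen_al L0 al0 w; pose be := pen_be L0 be0.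
pose D := C + rho * (1 - c).
have wp : 0 <= w `^ p by exact: powR_ge0.
(* From $\rho\le1$ and $3^p-1\ge2$. It gives [C <= 1 + k], the source of the factor [k] in the
   bound. *)
have wp1 : w `^ p <= 1.
  have p3 := pow3_ge3 p1.
  by rewrite /w (pen_weightE p1 rho0) ler_pdivrMr; lra.
have C1 : 1 <= C by rewrite /C /sat_cost lerDl mulr_ge0.
have Ck : C <= 1 + k%:R by rewrite /C /sat_cost lerD2l ler_piMr.
have D1 : 1 <= D.
  have : 0 <= rho * (1 - c) by apply: mulr_ge0; lra.
  by rewrite /D; lra.
exists (((C + rho * (1 - s)) / D) `^ p^-1); split.
  have rr : 0 <= rho <= 1 by rewrite ltW.
  apply: le_trans (gap_arith p1 k3 rr hs hsc hc C1 Ck).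
  rewrite le_eqVlt; apply/orP; left; apply/eqP; congr (_ + _).
  rewrite /rho /gap_const; have k00 : k%:R != 0 :> R by rewrite gt_eqF //; lra.
  have p00 : p != 0 by rewrite gt_eqF.
  have q00 : 2 ^+ k - 1 != 0 :> R.
    have : 1 < 2 ^+ k :> R by rewrite exprn_egt1 ?ltr1n //; case: (k) k3.
    by move=> ?; rewrite gt_eqF //; lra.
  set sn := `| _ |; set T := _ `^ _.
  by field; rewrite ?k00 ?p00 ?q00.
have L0' : (0 < L)%N by rewrite /L addn_gt0 (ltn_trans _ k3) ?orbT.
have [a Ha] := is_poly_total k L al be D p^-1.
exists (reduction k L al be D p^-1), a => n phi m0.
have [N [st [x cN out]]] := @reduction_exec R k L al be D p^-1 L0' n phi.
have H1 := penalised_sat p1 rho0 G; have H2 := penalised_unsat p1 rho0 G.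
have H3 := @penalised_far R p rho k L0 al0 be0 p1 rho0.
have C13 : C <= C + rho by lra.
have mR : 0 < (size phi)%:R :> R by rewrite ltr0n.
exists N, st, (L * size phi + n)%N, (B_mx L al phi), (t_mx L al be phi),
  (((size phi)%:R * D) `^ p^-1); split => //.
- apply: leq_trans (Ha _); apply: leq_add => //.
  by rewrite leq_add ?leq_mul ?leq_addl ?leq_addr.
- split => //; split; last by apply: powR_gt0; apply: mulr_gt0 => //; lra.
  apply: (@instance_row_free R k L al be n phi w); last exact: penalised_rows.
  by rewrite gt_eqF // pen_weight_gt0.
- move=> cv; have [b bE] := @val_attained R _ _ phi m0.
  have [z cz] := cost_assignment p1 phi H1 H2 b.
  apply: (dist_le p1 (x := z)); apply: le_trans cz _.
  have cs : c * (size phi)%:R <= (count (sat_clause b) phi)%:R by rewrite bE ler_pM2r.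
  rewrite natrB ?count_size // /D -/C.
  move: (count (sat_clause b) phi)%:R cs => t cs.
  have : rho * (c * (size phi)%:R) <= rho * t by apply: ler_wpM2l => //; exact: ltW.
  by lra.
- move=> vs.
  pose lb := (size phi)%:R * (C + rho * (1 - val_sat R phi)).
  have lbgt : (size phi)%:R * (C + rho * (1 - s)) < lb.
    by rewrite ltr_pM2l // ltrD2l ltr_pM2l //; lra.
  have t0 : 0 <= C + rho * (1 - s).
    have : 0 <= rho * (1 - s) by apply: mulr_ge0; lra.
    by lra.
  have lb0 : 0 <= lb by apply: ltW; apply: le_lt_trans lbgt; apply: mulr_ge0 => //; exact: ltW.
  apply: (@lt_le_trans _ _ (lb `^ p^-1)); last first.
    apply: (dist_ge p1) => // z; have [b bE] := cost_lattice p1 phi H1 H2 H3 C13 z.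
    apply: le_trans bE; have := @count_val R _ _ phi b m0.
    rewrite natrB ?count_size // /lb -/C.
    move: (count (sat_clause b) phi)%:R => t tv.
    have : rho * t <= rho * (val_sat R phi * (size phi)%:R) by apply: ler_wpM2l => //; exact: ltW.
    by lra.
  rewrite -powRM; last 2 first.
  - by rewrite divr_ge0 //; lra.
  - by apply: mulr_ge0; lra.
  have -> : (C + rho * (1 - s)) / D * ((size phi)%:R * D) = (size phi)%:R * (C + rho * (1 - s)).
    by field; lra.
  apply: gt0_ltr_powR => //; rewrite ?nnegrE ?invr_gt0 //.
  by apply: mulr_ge0 => //; exact: ltW.
Qed.

End Part1.

(** * Integer gadgets *)

Section PowerContinuity.
Variable R : realType.
Implicit Types (p a : R).

(** Away from 0 the power is differentiable; at 0, [p >= 1] gives $|u|^p\le|u|$ for small $u$. *)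
Lemma cvg_norm_powR (T : Type) (F : set_system T) (u : T -> R) a p : Filter F -> 1 <= p ->
  u x @[x --> F] --> a -> `|u x| `^ p @[x --> F] --> `|a| `^ p.
Proof.
move=> FF p1 ua; have p0 : 0 < p by exact: lt_le_trans p1.
have [a0|a0] := eqVneq a 0; last first.
  apply: (@continuous_cvg _ _ _ F FF (fun x => `|u x|) (fun z => z `^ p)); last exact: cvg_norm.
  apply: differentiable_continuous; apply/derivable1_diffP.
  by apply: ex_derive; apply: is_derive1_powR; rewrite normr_gt0.
rewrite a0 normr0 powR0 ?gt_eqF //.
have u0 : u x @[x --> F] --> 0 by rewrite -a0.
apply/cvgr0Pnorm_le => e e0.
have e1 : 0 < Num.min e 1 by rewrite lt_min e0 ltr01.
move/cvgr0Pnorm_le : u0 => /(_ _ e1); apply: filterS => x.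
rewrite le_min => /andP[ue u1]; rewrite ger0_norm ?powR_ge0 //.
apply: le_trans ue; rewrite -[leRHS]powRr1 // -!/(powR _ _).
have [-> |ux] := eqVneq (u x) 0; first by rewrite normr0 !powR0 ?gt_eqF.
by apply: ger_powR => //; rewrite u1 normr_gt0 ux.
Qed.

Lemma cvg_round (z : nat -> int) (v : R) : (forall S, `|(z S)%:~R - S%:R * v| <= 1) ->
  (z S)%:~R / S%:R @[S --> \oo] --> v.
Proof.
move=> H; apply/cvgrPdist_le => e e0; near=> S.
have Se : e^-1 <= S%:R by near: S; exact: nbhs_infty_ger.
have S0 : 0 < S%:R :> R by apply: lt_le_trans Se; rewrite invr_gt0.
have -> : v - (z S)%:~R / S%:R = - ((z S)%:~R - S%:R * v) / S%:R by field; rewrite gt_eqF.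
rewrite normrM normrN normfV (gtr0_norm S0) ler_pdivrMr //.
by apply: le_trans (H S) _; rewrite mulrC -ler_pdivrMr // div1r.
Unshelve. all: by end_near.
Qed.

Lemma floor_round (v : R) (S : nat) : `|(Num.floor (S%:R * v))%:~R - S%:R * v| <= 1.
Proof.
have /andP[h1 h2] := floor_itv (S%:R * v); rewrite intrD in h2.
by rewrite ler_norml; apply/andP; split; lra.
Qed.

Lemma ceil_round (v : R) (S : nat) : `|(Num.floor (S%:R * v) + 1)%:~R - S%:R * v| <= 1.
Proof.
have /andP[h1 h2] := floor_itv (S%:R * v); rewrite intrD in h2 *.
by rewrite ler_norml; apply/andP; split; lra.
Qed.

End PowerContinuity.

Section GadgetCostMore.
Variable R : realType.
Implicit Types (p c : R) (y : nat -> R).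

Lemma gadget_cost_scale p k L (al : nat -> nat -> R) (be : nat -> R) c y : 0 <= c ->
  gadget_cost p k L (fun g i => c * al g i) (fun g => c * be g) y =
  c `^ p * gadget_cost p k L al be y.
Proof.
move=> c0; rewrite /gadget_cost mulr_sumr; apply: eq_bigr => g _.
rewrite -powRM // -[in RHS](ger0_norm c0) -normrM mulrDr mulr_sumr.
by under eq_bigr do rewrite -mulrA.
Qed.

Lemma gadget_cost_eq p k L al be al' be' y y' :
  (forall g i, (g < L)%N -> (i < k)%N -> al g i = al' g i :> R) ->
  (forall g, (g < L)%N -> be g = be' g) -> (forall i, (i < k)%N -> y i = y' i) ->
  gadget_cost p k L al be y = gadget_cost p k L al' be' y'.
Proof.
move=> ha hb hy; apply: eq_bigr => g _; rewrite hb //; congr (`|_ + _| `^ _).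
by apply: eq_bigr => i _; rewrite ha // hy.
Qed.

Lemma cvg_gadget_cost (T : Type) (F : set_system T) p k L (al : T -> nat -> nat -> R)
    (be : T -> nat -> R) al0 be0 y : Filter F -> 1 <= p ->
  (forall g i, al S g i @[S --> F] --> al0 g i) -> (forall g, be S g @[S --> F] --> be0 g) ->
  gadget_cost p k L (al S) (be S) y @[S --> F] --> gadget_cost p k L al0 be0 y.
Proof.
move=> FF p1 ha hb; rewrite /gadget_cost.
apply: cvg_big => [|g _]; first exact: add_continuous.
apply: cvg_norm_powR => //; apply: cvgD; last exact: hb.
apply: cvg_big => [|i _]; first exact: add_continuous.
by apply: cvgMl; exact: ha.
Qed.

End GadgetCostMore.

Section IntegerGadget.
Variables (R : realType) (p rho : R) (k L0 : nat) (al0 : nat -> nat -> R) (be0 : nat -> R).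
Hypotheses (p1 : 1 <= p) (rho0 : 0 < rho).
Hypothesis G : forall y : nat -> R, (forall i, (i < k)%N -> y i = 1 \/ y i = -1) ->
  gadget_cost p k L0 al0 be0 y = 1 + rho * [forall i : 'I_k, y i == -1]%:R.
Local Notation w := (pen_weight p rho).
Local Notation C := (sat_cost p rho k).

(** The penalty weight is rounded up: the far case concerns infinitely many [y], out of reach of a
    limit, but it is monotone in this weight. The other coefficients are controlled at sign vectors,
    by a limit. *)
Definition int_al (S : nat) (g i : nat) : int :=
  if (g < L0)%N then Num.floor (S%:R * al0 g i)
  else if (g - L0)%N == i then Num.floor (S%:R * w) + 1 else 0.
Definition int_be (S : nat) (g : nat) : int :=
  if (g < L0)%N then Num.floor (S%:R * be0 g) else 0.
Local Notation alR S := (fun g i => (int_al S g i)%:~R : R).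
Local Notation beR S := (fun g => (int_be S g)%:~R : R).
Local Notation L := (L0 + k)%N.

Lemma int_alE S : alR S =
  pen_al L0 (fun g i => (Num.floor (S%:R * al0 g i))%:~R) (Num.floor (S%:R * w) + 1)%:~R.
Proof.
apply/funext => g; apply/funext => i; rewrite /int_al /pen_al.
by case: ifP => // _; case: ifP.
Qed.

Lemma int_beE S : beR S = pen_be L0 (fun g => (Num.floor (S%:R * be0 g))%:~R).
Proof. by apply/funext => g; rewrite /int_be /pen_be; case: ifP. Qed.

Lemma int_weight_ge S : S%:R * w <= (Num.floor (S%:R * w) + 1)%:~R.
Proof. by have /andP[_ /ltW] := floor_itv (S%:R * w). Qed.

Lemma int_weight_gt0 S : 0 < (Num.floor (S%:R * w) + 1)%:~R :> R.
Proof.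
have /andP[_ h] := floor_itv (S%:R * w); apply: le_lt_trans h.
by apply: mulr_ge0 => //; exact: ltW (pen_weight_gt0 p1 rho0).
Qed.

Lemma int_far S (y : nat -> R) : (forall i, (i < k)%N -> 1 <= `|y i|) ->
  (exists2 i, (i < k)%N & 3 <= `|y i|) ->
  S%:R `^ p * (C + rho) <= gadget_cost p k L (alR S) (beR S) y.
Proof.
move=> y1 y3; have p00 : 0 <= p by exact: le_trans p1.
rewrite int_alE int_beE; apply: le_trans (penalty_far _ _ _ (int_weight_gt0 S) p00 y1 y3).
have -> : C + rho = w `^ p * (k%:R + 3 `^ p - 1).
  rewrite /sat_cost (pen_weightE p1 rho0); have := pow3_ge3 p1 => p3; field; lra.
have w0 := ltW (pen_weight_gt0 p1 rho0).
rewrite mulrA -powRM //; apply: ler_wpM2r.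
  by have := pow3_ge3 p1; have : 0 <= k%:R :> R by []; lra.
by apply: ge0_ler_powR => //; rewrite ?nnegrE ?mulr_ge0 ?int_weight_ge // ltW // int_weight_gt0.
Qed.

Lemma int_pm1 (eps : R) : 0 < eps -> \forall S \near \oo, forall y : nat -> R,
  (forall i, (i < k)%N -> y i = 1 \/ y i = -1) ->
  `|gadget_cost p k L (pen_al L0 al0 w) (pen_be L0 be0) y * S%:R `^ p
    - gadget_cost p k L (alR S) (beR S) y| <= eps * S%:R `^ p.
Proof.
move=> eps0.
pose yb (b : {ffun 'I_k -> bool}) (i : nat) : R :=
  if (insub i : option 'I_k) is Some i' then (if b i' then 1 else -1) else 0.
have H (b : {ffun 'I_k -> bool}) : \forall S \near \oo,
    `|gadget_cost p k L (pen_al L0 al0 w) (pen_be L0 be0) (yb b)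
      - gadget_cost p k L (fun g i => alR S g i / S%:R) (fun g => beR S g / S%:R) (yb b)| <= eps.
  apply: cvgr_dist_le => //; apply: cvg_gadget_cost => // [g i|g].
    rewrite /int_al /pen_al; case: ifP => _; first exact: cvg_round (floor_round _).
    case: ifP => _; first exact: cvg_round (ceil_round _).
    by under eq_fun do rewrite mul0r; exact: cvg_cst.
  rewrite /int_be /pen_be; case: ifP => _; first exact: cvg_round (floor_round _).
  by under eq_fun do rewrite mul0r; exact: cvg_cst.
(* There are finitely many sign vectors, so one threshold for [S] serves them all. *)
have {}H := filter_forall _ H.
near=> S => y yE.
have S0 : 0 < S%:R :> R by rewrite ltr0n; near: S; exact: nbhs_infty_gt.
have HS : forall b, `|gadget_cost p k L (pen_al L0 al0 w) (pen_be L0 be0) (yb b)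
      - gadget_cost p k L (fun g i => alR S g i / S%:R) (fun g => beR S g / S%:R) (yb b)| <= eps.
  by near: S; exact: H.
pose b := [ffun i : 'I_k => y i == 1].
have yyb i : (i < k)%N -> y i = yb b i.
  move=> ik; rewrite /yb insubT ffunE /=; case: (yE i ik) => ->; rewrite ?eqxx //.
  by rewrite (_ : (-1 == 1 :> R) = false) //; apply/eqP => ?; lra.
have e1 al be : gadget_cost p k L al be y = gadget_cost p k L al be (yb b).
  exact: gadget_cost_eq.
have e2 : gadget_cost p k L (alR S) (beR S) y = S%:R `^ p *
    gadget_cost p k L (fun g i => alR S g i / S%:R) (fun g => beR S g / S%:R) y.
  rewrite -gadget_cost_scale //; apply: gadget_cost_eq => // [g i _ _|g _];
  by rewrite mulrC divfK // gt_eqF.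
rewrite e2 !e1 [_ * S%:R `^ p]mulrC -mulrBr normrM mulrC (ger0_norm (powR_ge0 S%:R p)).
by rewrite ler_wpM2r ?powR_ge0.
Unshelve. all: by end_near.
Qed.

(** The freedom in [M] allows distances to be made large compared with the steps of an integer
    radius. *)
Lemma integer_gadget (eps M : R) : 0 < eps -> exists S : nat, [/\ (0 < S)%N, M <= S%:R,
  (forall y : nat -> R, (forall i, (i < k)%N -> y i = 1 \/ y i = -1) ->
    (exists2 i, (i < k)%N & y i = 1) ->
    (C - eps) * S%:R `^ p <= gadget_cost p k L (alR S) (beR S) y <= (C + eps) * S%:R `^ p),
  (forall y : nat -> R, (forall i, (i < k)%N -> y i = -1) ->
    (C + rho - eps) * S%:R `^ p <= gadget_cost p k L (alR S) (beR S) y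
      <= (C + rho + eps) * S%:R `^ p) &
  (forall y : nat -> R, (forall i, (i < k)%N -> 1 <= `|y i|) ->
    (exists2 i, (i < k)%N & 3 <= `|y i|) ->
    (C + rho - eps) * S%:R `^ p <= gadget_cost p k L (alR S) (beR S) y)].
Proof.
move=> eps0; near \oo => S; exists S.
have H : forall y : nat -> R, (forall i, (i < k)%N -> y i = 1 \/ y i = -1) ->
  `|gadget_cost p k L (pen_al L0 al0 w) (pen_be L0 be0) y * S%:R `^ p
    - gadget_cost p k L (alR S) (beR S) y| <= eps * S%:R `^ p.
  by near: S; exact: int_pm1.
split.
- by near: S; exact: nbhs_infty_gt.
- by near: S; exact: nbhs_infty_ger.
- move=> y yE y1; have := H y yE; have /andP[h1 h2] := penalised_sat p1 rho0 G yE y1.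
  have -> : gadget_cost p k L (pen_al L0 al0 w) (pen_be L0 be0) y = C by apply/le_anti; rewrite h1 h2.
  by rewrite ler_norml => /andP[]; lra.
- move=> y yE; have yE' : forall i, (i < k)%N -> y i = 1 \/ y i = -1 by move=> i ik; right; exact: yE.
  have := H y yE'; have /andP[h1 h2] := penalised_unsat p1 rho0 G yE.
  have -> : gadget_cost p k L (pen_al L0 al0 w) (pen_be L0 be0) y = C + rho by apply/le_anti; rewrite h1 h2.
  by rewrite ler_norml => /andP[]; lra.
- move=> y y1 y3; apply: le_trans (int_far S y1 y3).
  rewrite mulrC; apply: ler_wpM2l; [exact: powR_ge0|lra].
Unshelve. all: by end_near.
Qed.

Lemma int_rows S i : (i < k)%N -> exists2 g, (g < L)%N & forall i', (i' < k)%N ->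
  alR S g i' = if i' == i then (Num.floor (S%:R * w) + 1)%:~R else 0.
Proof.
move=> ik; exists (L0 + i)%N; first by rewrite ltn_add2l.
move=> i' ik'; rewrite /int_al ltnNge leq_addr /= addKn eq_sym.
by case: ifP.
Qed.

End IntegerGadget.

(** * From CVP to Gap-SAT *)

Section Morphism.
Variables (K K' : comUnitRingType) (f : {rmorphism K -> K'}) (k L : nat).
Variables (al : nat -> nat -> K) (be : nat -> K) (n : nat) (phi : formula k n).

Lemma rmorph_sgn c : f (sgn K c) = sgn K' c.
Proof. by rewrite /sgn; case: odd; rewrite ?rmorphN1 ?rmorph1. Qed.

Lemma rmorph_B_entry i j :
  f (B_entry L al phi i j) = B_entry L (fun g i => f (al g i)) phi i j.
Proof.
rewrite /B_entry; case: ifP => _; last by rewrite rmorph_nat.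
rewrite /row_entry rmorph_sum; apply: eq_bigr => x _.
by case: ifP => _; rewrite ?rmorph0 // !rmorphM rmorph_nat rmorph_sgn.
Qed.

Lemma rmorph_t_entry i :
  f (t_entry L al be phi i) = t_entry L (fun g i => f (al g i)) (fun g => f (be g)) phi i.
Proof.
rewrite /t_entry; case: ifP => _; last by rewrite rmorph0.
rewrite /row_target rmorphB rmorph_sum; congr (_ - _).
by apply: eq_bigr => x _; rewrite rmorphM rmorph_sgn.
Qed.

End Morphism.

Lemma is_polyS f : is_poly f -> is_poly (fun V => (f V).+1).
Proof.
move=> pf; apply: (is_poly_le (g := fun V => (f V + 1)%N)); first by move=> V; rewrite addn1.
by apply: is_polyD => //; exact: is_polyC.
Qed.

Ltac poly := repeat first [exact: is_polyC | exact: is_poly_id | exact: is_poly_scost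
  | exact: is_poly_ebd | apply: is_poly_fcost | apply: is_polyD | apply: is_polyM
  | apply: is_polyS].

(** * Transfer of the running time *)

Section SatFromCvp.
Variables (R : realType) (p : R) (k L : nat) (al : nat -> nat -> int) (be : nat -> int).
Variables (P : prog R) (gamma eps : R) (a E F K : nat).
Hypotheses (L0 : (0 < L)%N) (p1 : 1 <= p) (dP : discrete P) (E0 : (0 < E)%N) (F0 : (0 < F)%N)
  (eps1 : eps <= 1).
Hypothesis alg : forall (n d : nat) (B : 'M[rat]_(d, n)) (t : 'cV[rat]_d) (r : rat),
  let B' := map_mx (ratr : rat -> R) B in
  let t' := map_mx (ratr : rat -> R) t in
  let r' : R := ratr r in
  cvp_instance B' t' r' ->
  decides_within P eps n a (word_size (enc_cvp B t r)) (enc_cvp B t r)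
    (cvp_yes p B' t' r') (cvp_no p gamma B' t' r').
Local Notation alR := (fun g i => (al g i)%:~R : R).
Local Notation beR := (fun g => (be g)%:~R : R).
Hypothesis rowf : forall n (psi : formula k n), row_free (B_mx L alR psi)^T.

Definition sat_dist n (psi : formula k n) : R :=
  dist p (lattice (B_mx L alR psi)) (t_mx L alR beR psi).

Definition Vb (A : nat) : nat :=
  (2 * A + 3 + (2 + k * A) + (5 + 3 * ((L * A + A) + (L * A + A) * A))
   + (K * A + 2) * (E + F + 1))%N.

Definition wsize_bound (V : nat) : nat := (V * (ebd (eword k L al be) V).+1)%N.

(** Every cell of the word is the value of [eword] in a memory bounded by [V], so [ebd] bounds
    it. *)
Lemma word_size_le n (psi : formula k n) V r : (2 * (n + size psi) + 2 <= V)%N ->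
  (wordlen L psi <= V)%N -> (r <= V)%N -> (word_size (word L al be psi r) <= wsize_bound V)%N.
Proof.
move=> V1 V2 rV; rewrite /word_size (big_nth 0%N) size_word //.
apply: (@leq_trans (\sum_(0 <= i < wordlen L psi) (ebd (eword k L al be) V).+1)%N); last first.
  by rewrite sum_nat_const_nat subn0 leq_mul2r V2 orbT.
rewrite !big_nat; apply: leq_sum => x /andP[_ xl].
apply: leq_trans (bits_le _) _; rewrite ltnS.
(* An artificial memory made of just the arrays that [eword] reads. *)
pose f b i := if b == 0%N then nth 0%N (enc_formula psi) i else if b == 2%N then used psi i : nat
  else if b == 4%N then x else if b == 20%N then r else 0%N.
rewrite -(@eword_eval k L al be L0 n psi f r x) //; apply: neval_bd; last exact: eword_wf.
move=> b i _; rewrite /f; case: ifP => _.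
  exact: leq_trans (enc_formula_le psi i) V1.
case: ifP => _; first by apply: (@leq_trans 1); [case: used|lia].
case: ifP => _; first by apply: ltnW; exact: leq_trans xl V2.
by case: ifP.
Qed.

Lemma oracle_run n (psi : formula k n) V r : (2 * (n + size psi) + 2 <= V)%N ->
  (wordlen L psi <= V)%N -> (0 < r <= V)%N ->
  exists N0 st, [/\ exec P (init_state R (word L al be psi r)) N0 st,
    (N0 <= Num.truncn (2 `^ ((1 - eps) * n%:R) * (poly_bound a (wsize_bound V))%:R))%N,
    sat_dist psi <= r%:R -> accepting st & gamma * r%:R < sat_dist psi -> ~ accepting st].
Proof.
move=> V1 V2 /andP[r0 rV].
pose Bq := map_mx (intr : int -> rat) (B_mx L al psi).
pose tq := map_mx (intr : int -> rat) (t_mx L al be psi).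
have BE : map_mx (ratr : rat -> R) Bq = B_mx L alR psi.
  by apply/matrixP => i j; rewrite !mxE ratr_int -(rmorph_B_entry (intr : {rmorphism int -> R})).
have tE : map_mx (ratr : rat -> R) tq = t_mx L alR beR psi.
  by apply/matrixP => i j; rewrite !mxE ratr_int -(rmorph_t_entry (intr : {rmorphism int -> R})).
have rE : ratr (r%:R : rat) = r%:R :> R by rewrite ratr_nat.
have := @alg n _ Bq tq r%:R; rewrite /= BE tE rE => /(_ _)[|N0 [st [x c yes no]]].
  by split => //; rewrite ltr0n.
exists N0, st; split => //.
rewrite truncn_ge_nat; last by rewrite mulr_ge0 ?powR_ge0.
apply: le_trans c _; apply: ler_wpM2l; first exact: powR_ge0.
by rewrite ler_nat; apply: leq_poly_bound => //; exact: word_size_le.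
Qed.

Definition step_bound (V : nat) : nat :=
  (wcost k L al be V + 14 * V.+1 + (2 * V + 7))%N.
Definition iter_bound (V : nat) : nat :=
  (scost (NC 0) (eadd (NV 8) (NC 1)) V + scost (NC 0) (emul (NC E) (NV 8)) V + step_bound V)%N.
Definition cost_poly (V : nat) : nat :=
  (prepare_cost k K V + (V.+1 * (iter_bound V + 4) + 4)
   + (fcost (ecount k (NR 24 (NC 1))) V (scost (NV 4) esaved V) V
      + scost (NC 0) (emul (NC F) (NV 8)) V + scost (NC 0) (NC 0) V + step_bound V))%N.

Lemma is_poly_Vb : is_poly Vb. Proof. rewrite /Vb; poly. Qed.

Lemma is_poly_wsize : is_poly wsize_bound.
Proof. by apply: is_polyM; [exact: is_poly_id|apply: is_polyS; exact: is_poly_ebd]. Qed.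

Lemma is_poly_step : is_poly step_bound.
Proof. rewrite /step_bound /wcost; poly. Qed.

Lemma is_poly_cost : is_poly cost_poly.
Proof.
rewrite /cost_poly /iter_bound /prepare_cost; have := is_poly_step.
move: step_bound => f pf; repeat (first [exact: pf|progress poly]).
Qed.

(** Each simulated run is charged linearly in [NP] and all else is polynomial, so a single factor
    [NP.+1] can be taken out of the whole cost. *)
Lemma cost_polyP n (phi : formula k n) V NP : (K * size phi + 2 <= V)%N ->
  (sat_cost_bound L al be E F K phi V NP <= cost_poly V * NP.+1)%N.
Proof.
move=> JV; have bJ : (bits (K * size phi + 2) <= V.+1)%N.
  by apply: leq_trans (bits_le _) _; rewrite ltnS.
have rc : (run_cost L al be K phi V NP <= step_bound V * NP.+1)%N.
  rewrite /run_cost /step_bound; move: (wcost _ _ _ _ _) (bits _) bJ => W b bV.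
  have : (14 * b * NP <= 14 * V.+1 * NP)%N by rewrite leq_mul2r leq_mul2l bV !orbT.
  by nia.
have ic : (iter_cost L al be E K phi V NP <= iter_bound V * NP.+1)%N.
  by rewrite /iter_cost /iter_bound; move: (scost _ _ _) (scost _ _ _) (step_bound V) rc => x y z; nia.
rewrite /sat_cost_bound /finish_cost /cost_poly.
have Km : ((K * size phi).+1 <= V.+1)%N by lia.
have : ((K * size phi).+1 * (iter_cost L al be E K phi V NP + 4) <=
   V.+1 * ((iter_bound V + 4) * NP.+1))%N.
  by apply: leq_mul => //; move: ic; move: (iter_bound V) (iter_cost _ _ _ _ _ _ _ _) => x y; nia.
move: rc; move: (run_cost _ _ _ _ _ _ _) (step_bound V) => r1 r2.
move: (_.+1 * (iter_cost _ _ _ _ _ _ _ _ + 4))%N => i1.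
rewrite [(V.+1 * (_ * _))%N]mulnA; move: (V.+1 * (iter_bound V + 4))%N => i2.
have l v : (v <= v * NP.+1)%N by rewrite leq_pmulr.
move: (prepare_cost k K V) (fcost (ecount k (NR 24 (NC 1))) V (scost (NV 4) esaved V) V).
move: (scost (NC 0) (emul (NC F) (NV 8)) V) (scost (NC 0) (NC 0) V) => x y z t hr hi.
by have := l x; have := l y; have := l z; have := l t; rewrite !mulnDl; lia.
Qed.

Lemma sat_from_cvp : exists b, forall n (phi : formula k n), (0 < size phi)%N ->
  sat_dist (positive phi) <= (K * size phi)%:R ->
  exists N st q, [/\ exec (sat_prog k L al be P E F K) (init_state R (enc_formula phi)) N st,
    N%:R <= 2 `^ ((1 - eps) * n%:R) * (poly_bound b (n + size phi))%:R,
    [/\ (E * q.-1)%:R <= sat_dist (positive phi),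
        sat_dist (positive phi) <= gamma * (E * q)%:R & (0 < q)%N],
    sat_dist phi <= (F * q)%:R -> accepting st &
    gamma * (F * q)%:R < sat_dist phi -> ~ accepting st].
Proof.
have [b Hb] : is_poly (fun A => cost_poly (Vb A) * (poly_bound a (wsize_bound (Vb A)) + 1))%N.
  apply: is_polyM; first exact: is_poly_comp is_poly_cost is_poly_Vb.
  apply: is_polyD; last exact: is_polyC.
  apply: (is_poly_comp (f := fun V => poly_bound a (wsize_bound V))); last exact: is_poly_Vb.
  by apply: is_poly_comp is_poly_wsize; exists a.
exists b => n phi m0 DK; set m := size phi; set V := Vb (n + m).
have mA : (m <= n + m)%N by rewrite leq_addl.
have nA : (n <= n + m)%N by rewrite leq_addr.
have V1 : (2 * (n + m) + 3 <= V)%N.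
  by do 2![apply: leq_trans (leq_addr _ _)]; exact: leq_addr.
have V2 : (2 + k * m <= V)%N.
  do 2![apply: leq_trans (leq_addr _ _)]; apply: leq_trans (leq_addl _ _).
  by rewrite leq_add2l leq_mul2l mA orbT.
have V3 : (wordlen L phi <= V)%N.
  apply: leq_trans (leq_addr _ _); apply: leq_trans (leq_addl _ _).
  have h1 : (L * m + n <= L * (n + m) + (n + m))%N by rewrite leq_add // leq_mul2l mA orbT.
  by rewrite leq_add2l leq_mul2l /= leq_add // leq_mul.
have V4 : ((K * m + 2) * (E + F + 1) <= V)%N.
  apply: leq_trans (leq_addl _ _).
  by rewrite leq_mul2r leq_add2r leq_mul2l mA !orbT.
have EFV q : (0 < q < K * m + 2)%N -> (0 < E * q <= V)%N /\ (0 < F * q <= V)%N.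
  by move=> /andP[q0 qJ]; rewrite !muln_gt0 E0 F0 q0 /=; split; move: V4; nia.
set T := 2 `^ ((1 - eps) * n%:R); set W := poly_bound a (wsize_bound V).
(* Uses [eps <= 1]. An exponential factor of at least 1 absorbs the steps outside the simulated
   runs. *)
have T1 : 1 <= T.
  by rewrite /T -[leLHS](powRr0 (2 : R)) ler_powR ?ler1n // mulr_ge0 // subr_ge0.
pose NP := Num.truncn (T * W%:R).
have V1' : (2 * (n + m) + 2 <= V)%N by apply: leq_trans V1; rewrite leq_add2l.
have D0 : 0 <= sat_dist (positive phi).
  apply: le_trans (powR_ge0 0 p^-1) _; apply: dist_ge => // x; exact: cost_ge0.
have calib q : (0 < q < K * m + 2)%N -> exists N0 st,
  [/\ exec P (init_state R (word L al be (positive phi) (E * q))) N0 st, (N0 <= NP)%N,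
      sat_dist (positive phi) <= (E * q)%:R -> accepting st &
      gamma * (E * q)%:R < sat_dist (positive phi) -> ~ accepting st].
  move=> /EFV[h _]; apply: oracle_run => //; first by rewrite size_positive.
  by rewrite /wordlen size_positive.
have final q : (0 < q < K * m + 2)%N -> exists N0 st,
  [/\ exec P (init_state R (word L al be phi (F * q))) N0 st, (N0 <= NP)%N,
      sat_dist phi <= (F * q)%:R -> accepting st &
      gamma * (F * q)%:R < sat_dist phi -> ~ accepting st].
  by move=> /EFV[_ h]; apply: oracle_run.
have [N [st [q [x c [h1 [h2 h3]] yes no]]]] :=
  sat_prog_exec L0 dP E0 F0 V1 V2 V3 V4 D0 DK calib final.
exists N, st, q; split => //.
have JV : (K * m + 2 <= V)%N by apply: leq_trans V4; rewrite leq_pmulr // addn1.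
have NQ : (N <= cost_poly V * NP.+1)%N by apply: leq_trans c _; exact: cost_polyP.
apply: (@le_trans _ _ (T * (cost_poly V * (W + 1))%:R)); last first.
  apply: ler_wpM2l; first by apply: le_trans T1.
  by rewrite ler_nat; exact: Hb.
apply: (@le_trans _ _ (cost_poly V * NP.+1)%:R); first by rewrite ler_nat.
rewrite !natrM mulrCA; apply: ler_wpM2l => //.
have : NP%:R <= T * W%:R by rewrite truncn_le mulr_ge0 // (le_trans _ T1).
by rewrite -natr1 natrD; lra.
Qed.

End SatFromCvp.

(** The rounding error [e] may spread the cost of satisfied clauses by one factor [x], and may
    consume the eighth factor of the gap; the other seven remain for [exists_sat_algorithm]. *)
Lemma perturbation_bounds (R : realType) (C x : R) : 1 <= C -> 1 < x ->
  exists e, [/\ 0 < e, C / 2 <= C - e, C + e <= x * (C - e) & x ^+ 7 * (C + e) <= x ^+ 8 * C - e].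
Proof.
move=> C1 x1; have x0 : 0 < x by lra.
set y := x ^+ 7.
have xy : x <= y by rewrite /y exprS ler_peMr ?exprn_ege1; lra.
have -> : x ^+ 8 = x * y by rewrite exprS.
have [e [e0 eE]] : exists e, 0 < e /\ e * (2 * y) = C * (x - 1).
  exists (C * (x - 1) / (2 * y)); split; last by field; lra.
  by rewrite divr_gt0 ?mulr_gt0; lra.
exists e.
have h1 : e * (1 + x) <= e * (2 * y) by apply: ler_wpM2l; lra.
have h2 : C * (x - 1) <= y * (C * (x - 1)) by rewrite ler_peMl ?mulr_ge0; lra.
have h3 : e * 1 <= e * y by apply: ler_wpM2l; lra.
have h4 : e * (2 * x) <= e * (2 * y) by apply: ler_wpM2l; lra.
split => //; try lra.
have : (2 * e) * x <= C * x by lra.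
by rewrite ler_pM2r //; lra.
Qed.

(** * Choice of the constants *)

Section CvpHardness.
Variables (R : realType) (p : R) (k : nat) (delta : R).
Hypotheses (p1 : 1 <= p) (podd : forall z : int, p <> 2 * z%:~R).
Hypotheses (k0 : (0 < k)%N) (delta0 : 0 < delta).

(** The clause size given by Gap-SETH may be at most [p] or 2, so the ratio is taken from a larger
    [k'], which covers all orders up to [k]. *)
Lemma exists_gadget : exists (rho : R) (L0 : nat) (al0 : nat -> nat -> R) (be0 : nat -> R),
  0 < rho /\ forall y : nat -> R, (forall i, (i < k)%N -> y i = 1 \/ y i = -1) ->
    gadget_cost p k L0 al0 be0 y = 1 + rho * [forall i : 'I_k, y i == -1]%:R.
Proof.
pose k' := (k + Num.truncn p + 3)%N.
have pk : p < k'%:R by apply: lt_le_trans (truncnS_gt p) _; rewrite ler_nat /k' addn3 ltnS ltnW // ltnS ltnW // ltnS leq_addl.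
have k3 : (2 < k')%N by rewrite /k' addn3.
have kk' : (k <= k')%N by rewrite /k' -addnA leq_addr.
have rho0 := gap_const_gt0 p1 podd pk.
have [L0 [al0 [be0 G]]] := word_gadget p1 rho0
  (fun j (jk : (j <= k)%N) => difference_ratio p1 podd k3 pk (leq_trans jk kk')).
by exists (gap_const p k'), L0, al0, be0.
Qed.

(** Let $g=x^{1/p}$ be the factor of the CVP algorithm and $D'$ the distance of the positive
    formula. Then $U\le D'\le gU$ and $D'/g\le Eq\le gD'$. A satisfiable formula has distance at
    most $gU\le g^2Eq\le Fq$. One of value below $1-\delta$ has distance at least $g^7U$, whereas
    $g\cdot Fq\le g^4Eq\le g^5D'\le g^6U$. *)
Lemma exists_sat_algorithm : exists gamma : R, 1 < gamma /\ forall (eps : R) (P : prog R),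
  eps <= 1 -> cvp_algorithm p gamma eps P -> exists P', gap_sat_algorithm k delta eps P'.
Proof.
have p10 := p1; have d00 := delta0; have p0 : 0 < p by lra.
have [rho [L0 [al0 [be0 [rho0 G]]]]] := exists_gadget.
have [C [C1 CE]] : exists C : R, 1 <= C /\ C = sat_cost p rho k.
  by eexists; split; last reflexivity; rewrite /sat_cost lerDl mulr_ge0 ?powR_ge0.
have C0 : 0 < C by lra.
(* The eighth root of the gap $1+\delta\rho/C$. *)
have [x [x1 x8]] : exists x : R, 1 < x /\ x ^+ 8 * C = C + delta * rho.
  have h1 : 1 < 1 + delta * rho / C by rewrite ltrDl divr_gt0 ?mulr_gt0.
  exists (expR (ln (1 + delta * rho / C) / 8)); split.
    by rewrite expR_gt1 divr_gt0 // ln_gt0.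
  rewrite -expRM_natl [8%:R * _]mulrC divfK ?pnatr_eq0 // lnK; last by rewrite posrE; lra.
  by field; lra.
have [e [e0 eC A1 A2]] := perturbation_bounds C1 x1.
rewrite x8 in A2.
have x0 : 0 < x by lra.
have ip0 : 0 < p^-1 by rewrite invr_gt0.
have [g [g1 gE]] : exists g, 1 < g /\ g = x `^ p^-1.
  eexists; split; last reflexivity.
  by rewrite /powR gt_eqF // expR_gt1 mulr_gt0 // ln_gt0.
have g0 : 0 < g by lra.
have h32 : 0 < g ^+ 3 - g ^+ 2.
  have -> : g ^+ 3 - g ^+ 2 = g ^+ 2 * (g - 1) by ring.
  by rewrite mulr_gt0 ?exprn_gt0 //; lra.
(* The interval from $Eg^2$ to $Eg^3$ has to contain an integer, the [F] below. *)
have [E [E0 E1]] : exists E, (0 < E)%N /\ 1 <= E%:R * (g ^+ 3 - g ^+ 2).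
  exists (Num.truncn (g ^+ 3 - g ^+ 2)^-1).+1; split => //.
  have := truncnS_gt (g ^+ 3 - g ^+ 2)^-1; rewrite -[X in X < _]mul1r ltr_pdivrMr //.
  exact: ltW.
have [F [F0 F1 F2]] : exists F, [/\ (0 < F)%N, E%:R * g ^+ 2 <= F%:R & F%:R <= E%:R * g ^+ 3].
  have t1 := truncnS_gt (E%:R * g ^+ 2).
  have t2 : (Num.truncn (E%:R * g ^+ 2))%:R <= E%:R * g ^+ 2.
    by rewrite truncn_le mulr_ge0 // exprn_ge0 // ltW.
  exists (Num.truncn (E%:R * g ^+ 2)).+1; split => //; first exact: ltW.
  by rewrite -natr1; lra.
(* Since $D'\ge S/2$ will hold, this scale makes one step [E] of the candidate radius at most
   $(g-1)D'$. *)
have [S [S0 SM H1 H2 H3]] := integer_gadget p1 rho0 G (2 * E%:R / (g - 1)) e0.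
rewrite -CE in H1 H2 H3.
pose al := int_al p rho L0 al0 S; pose be := int_be L0 be0 S; pose L := (L0 + k)%N.
have [T [T0 TE]] : exists T : R, 0 < T /\ T = S%:R `^ p.
  by eexists; split; last reflexivity; apply: powR_gt0; rewrite ltr0n.
rewrite -TE in H1 H2 H3.
(* [K] bounds the cost of a satisfied clause, so that $D'\le Km$ and the search takes linearly many
   rounds. *)
have [K [K0 CK]] : exists K, (0 < K)%N /\ (C + e) * T <= K%:R.
  by exists (Num.truncn ((C + e) * T)).+1; split => //; apply: ltW; exact: truncnS_gt.
have L00 : (0 < L)%N by rewrite /L addn_gt0 k0 orbT.
have rowf n (psi : formula k n) : row_free (B_mx L (fun g i => (al g i)%:~R : R) psi)^T.
  apply: (instance_row_free (fun=> 0)); last by move=> i; exact: int_rows.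
  by rewrite gt_eqF // int_weight_gt0.
exists g; split => // eps P eps1 [dP [a alg]].
have [b Hb] := @sat_from_cvp R p k L al be P g eps a E F K L00 p1 dP E0 F0 eps1 alg rowf.
exists (sat_prog k L al be P E F K); split; first exact: discrete_sat_prog.
exists b => n phi m0; set m := size phi in m0 *.
pose sd n (psi : formula k n) := sat_dist p L al be psi.
have mR : 1 <= m%:R :> R by rewrite ler1n.
have C13 : (C - e) * T <= (C + rho - e) * T by rewrite ler_pM2r //; lra.
have [u [u0 uE]] : exists u, 0 < u /\ u = m%:R * (T * (C - e)).
  by eexists; split; last reflexivity; rewrite !mulr_gt0 //; lra.
have [U [U0 UE]] : exists U, 0 < U /\ U = u `^ p^-1.
  by eexists; split; last reflexivity; exact: powR_gt0.
have mono (v w : R) : 0 <= v -> v <= w -> v `^ p^-1 <= w `^ p^-1.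
  by move=> v0 vw; apply: ge0_ler_powR; rewrite ?nnegrE //; [exact: ltW|exact: le_trans vw].
have gU : g * U = (x * u) `^ p^-1 by rewrite UE gE powRM // ltW.
have g7 : g ^+ 7 = (x ^+ 7) `^ p^-1.
  by rewrite gE -(powR_mulrn 7 (powR_ge0 x p^-1)) -powRrM mulrC powRrM powR_mulrn // ltW.
have C2le : m%:R * ((C + e) * T) <= x * u.
  have -> : x * u = m%:R * (x * (C - e) * T) by rewrite uE; ring.
  by apply: ler_wpM2l; [lra|rewrite ler_pM2r].
have C20 : 0 <= m%:R * ((C + e) * T) by rewrite !mulr_ge0 //; lra.
have up (psi : formula k n) (c : {ffun 'I_n -> bool}) : size psi = m -> all (sat_clause c) psi ->
    sd n psi <= (m%:R * ((C + e) * T)) `^ p^-1.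
  move=> sz sc; have [z cz] := cost_assignment p1 psi H1 H2 c.
  apply: (dist_le p1 (x := z)); apply: le_trans cz _.
  by move: sc; rewrite all_count sz => /eqP ->; rewrite subnn mul0r addr0.
have low (psi : formula k n) (c v : R) : size psi = m ->
    (forall b : {ffun 'I_n -> bool}, (count (sat_clause b) psi)%:R <= c) ->
    0 <= v -> v <= m%:R * ((C + rho - e) * T) - c * (rho * T) -> v `^ p^-1 <= sd n psi.
  move=> sz cc v0 vle; apply: (dist_ge p1) => // z.
  have [c' cE] := cost_lattice p1 psi H1 H2 H3 C13 z.
  apply: le_trans cE; apply: le_trans vle _.
  rewrite natrB ?count_size // sz; have := cc c'; move: (count _ _)%:R => t tc.
  have : t * (rho * T) <= c * (rho * T) by rewrite ler_pM2r // mulr_gt0.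
  by lra.
have spos : size (positive phi) = m := size_positive phi.
have D'up0 := up _ _ spos (sat_positive phi k0).
have D'up : sd n (positive phi) <= g * U.
  by apply: le_trans D'up0 _; rewrite gU; exact: mono.
have D'low : U <= sd n (positive phi).
  rewrite UE; apply: (low _ m%:R) => //; [by move=> c; rewrite ler_nat -spos count_size|exact: ltW|].
  by rewrite uE; lra.
have D'K : sat_dist p L al be (positive phi) <= (K * size phi)%:R.
  apply: le_trans D'up0 _; rewrite natrM [K%:R * _]mulrC.
  have mK1 : 1 <= m%:R * K%:R :> R by rewrite -natrM ler1n muln_gt0 m0 K0.
  apply: (@le_trans _ _ ((m%:R * K%:R) `^ p^-1)); first by apply: mono => //; rewrite ler_wpM2l.
  apply: (@le_trans _ _ ((m%:R * K%:R) `^ 1)); first by apply: ler_powR => //; rewrite invf_le1.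
  by rewrite powRr1 // (le_trans ler01 mK1).
(* $(S/2)^p\le S^p/2\le u$, as $p\ge1$ and $C-e\ge C/2\ge1/2$. *)
have S2U : S%:R / 2 <= U.
  have S20 : 0 <= S%:R / 2 :> R by rewrite divr_ge0.
  have -> : S%:R / 2 = ((S%:R / 2) `^ p) `^ p^-1 by rewrite -powRrM mulfV ?gt_eqF // powRr1.
  rewrite UE; apply: mono; first exact: powR_ge0.
  rewrite powRM // -TE.
  have : 2^-1 `^ p <= 2^-1 :> R.
    by rewrite -[leRHS]powRr1 ?invr_ge0 // ger_powR // invr_gt0 ltr0n /= invf_le1 ?ler1n.
  move=> h2; apply: (@le_trans _ _ (T * 2^-1)); first by rewrite ler_pM2l.
  rewrite uE; apply: (@le_trans _ _ (1 * (T * (C - e)))); last by rewrite ler_pM2r // mulr_gt0 //; lra.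
  by rewrite mul1r ler_pM2l //; lra.
have ED' : E%:R <= (g - 1) * sd n (positive phi).
  have g10 : 0 < g - 1 by lra.
  have : 2 * E%:R / (g - 1) <= 2 * sd n (positive phi) by lra.
  by rewrite ler_pdivrMr //; lra.
have [N [st [q [ex cN [q1 q2 q0] yes no]]]] := Hb n phi m0 D'K.
exists N, st; split => //.
- move=> [c sc]; apply: yes.
  apply: le_trans (up phi c erefl sc) _.
  apply: (@le_trans _ _ (g * U)); first by rewrite gU; exact: mono.
  apply: (@le_trans _ _ (g * (g * (E%:R * q%:R)))).
    rewrite ler_pM2l //; apply: le_trans D'low _; rewrite -natrM; exact: q2.
  have -> : g * (g * (E%:R * q%:R)) = E%:R * g ^+ 2 * q%:R by ring.
  by rewrite natrM ler_wpM2r.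
- move=> vs; apply: no.
  have cc (c' : {ffun 'I_n -> bool}) : (count (sat_clause c') phi)%:R <= (1 - delta) * m%:R.
    apply: le_trans (count_val R c' m0) _; rewrite ler_wpM2r //; exact: ltW.
  apply: (@lt_le_trans _ _ (g ^+ 7 * U)); last first.
    have x70 : 0 <= x ^+ 7 by apply: exprn_ge0; exact: ltW.
    have u00 := ltW u0; have -> : g ^+ 7 * U = (x ^+ 7 * u) `^ p^-1 by rewrite g7 UE powRM.
    apply: (low _ ((1 - delta) * m%:R)) => //; first exact: mulr_ge0.
    have : x ^+ 7 * (C - e) <= C + delta * rho - e.
      by apply: le_trans A2; rewrite ler_wpM2l ?exprn_ge0 //; lra.
    rewrite uE -(ler_pM2l T0) -(ler_pM2l (lt_le_trans ltr01 mR)); lra.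
  have Eq : (E * q)%:R <= g * sd n (positive phi).
    have -> : (E * q)%:R = (E * q.-1)%:R + E%:R :> R by rewrite -natrD -mulnSr prednK.
    by move: q1 ED'; rewrite -/(sd n _); lra.
  apply: (@le_lt_trans _ _ (g ^+ 6 * U)); last by rewrite ltr_pM2r // [g ^+ 7]exprS ltr_pMl // exprn_gt0.
  have -> : g ^+ 6 * U = g ^+ 5 * (g * U) by ring.
  apply: (@le_trans _ _ (g ^+ 5 * sd n (positive phi))); last by rewrite ler_pM2l // exprn_gt0.
  have -> : g ^+ 5 * sd n (positive phi) = g ^+ 4 * (g * sd n (positive phi)) by ring.
  apply: (@le_trans _ _ (g ^+ 4 * (E * q)%:R)); last by rewrite ler_pM2l // exprn_gt0.
  have -> : g ^+ 4 * (E * q)%:R = g * (E%:R * g ^+ 3 * q%:R) by rewrite natrM; ring.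
  by rewrite ler_pM2l // natrM ler_wpM2r.
Qed.

End CvpHardness.

Lemma cvp_algorithm_le (R : realType) (p gamma eps eps' : R) (P : prog R) : eps' <= eps ->
  cvp_algorithm p gamma eps P -> cvp_algorithm p gamma eps' P.
Proof.
move=> ee [dP [a alg]]; split => //; exists a => n d B t r B' t' r' inst.
have [N [st [x c yes no]]] := alg n d B t r inst; exists N, st; split => //.
apply: le_trans c _; rewrite ler_wpM2r // ler_powR ?ler1n // ler_wpM2r //; lra.
Qed.

Theorem theorem4p2 (R : realType) :
  (forall (p : R) (k : nat) (s c : R),
     1 <= p -> (forall z : int, p <> 2 * z%:~R) ->
     Num.max 2 p < k%:R ->
     1 - 2 ^- k < s -> s <= c -> c <= 1 ->
     exists gamma : R,
       1 + (2 ^+ (k - 1)) / (2 ^+ k - 1) * (c - s)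
           * (`|sin (pi * p / 2)| / (4 * p ^+ 3 * k%:R))
           * ((2 * p) / ((expR 1) ^+ 2 * pi ^+ 2 * k%:R)) `^ ((p + 1) / 2)
         <= gamma
       /\ karp_reduction_gapsat_cvp k s c p gamma)
  /\
  (Gap_SETH R ->
   forall p eps : R,
     1 <= p -> (forall z : int, p <> 2 * z%:~R) -> 0 < eps ->
     exists gamma : R,
       1 < gamma /\ ~ exists P : prog R, cvp_algorithm p gamma eps P).
Proof.
split=> [p k s c p1 podd kmax hs hsc hc|seth p eps p1 podd eps0].
  exact: karp_reduction_exists.
(* For [eps] above 1 the exponent of the allowed time would be negative. Lowering [eps] only allows
   more time, so the assumed algorithm still qualifies. *)
pose eps' := Num.min eps 1.
have eps'0 : 0 < eps' by rewrite lt_min eps0 ltr01.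
have [k [delta [k0 delta0 hard]]] := seth eps' eps'0.
have [gamma [gamma1 alg]] := exists_sat_algorithm p1 podd k0 delta0.
exists gamma; split => // -[P Palg]; apply: hard.
apply: (alg eps' P); first by rewrite ge_min lexx orbT.
by apply: cvp_algorithm_le Palg; rewrite ge_min lexx.
Qed.
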